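(* Let $X\subseteq\mathbb{R}^n$ be r.e. open. (a) Every computable open $f:X\to\mathbb{R}$ is effectively open. More generally, if a computable open $f:X\to\mathbb{R}^m$ maps every open ball $B\subseteq X$ to a convex set $f[B]\subseteq\mathbb{R}^m$, then $f$ is effectively open. (b) Every surjective computable affinely linear mapping $\mathbb{R}^n\to\mathbb{R}^m$ is effectively open. (c) If computable $f:X\to\mathbb{R}^m$ is continuously differentiable, its derivative $f'$ is computable, and $f'(\vec x)$ has rank $m$ for every $\vec x\in X$, then $f$ is effectively open. (d) Let $f:X\to\mathbb{R}^n$ be computable and $h:X\rightrightarrows\mathbb{N}$ be a computable multi-valued function such that for every $\vec x\in X$ and every $\ell\in h(\vec x)$ the restriction of $f$ to $B(\vec x,2^{-\ell})\cap X$ is injective. Then $f$ is effectively open. (e) If $X$ is bounded and $f:\overline{X}\to\mathbb{R}^n$ is computable and locally injective (each point has a neighbourhood ball on which $f$ is injective), then $f|_X$ is effectively open. The same holds if $f:X\to\mathbb{R}^n$ is computable and globally injective.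
   Context: Type-2 computability (Weihrauch) with the Cauchy representation $\rho^n$ for $\mathbb{R}^n$ and $\theta^d_<$ for open subsets of $\mathbb{R}^d$ (a name lists rational centers and radii of open balls whose union is the set). $X$ r.e. open: has a computable $\theta^n_<$-name. An open function $f:X\to\mathbb{R}^m$ is effectively open if $U\mapsto f[U]$ on open $U\subseteq X$ is $(\theta^n_<\to\theta^m_<)$-computable. A multi-valued $h:X\rightrightarrows\mathbb{N}$ is computable if some machine, on any $\rho^n$-name of $\vec x$, outputs some element of $h(\vec x)$ (possibly depending on the name). $B(\vec x,r)$: open Euclidean ball. *)

(* Defs.v *)
From HB Require Import structures.
From mathcomp Require Import all_boot all_order all_algebra.
From mathcomp Require Import all_classical all_reals all_analysis.
Set Implicit Arguments. Unset Strict Implicit. Unset Printing Implicit Defensive.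
Import Order.TTheory GRing.Theory Num.Theory.
Import numFieldNormedType.Exports.
Local Open Scope ring_scope.
Local Open Scope classical_set_scope.

Definition cpair (a b : nat) : nat := (((a + b) * (a + b).+1)./2 + b)%N.

Fixpoint tri_root_aux (z s fuel : nat) : nat :=
  match fuel with
  | 0 => s
  | f.+1 => if ((s.+1 * s.+2)./2 <= z)%N then tri_root_aux z s.+1 f else s
  end.

Definition cunpair (z : nat) : nat * nat :=
  let s := tri_root_aux z 0 z in
  let b := (z - (s * s.+1)./2)%N in ((s - b)%N, b).

Inductive prf : Type :=
| PZero | PSucc | PId | PFst | PSnd
| PPair (f g : prf)
| PComp (f g : prf)
| PRec (f g : prf)
| PMu (f : prf).

Inductive eval : prf -> nat -> nat -> Prop :=
| eZero x : eval PZero x 0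
| eSucc x : eval PSucc x x.+1
| eId x : eval PId x x
| eFst x : eval PFst x (cunpair x).1
| eSnd x : eval PSnd x (cunpair x).2
| ePair f g x a b : eval f x a -> eval g x b -> eval (PPair f g) x (cpair a b)
| eComp f g x y z : eval g x y -> eval f y z -> eval (PComp f g) x z
| eRec0 f g a z : eval f a z -> eval (PRec f g) (cpair a 0) z
| eRecS f g a n y z : eval (PRec f g) (cpair a n) y ->
    eval g (cpair a (cpair n y)) z -> eval (PRec f g) (cpair a n.+1) z
| eMu f a n : eval f (cpair a n) 0 ->
    (forall m, (m < n)%N -> exists v, v <> 0%N /\ eval f (cpair a m) v) ->
    eval (PMu f) a n.

Definition prf_total (e : prf) : Prop := forall x, exists y, eval e x y.

Definition computable_seq (p : nat -> nat) : Prop :=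
  exists e, forall k, eval e k (p k).

(* Type-2 machines.  A (total recursive) e acts on Baire space: on     *)
(* input p, output symbol n is (h <code(p[0..k)), n>) - 1 for the least *)
(* k at which h gives a nonzero value (standard characterization of    *)
(* Type-2 computable functions).                                       *)
Fixpoint lcode (l : seq nat) : nat :=
  if l is x :: l' then (cpair x (lcode l')).+1 else 0%N.

Definition prefix_code (p : nat -> nat) (k : nat) : nat := lcode (mkseq p k).

Definition runs (e : prf) (p q : nat -> nat) : Prop :=
  forall n, exists k y,
    eval e (cpair (prefix_code p k) n) y.+1 /\ q n = y /\
    forall k', (k' < k)%N -> eval e (cpair (prefix_code p k') n) 0.

Definition zz (n : nat) : int :=
  if odd n then - ((n.+1)./2)%:Z else (n./2)%:Z.

Definition qdec (n : nat) : rat :=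
  let ab := cunpair n in (zz ab.1)%:~R / (ab.2.+1)%:R.

Section Reps.
Context {R : realType}.

Definition eball (d : nat) (c : 'rV[R]_d) (r : R) : set 'rV[R]_d :=
  [set y | 0 < r /\ \sum_(i < d) (y 0 i - c 0 i) ^+ 2 < r ^+ 2].

(* Cauchy representation of R^(a x b) (vectors: a = 1):
   p <cpair k <i,j>> codes entry (i,j) of a rational approximation
   at Euclidean distance <= 2^-k. *)
Definition rho (a b : nat) (p : nat -> nat) (x : 'M[R]_(a, b)) : Prop :=
  forall k : nat,
    \sum_(i < a) \sum_(j < b)
       (ratr (qdec (p (cpair k (cpair i j)))) - x i j) ^+ 2
    <= ((2 ^+ k)^-1) ^+ 2.

Definition ball_of (d : nat) (p : nat -> nat) (k : nat) : set 'rV[R]_d :=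
  if p (cpair k 0) is r.+1 then
    eball (\row_(i < d) ratr (qdec (p (cpair k i.+1)))) (ratr (qdec r))
  else set0.

Definition theta (d : nat) (p : nat -> nat) (U : set 'rV[R]_d) : Prop :=
  U = \bigcup_(k in setT) @ball_of d p k.

Definition re_open (d : nat) (X : set 'rV[R]_d) : Prop :=
  exists p, computable_seq p /\ theta p X.

Definition computable_fun (a b c d : nat) (X : set 'M[R]_(a, b))
    (f : 'M[R]_(a, b) -> 'M[R]_(c, d)) : Prop :=
  exists e, prf_total e /\
    forall x p, X x -> rho p x -> exists q, runs e p q /\ rho q (f x).

(* computable multi-valued function X =>> N (a natural number is named by
   q with q 0 = the number) *)
Definition computable_mv (a b : nat) (X : set 'M[R]_(a, b))
    (h : 'M[R]_(a, b) -> set nat) : Prop :=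
  exists e, prf_total e /\
    forall x p, X x -> rho p x -> exists q, runs e p q /\ h x (q 0%N).

Definition open_fun (n m : nat) (X : set 'rV[R]_n) (f : 'rV[R]_n -> 'rV[R]_m)
  : Prop := forall U, open U -> U `<=` X -> open (f @` U).

Definition eff_open (n m : nat) (X : set 'rV[R]_n) (f : 'rV[R]_n -> 'rV[R]_m)
  : Prop :=
  exists e, prf_total e /\
    forall U p, open U -> U `<=` X -> theta p U ->
      exists q, runs e p q /\ theta q (f @` U).

Definition convex_in (m : nat) (S : set 'rV[R]_m) : Prop :=
  forall y z (t : R), S y -> S z -> 0 <= t <= 1 -> S (t *: y + (1 - t) *: z).

Definition inj_on (n m : nat) (A : set 'rV[R]_n) (f : 'rV[R]_n -> 'rV[R]_m)
  : Prop := forall x y, A x -> A y -> f x = f y -> x = y.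

Definition bounded_in (n : nat) (X : set 'rV[R]_n) : Prop :=
  exists M : R, forall x, X x -> forall i, `|x 0 i| <= M.

End Reps.

(* Main.v *)
(** The image of an open set is enumerated through certificates: finite data, checkable by
    a machine, which guarantee that a rational ball around [q] lies in the image of a
    rational ball around [c].  They are built from finite prefixes of names on which the
    machine for [f] has already answered: such a prefix can be continued to a name of every
    point of a small cube, so the answer approximates [f] on the whole cube, and by
    compactness finitely many prefixes control [f] on the boundary of a given cube.

    If balls have convex images, it suffices to find a sample point in the ball whose image
    lies in each orthant as seen from [q].  If [f] has a derivative of rank [m] at [x], choose
    a rational matrix [M] close to a right inverse of it; then [u |-> f (c + u M)] is close to
    a translation on small cubes, and the sign conditions of the Poincare-Miranda theorem on
    the boundary are a certificate.  If [f] is injective on a cube, the image of the open cube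
    is open by invariance of domain, hence a component of the complement of the image of the
    boundary; a certificate bounds the distance from [q] to the latter from below.  In the
    last two cases of the theorem the injectivity radius is constant, by compactness of the
    closure for the first of them.

    The Poincare-Miranda theorem follows from a discrete version: modulo 2, the cup product
    of the coboundaries of [n] sign functions on a cubical lattice is itself a coboundary, so
    its sum over a box reduces to a face.  For invariance of domain, suppose that [F 0] is not
    interior to the image of the cube and let [c] be a nearby point outside the image.  A
    Lipschitz approximation [P] of the inverse of [F] misses small values on a small cube
    boundary around [c]; composing it with the push away from [c] yields a map without zeros
    at distance at most [rho] from the identity, which contradicts Poincare-Miranda. *)
Require Import Defs.
From HB Require Import structures.
From mathcomp Require Import all_boot all_order all_algebra.
From mathcomp Require Import all_classical all_reals all_analysis.
From mathcomp Require Import zify ring lra.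
Set Implicit Arguments.
Unset Strict Implicit.
Unset Printing Implicit Defensive.
Import Order.TTheory GRing.Theory Num.Theory.
Import numFieldNormedType.Exports.
Local Open Scope ring_scope.
Local Open Scope classical_set_scope.
Local Notation eval := Defs.eval.

(** * Computable functions on the natural numbers *)

Section Pairing.
Local Open Scope nat_scope.

Definition tri (s : nat) := (s * s.+1)./2.

Lemma triS s : tri s.+1 = tri s + s.+1.
Proof.
rewrite /tri; have -> : s.+1 * s.+2 = s * s.+1 + s.+1.*2 by lia.
by rewrite halfD oddM /= odd_double /= !andbF /= doubleK.
Qed.

Lemma leq_tri s t : s <= t -> tri s <= tri t.
Proof.
elim: t => [|t IH]; first by rewrite leqn0 => /eqP->.
rewrite leq_eqVlt => /predU1P[->//|]; rewrite ltnS => /IH h.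
by rewrite triS (leq_trans h) // leq_addr.
Qed.

Lemma tri_ge s : s <= tri s.
Proof. by case: s => // s; rewrite triS leq_addl. Qed.

(** Consecutive triangular numbers differ by [s.+1], so the intervals [[tri s, tri s + s]] are
    disjoint. *)
Lemma tri_inj_between s t b c : b <= s -> c <= t ->
  tri s + b = tri t + c -> s = t.
Proof.
move=> bs ct e; case: (ltngtP s t) => // h.
- have := @leq_tri _ _ h; rewrite triS; lia.
- have := @leq_tri _ _ h; rewrite triS; lia.
Qed.

Lemma tri_root_auxP z s fuel : tri s <= z -> z < tri (s + fuel).+1 ->
  tri (tri_root_aux z s fuel) <= z < tri (tri_root_aux z s fuel).+1.
Proof.
elim: fuel s => [|f IH] s h1 h2; first by rewrite /= h1; rewrite addn0 in h2.
have -> : tri_root_aux z s f.+1 = if tri s.+1 <= z then tri_root_aux z s.+1 f else s by [].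
case: ifP => h3.
- by apply: IH => //; rewrite addSnnS.
- by rewrite h1 ltnNge h3.
Qed.

Lemma cpairK z : cpair (cunpair z).1 (cunpair z).2 = z.
Proof.
rewrite /cunpair /=; set s := tri_root_aux z 0 z.
have /andP[h1 h2] : tri s <= z < tri s.+1.
  (* The fuel [z] is enough because [z < tri z.+1]. *)
  by apply: tri_root_auxP => //; rewrite add0n; apply: tri_ge.
rewrite -[(s * s.+1)./2]/(tri s) /cpair.
rewrite triS in h2.
have -> : s - (z - tri s) + (z - tri s) = s by lia.
by rewrite -[(s * s.+1)./2]/(tri s); lia.
Qed.

Lemma cunpairK a b : cunpair (cpair a b) = (a, b).
Proof.
have := cpairK (cpair a b); set u := cunpair _ => e.
have {e} : tri (u.1 + u.2) + u.2 = tri (a + b) + b by [].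
case: u => c d /= e.
have e2 : c + d = a + b by apply: tri_inj_between e; lia.
by congr pair; move: e; rewrite e2; lia.
Qed.

Lemma cpair_fst a b : (cunpair (cpair a b)).1 = a.
Proof. by rewrite cunpairK. Qed.

Lemma cpair_snd a b : (cunpair (cpair a b)).2 = b.
Proof. by rewrite cunpairK. Qed.

Lemma cpair_inj a b c d : cpair a b = cpair c d -> a = c /\ b = d.
Proof. by move=> e; have := cunpairK a b; rewrite e cunpairK => -[-> ->]. Qed.

Lemma cpair_ge1 a b : a <= cpair a b.
Proof. by rewrite /cpair -/(tri _); have := tri_ge (a + b); lia. Qed.

Lemma leq_cpair a b c : b <= c -> cpair a b <= cpair a c.
Proof.
move=> h; rewrite /cpair -!/(tri _).
by have := @leq_tri (a + b) (a + c); lia.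
Qed.

Lemma cunpair0 : cunpair 0 = (0, 0).
Proof. by []. Qed.

End Pairing.

Global Opaque cpair cunpair.

(** The argument of [PRec] is not in constructor form, so both cases are kept as equations on [x],
    to be resolved by injectivity of [cpair]. *)
Lemma eval_PRec_inv f g x y : eval (PRec f g) x y ->
  (exists a, x = cpair a 0 /\ eval f a y) \/
  (exists a n v, x = cpair a n.+1 /\
     eval (PRec f g) (cpair a n) v /\ eval g (cpair a (cpair n v)) y).
Proof.
move=> h; inversion h; subst; [left|right]; first by eexists; split; [reflexivity|].
by do 3 eexists; split; [reflexivity|split; eassumption].
Qed.

(** Induction on the program, with an inner induction on the counter for [PRec]. Two different
    results of [PMu] would make its body both zero and nonzero at the smaller one. *)
Lemma eval_det e x y y' : eval e x y -> eval e x y' -> y = y'.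
Proof.
elim: e x y y' => [||||| f IHf g IHg|f IHf g IHg|f IHf g IHg|f IHf] x y y' h h';
  try by inversion h; inversion h'; subst.
- inversion h as [| | | | |? ? ? a b fa gb| | | |]; subst.
  inversion h' as [| | | | |? ? ? a' b' fa' gb'| | | |]; subst.
  by rewrite (IHf _ _ _ fa fa') (IHg _ _ _ gb gb').
- inversion h as [| | | | | |? ? ? a b ga fb| | |]; subst.
  inversion h' as [| | | | | |? ? ? a' b' ga' fb'| | |]; subst.
  by move: fb'; rewrite -(IHg _ _ _ ga ga'); apply: IHf.
- move: h h'; rewrite -(cpairK x); move: (cunpair x) => [a n] /=.
  elim: n y y' => [|n IHn] y y' /eval_PRec_inv h1 /eval_PRec_inv h2.
    case: h1 h2 => [[_ [/cpair_inj[<- _] f1]]|[? [? [? [/cpair_inj[]]]]]] //.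
    by case=> [[_ [/cpair_inj[<- _]]]|[? [? [? [/cpair_inj[]]]]]] //; apply: IHf f1.
  case: h1 h2 => [[? [/cpair_inj[]]]|[_ [_ [u [/cpair_inj[<- [<-]] [r1 g1]]]]]] //.
  case=> [[? [/cpair_inj[]]]|[_ [_ [v [/cpair_inj[<- [<-]] [r2 g2]]]]]] //.
  by move: g2; rewrite -(IHn _ _ r1 r2); apply: IHg g1.
- inversion h as [| | | | | | | | |? ? ? f1 lt1]; subst.
  inversion h' as [| | | | | | | | |? ? ? f2 lt2]; subst.
  case: (ltngtP y y') => // lt.
  + by have [v [v0 hv]] := lt2 _ lt; case: v0; rewrite (IHf _ _ _ f1 hv).
  + by have [v [v0 hv]] := lt1 _ lt; case: v0; rewrite (IHf _ _ _ f2 hv).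
Qed.

Notation cmp := computable_seq.
Notation cmpb P := (computable_seq (fun z => nat_of_bool (P z))).

Section Computable.
Local Open Scope nat_scope.

Lemma cmp_ext F G : F =1 G -> cmp G -> cmp F.
Proof. by move=> /funext->. Qed.

Lemma cmp_id : cmp (fun z => z).
Proof. by exists PId => k; apply: eId. Qed.

Lemma cmp_comp F G : cmp F -> cmp G -> cmp (fun z => F (G z)).
Proof. by move=> [f hf] [g hg]; exists (PComp f g) => k; apply: eComp. Qed.

Lemma cmp_S F : cmp F -> cmp (fun z => (F z).+1).
Proof. by move=> h; apply: (cmp_comp (F := S)) h; exists PSucc => k; apply: eSucc. Qed.

Lemma cmp_const c : cmp (fun=> c).
Proof. by elim: c => [|c /cmp_S//]; exists PZero => k; apply: eZero. Qed.

Lemma cmp_fst F : cmp F -> cmp (fun z => (cunpair (F z)).1).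
Proof.
by move=> h; apply: (cmp_comp (F := fun z => (cunpair z).1)) h; exists PFst => k; apply: eFst.
Qed.

Lemma cmp_snd F : cmp F -> cmp (fun z => (cunpair (F z)).2).
Proof.
by move=> h; apply: (cmp_comp (F := fun z => (cunpair z).2)) h; exists PSnd => k; apply: eSnd.
Qed.

Lemma cmp_pair F G : cmp F -> cmp G -> cmp (fun z => cpair (F z) (G z)).
Proof. by move=> [f hf] [g hg]; exists (PPair f g) => k; apply: ePair. Qed.

(** The parameter [z] travels through the recursion in the first component of the argument of
    [PRec]. *)
Lemma cmp_rec A (G : nat -> nat -> nat -> nat) N : cmp A ->
  cmp (fun t => G (cunpair t).1 (cunpair (cunpair t).2).1 (cunpair (cunpair t).2).2) ->
  cmp N -> cmp (fun z => nat_rect (fun=> nat) (A z) (G z) (N z)).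
Proof.
move=> [a ha] [g hg] [b hb].
exists (PComp (PRec a g) (PPair PId b)) => k.
apply: (@eComp _ _ _ (cpair k (N k))); first by apply: ePair; [apply: eId|].
elim: (N k) => [|n IH] /=; first exact: eRec0.
apply: eRecS IH _.
by have := hg (cpair k (cpair n (nat_rect (fun=> nat) (A k) (G k) n))); rewrite !cunpairK.
Qed.

Lemma cmp_iter (g : nat -> nat) A N : cmp g -> cmp A -> cmp N ->
  cmp (fun z => iter (N z) g (A z)).
Proof.
move=> hg hA hN; apply: (@cmp_ext _ (fun z => nat_rect (fun=> nat) (A z) (fun _ => g) (N z))).
  by move=> z; elim: (N z) => //= n ->.
by apply: (@cmp_rec A (fun _ _ => g)) => //; apply: cmp_comp hg _; do 2! apply: cmp_snd; apply: cmp_id.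
Qed.

Lemma cmp_add F G : cmp F -> cmp G -> cmp (fun z => F z + G z).
Proof.
move=> hF hG; apply: (@cmp_ext _ (fun z => iter (G z) S (F z))).
  by move=> z; rewrite iter_succn.
by apply: cmp_iter => //; apply/cmp_S/cmp_id.
Qed.

Lemma cmp_pred F : cmp F -> cmp (fun z => (F z).-1).
Proof.
move=> hF; apply: (@cmp_ext _ (fun z => nat_rect (fun=> nat) 0 (fun n _ => n) (F z))).
  by move=> z; case: (F z).
apply: (@cmp_rec (fun=> 0) (fun _ n _ => n)) => //; first exact: cmp_const.
by apply/cmp_fst/cmp_snd/cmp_id.
Qed.

Lemma cmp_sub F G : cmp F -> cmp G -> cmp (fun z => F z - G z).
Proof.
move=> hF hG; apply: (@cmp_ext _ (fun z => iter (G z) predn (F z))).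
  by move=> z; rewrite iter_predn.
by apply: cmp_iter => //; apply/cmp_pred/cmp_id.
Qed.

Lemma cmp_mul F G : cmp F -> cmp G -> cmp (fun z => F z * G z).
Proof.
move=> hF hG.
apply: (@cmp_ext _ (fun z => nat_rect (fun=> nat) 0 (fun n y => y + F z) (G z))).
  by move=> z; elim: (G z) => [|n /= <-]; rewrite ?muln0 // mulnSr.
apply: (@cmp_rec (fun=> 0) (fun z n y => y + F z)) => //; first exact: cmp_const.
by apply: cmp_add; [do 2! apply: cmp_snd; apply: cmp_id|apply: cmp_comp hF _; apply/cmp_fst/cmp_id].
Qed.

Lemma cmp_exp F G : cmp F -> cmp G -> cmp (fun z => F z ^ G z).
Proof.
move=> hF hG.
apply: (@cmp_ext _ (fun z => nat_rect (fun=> nat) 1 (fun n y => y * F z) (G z))).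
  by move=> z; elim: (G z) => [|n /= <-]; rewrite ?expn0 // expnSr.
apply: (@cmp_rec (fun=> 1) (fun z n y => y * F z)) => //; first exact: cmp_const.
by apply: cmp_mul; [do 2! apply: cmp_snd; apply: cmp_id|apply: cmp_comp hF _; apply/cmp_fst/cmp_id].
Qed.

Lemma cmp_neg (P : nat -> bool) : cmpb P -> cmpb (fun z => ~~ P z).
Proof.
move=> hP; apply: (@cmp_ext _ (fun z => 1 - P z)); first by move=> z; case: (P z).
by apply: cmp_sub => //; apply: cmp_const.
Qed.

Lemma cmp_and (P Q : nat -> bool) : cmpb P -> cmpb Q -> cmpb (fun z => P z && Q z).
Proof.
move=> hP hQ; apply: (@cmp_ext _ (fun z => P z * Q z)); last exact: cmp_mul.
by move=> z; rewrite mulnb.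
Qed.

Lemma cmp_or (P Q : nat -> bool) : cmpb P -> cmpb Q -> cmpb (fun z => P z || Q z).
Proof.
move=> hP hQ; apply: (@cmp_ext _ (fun z => ~~ (~~ P z && ~~ Q z))).
  by move=> z; case: (P z); case: (Q z).
by apply: cmp_neg; apply: cmp_and; apply: cmp_neg.
Qed.

Lemma cmp_imp (P Q : nat -> bool) : cmpb P -> cmpb Q -> cmpb (fun z => P z ==> Q z).
Proof.
move=> hP hQ; apply: (@cmp_ext _ (fun z => ~~ P z || Q z)).
  by move=> z; case: (P z); case: (Q z).
by apply: cmp_or => //; apply: cmp_neg.
Qed.

Lemma cmp_if (P : nat -> bool) F G : cmpb P -> cmp F -> cmp G ->
  cmp (fun z => if P z then F z else G z).
Proof.
move=> hP hF hG; apply: (@cmp_ext _ (fun z => P z * F z + ~~ P z * G z)).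
  by move=> z; case: (P z); rewrite ?mul0n ?mul1n ?addn0.
by apply: cmp_add; apply: cmp_mul => //; apply: cmp_neg.
Qed.

Lemma cmp_leq F G : cmp F -> cmp G -> cmpb (fun z => F z <= G z).
Proof.
move=> hF hG; apply: (@cmp_ext _ (fun z => 1 - (F z - G z))).
  by move=> z; rewrite /leq; case: (F z - G z).
by apply: cmp_sub; [apply: cmp_const|apply: cmp_sub].
Qed.

Lemma cmp_eq F G : cmp F -> cmp G -> cmpb (fun z => F z == G z).
Proof.
move=> hF hG; apply: (@cmp_ext _ (fun z => (F z <= G z) && (G z <= F z))).
  by move=> z; rewrite eqn_leq.
by apply: cmp_and; apply: cmp_leq.
Qed.

Lemma cmp_divn F G : cmp F -> cmp G -> cmp (fun z => F z %/ G z).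
Proof.
move=> hF hG.
pose step (z n y : nat) := if (y.+1 * G z <= F z) && (0 < G z) then y.+1 else y.
apply: (@cmp_ext _ (fun z => nat_rect (fun=> nat) 0 (step z) (F z))); last first.
  have h2 : cmp (fun t => (cunpair (cunpair t).2).2) by do 2! apply: cmp_snd; apply: cmp_id.
  have h1 : cmp (fun t => (cunpair t).1) by apply/cmp_fst/cmp_id.
  apply: (@cmp_rec (fun=> 0) step) => //; first exact: cmp_const.
  apply: cmp_if => //; last exact: cmp_S.
  apply: cmp_and; apply: cmp_leq; try exact: (cmp_comp hF h1).
  - by apply: cmp_mul; [apply: cmp_S|exact: (cmp_comp hG h1)].
  - exact: cmp_const.
  - exact: (cmp_comp hG h1).
(* After [n] rounds the counter is the minimum of [n] and the quotient, and the quotient is at most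
   [F z]. *)
move=> z; rewrite -[LHS](minn_idPr (leq_div (F z) (G z))).
elim: {1 3}(F z) => [|n]; first by rewrite min0n.
rewrite /= => <-; rewrite /step; have [->|G0] := posnP (G z).
  by rewrite divn0 !minn0 andbF.
rewrite andbT -leq_divRL //; case: ifP; lia.
Qed.

Lemma cmp_modn F G : cmp F -> cmp G -> cmp (fun z => F z %% G z).
Proof.
move=> hF hG; apply: (@cmp_ext _ (fun z => F z - F z %/ G z * G z)).
  by move=> z; rewrite {2}(divn_eq (F z) (G z)) addnC addnK.
by apply: cmp_sub => //; apply: cmp_mul => //; apply: cmp_divn.
Qed.

Lemma cmp_big_and n (P : 'I_n -> nat -> bool) : (forall i, cmpb (P i)) ->
  cmpb (fun z => [forall i, P i z]).
Proof.
move=> h; apply: (@cmp_ext _ (fun z => \big[andb/true]_i P i z)).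
  by move=> z; rewrite big_andE.
elim: (index_enum _) => [|i s IH]; first by apply: cmp_ext (cmp_const 1) => z; rewrite big_nil.
apply: (@cmp_ext _ (fun z => P i z && \big[andb/true]_(i <- s) P i z)).
  by move=> z; rewrite big_cons.
exact: cmp_and.
Qed.

Lemma cmp_big_or n (P : 'I_n -> nat -> bool) : (forall i, cmpb (P i)) ->
  cmpb (fun z => [exists i, P i z]).
Proof.
move=> h; apply: (@cmp_ext _ (fun z => ~~ [forall i, ~~ P i z])).
  by move=> z; rewrite negb_forall; congr nat_of_bool; apply: eq_existsb => i; rewrite negbK.
by apply: cmp_neg; apply: cmp_big_and => i; apply: cmp_neg.
Qed.

Lemma cmp_sum n (F : 'I_n -> nat -> nat) : (forall i, cmp (F i)) ->
  cmp (fun z => \sum_i F i z).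
Proof.
move=> h; elim: (index_enum _) => [|i s IH].
  by apply: cmp_ext (cmp_const 0) => z; rewrite big_nil.
apply: (@cmp_ext _ (fun z => F i z + \sum_(i <- s) F i z)); last exact: cmp_add.
by move=> z; rewrite big_cons.
Qed.

Definition allb (n : nat) (P : nat -> bool) := all P (iota 0 n).

Lemma allbP n (P : nat -> bool) : reflect (forall k, k < n -> P k) (allb n P).
Proof.
apply: (iffP allP) => h k; first by move=> kn; apply: h; rewrite mem_iota.
by rewrite mem_iota => /h.
Qed.

(** The number of tests depends on the input, so the conjunction is a primitive recursion, unlike in
    [cmp_big_and]. *)
Lemma cmp_allb N (P : nat -> nat -> bool) : cmp N ->
  cmpb (fun t => P (cunpair t).1 (cunpair t).2) ->
  cmpb (fun z => allb (N z) (P z)).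
Proof.
move=> hN hP.
apply: (@cmp_ext _ (fun z => nat_rect (fun=> nat) 1 (fun n y => P z n * y) (N z))).
  move=> z; elim: (N z) => //= n <-.
  by rewrite /allb -addn1 iotaD all_cat /= andbT add0n mulnb andbC.
apply: (@cmp_rec (fun=> 1) (fun z n y => P z n * y)) => //; first exact: cmp_const.
apply: cmp_mul; last by do 2! apply: cmp_snd; apply: cmp_id.
apply: (@cmp_ext _ (fun t => nat_of_bool
   (P (cunpair (cpair (cunpair t).1 (cunpair (cunpair t).2).1)).1
      (cunpair (cpair (cunpair t).1 (cunpair (cunpair t).2).1)).2))).
  by move=> z; rewrite !cunpairK.
apply: (cmp_comp (F := fun t => nat_of_bool (P (cunpair t).1 (cunpair t).2))) => //.
by apply: cmp_pair; [|apply/cmp_fst/cmp_snd]; [apply/cmp_fst|]; apply: cmp_id.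
Qed.

End Computable.

(** * Codes of finite words and of rational-valued functions *)

Ltac cmp_step := first
  [ assumption
  | lazymatch goal with
    | |- computable_seq (fun=> ?c) => exact: (cmp_const c)
    | |- computable_seq (fun z => z) => exact: cmp_id
    | |- computable_seq (fun z => S (@?F z)) => apply: (@cmp_S F)
    | |- computable_seq (fun z => fst (cunpair (@?F z))) => apply: (@cmp_fst F)
    | |- computable_seq (fun z => snd (cunpair (@?F z))) => apply: (@cmp_snd F)
    | |- computable_seq (fun z => cpair (@?F z) (@?G z)) => apply: (@cmp_pair F G)
    | |- computable_seq (fun z => addn (@?F z) (@?G z)) => apply: (@cmp_add F G)
    | |- computable_seq (fun z => muln (@?F z) (@?G z)) => apply: (@cmp_mul F G)
    | |- computable_seq (fun z => subn (@?F z) (@?G z)) => apply: (@cmp_sub F G)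
    | |- computable_seq (fun z => predn (@?F z)) => apply: (@cmp_pred F)
    | |- computable_seq (fun z => expn (@?F z) (@?G z)) => apply: (@cmp_exp F G)
    | |- computable_seq (fun z => divn (@?F z) (@?G z)) => apply: (@cmp_divn F G)
    | |- computable_seq (fun z => modn (@?F z) (@?G z)) => apply: (@cmp_modn F G)
    | |- computable_seq (fun z => nat_of_bool (~~ @?P z)) => apply: (@cmp_neg P)
    | |- computable_seq (fun z => nat_of_bool (@?P z && @?Q z)) => apply: (@cmp_and P Q)
    | |- computable_seq (fun z => nat_of_bool (@?P z || @?Q z)) => apply: (@cmp_or P Q)
    | |- computable_seq (fun z => nat_of_bool (@?P z ==> @?Q z)) => apply: (@cmp_imp P Q)
    | |- computable_seq (fun z => nat_of_bool (leq (@?F z) (@?G z))) => apply: (@cmp_leq F G)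
    | |- computable_seq (fun z => nat_of_bool (@eq_op _ (@?F z) (@?G z))) => apply: (@cmp_eq F G)
    | H : computable_seq ?F |- computable_seq (fun z => ?F (@?G z)) => apply: (@cmp_comp F G H)
    end
  | simple apply cmp_if ].
Ltac cmp_solve := repeat cmp_step.

Section Codes.
Local Open Scope nat_scope.

(** The predecessor undoes the successor in [lcode]; the empty word gets head and tail [0]. *)
Definition hdc (w : nat) := (cunpair w.-1).1.
Definition tlc (w : nat) := (cunpair w.-1).2.
Definition nthc (w i : nat) := hdc (iter i tlc w).

Lemma tlc_cons x l : tlc (lcode (x :: l)) = lcode l.
Proof. exact: cpair_snd. Qed.

Lemma hdc_cons x l : hdc (lcode (x :: l)) = x.
Proof. exact: cpair_fst. Qed.

Lemma iter_tlc i l : iter i tlc (lcode l) = lcode (drop i l).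
Proof.
elim: i l => [|i IH] l; first by rewrite drop0.
rewrite iterSr; case: l => [|x l]; first by rewrite /tlc cunpair0 (IH [::]).
by rewrite tlc_cons IH.
Qed.

Lemma nthcE l i : nthc (lcode l) i = nth 0 l i.
Proof.
rewrite /nthc iter_tlc -{2}(cat_take_drop i l) nth_cat size_take.
case: (ltnP i (size l)) => h; last by rewrite drop_oversize // ltnNge h /= nth_nil.
by rewrite ltnn subnn; case: (drop i l) => // x s; rewrite hdc_cons.
Qed.

Lemma nthc_mkseq (p : nat -> nat) L i : i < L -> nthc (lcode (mkseq p L)) i = p i.
Proof. by move=> h; rewrite nthcE nth_mkseq. Qed.

(** A length test on codes, by which a machine waits until enough input has been read. *)
Lemma lcode_eq0 i l : (iter i tlc (lcode l) == 0) = (size l <= i).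
Proof.
rewrite iter_tlc -subn_eq0 -size_drop.
by case: (drop i l).
Qed.

Lemma cmp_nthc W I : cmp W -> cmp I -> cmp (fun z => nthc (W z) (I z)).
Proof.
move=> hW hI; apply: cmp_fst; apply: cmp_pred; apply: cmp_iter => //.
by apply: cmp_snd; apply: cmp_pred; apply: cmp_id.
Qed.

Lemma cmp_prefix_code (P : nat -> nat -> nat) N : cmp N ->
  cmp (fun t => P (cunpair t).1 (cunpair t).2) ->
  cmp (fun z => prefix_code (P z) (N z)).
Proof.
move=> hN hP.
(* The code is built from the right: after [i] rounds [acc] codes the last [i] letters. *)
pose step z i acc := (cpair (P z (N z - i.+1)) acc).+1.
apply: (@cmp_ext _ (fun z => nat_rect (fun=> nat) 0 (step z) (N z))) => [z|].
  suff: forall i, i <= N z -> nat_rect (fun=> nat) 0 (step z) i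
       = lcode (map (P z) (iota (N z - i) i)).
    by move=> ->; rewrite // subnn.
  elim=> //= i IH h; rewrite IH ?(ltnW h) // /step; congr (cpair _ (lcode _)).+1.
  by rewrite -subSn // subSS.
apply: (@cmp_rec (fun=> 0) step) => //; first exact: cmp_const.
rewrite /step; cmp_solve.
apply: (@cmp_ext _ (fun t => (fun t => P (cunpair t).1 (cunpair t).2)
   (cpair (cunpair t).1 (N (cunpair t).1 - (cunpair (cunpair t).2).1.+1)))).
  by move=> t /=; rewrite cunpairK.
by apply: (cmp_comp hP); cmp_solve.
Qed.

(* [runm] searches among the first [L] prefixes of [p] for an output at
   position [o]; 0 means that the machine has not answered yet. *)
Definition runm (E : nat -> nat) (p : nat -> nat) (L o : nat) : nat :=
  nat_rect (fun=> nat) (E (cpair (prefix_code p 0) o))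
    (fun k y => if y == 0 then E (cpair (prefix_code p k.+1) o) else y) L.

Lemma runmP E p L o y : runm E p L o = y.+1 <->
  exists2 k, k <= L & E (cpair (prefix_code p k) o) = y.+1 /\
    forall k', k' < k -> E (cpair (prefix_code p k') o) = 0.
Proof.
elim: L => [|L IH].
  split=> [h|[k]]; first by exists 0.
  by rewrite leqn0 => /eqP-> [].
rewrite /runm /= -/(runm E p L o); split.
  case: eqP => [e0 e|_ /IH[k kL ?]]; last by exists k; rewrite // leqW.
  exists L.+1 => //; split=> // k' k'L.
  move: e0 {e}; elim: (L) k' k'L => [|M IHM] k' k'M; first by case: k' k'M.
  rewrite /runm /= -/(runm E p M o); case: eqP => // e0 e.
  by move: k'M; rewrite ltnS leq_eqVlt => /predU1P[->//|/IHM->].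
case=> k; rewrite leq_eqVlt => /predU1P[-> [e h]|kL h]; last first.
  have -> : runm E p L o = y.+1 by apply/IH; exists k.
  by [].
suff -> : runm E p L o = 0 by [].
elim: (L) h => [|M IHM] h; first exact: h.
by rewrite /runm /= -/(runm E p M o) IHM ?h // => k' /leqW; apply: h.
Qed.

Lemma cmp_runm E W L O : cmp E -> cmp W -> cmp L -> cmp O ->
  cmp (fun z => runm E (nthc (W z)) (L z) (O z)).
Proof.
move=> hE hW hL hO.
apply: (@cmp_rec _ (fun z k y => if y == 0 then
  E (cpair (prefix_code (nthc (W z)) k.+1) (O z)) else y)) => //.
  apply: (cmp_comp hE); apply: cmp_pair => //; exact: cmp_const.
cmp_solve.
apply: (@cmp_prefix_code (fun t => nthc (W (cunpair t).1))); first by cmp_solve.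
by apply: cmp_nthc; cmp_solve.
Qed.

Lemma cmp_of_total e : prf_total e -> exists2 E, cmp E & forall x, eval e x (E x).
Proof. by move=> /choice[E h]; exists E => //; exists e. Qed.

(** By determinism of [eval], the relation [runs] becomes a statement about the computable search
    [runm]. *)
Lemma runs_fun e E p q : (forall x, eval e x (E x)) -> runs e p q <->
  forall o, exists L, runm E p L o = (q o).+1.
Proof.
move=> h; split=> H o.
  have [k [y [ey [qo lt]]]] := H o; exists k; apply/runmP; exists k => //.
  rewrite qo; split; first exact: eval_det (h _) ey.
  by move=> k' /lt; apply: eval_det.
have [L /runmP[k _ [ek lt]]] := H o; exists k, (q o); split; first by rewrite -ek.
by split=> // k' /lt <-.
Qed.

Lemma runm_mono E p L L' o y : runm E p L o = y.+1 -> L <= L' -> runm E p L' o = y.+1.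
Proof. by move=> /runmP[k kL h] LL; apply/runmP; exists k; rewrite // (leq_trans kL). Qed.

Lemma eq_prefix_code p p' k : (forall i, i < k -> p i = p' i) ->
  prefix_code p k = prefix_code p' k.
Proof.
move=> h; rewrite /prefix_code; congr lcode; apply/eq_in_map => i.
by rewrite mem_iota => /h.
Qed.

Lemma eq_runm E p p' L o : (forall i, i < L -> p i = p' i) -> runm E p L o = runm E p' L o.
Proof.
elim: L => [|L IH] h //; rewrite /runm /= -/(runm E p L o) -/(runm E p' L o).
by rewrite IH => [|i iL]; [rewrite (@eq_prefix_code p p')|apply/h/ltnW].
Qed.

End Codes.

(** * Computable rational-valued functions *)

Section CompRat.
Context {R : realType}.
Implicit Types F G : nat -> R.

(** A difference of naturals over a positive denominator, so that inequalities become inequalities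
    between naturals. *)
Definition cmpQ (F : nat -> R) := exists a b d, [/\ cmp a, cmp b, cmp d &
  forall z, F z = ((a z)%:R - (b z)%:R) / (d z).+1%:R].

Lemma cmpQ_ext F G : F =1 G -> cmpQ G -> cmpQ F.
Proof. by move=> /funext->. Qed.

Lemma cmpQ_nat N : cmp N -> cmpQ (fun z => (N z)%:R).
Proof.
move=> hN; exists N, (fun=> 0%N), (fun=> 0%N); split=> //; try exact: cmp_const.
by move=> z; rewrite subr0 divr1.
Qed.

Lemma cmpQ_inv N : cmp N -> cmpQ (fun z => (N z).+1%:R^-1).
Proof.
move=> hN; exists (fun=> 1%N), (fun=> 0%N), N; split=> //; try exact: cmp_const.
by move=> z; rewrite subr0 mul1r.
Qed.

Lemma cmpQ_add F G : cmpQ F -> cmpQ G -> cmpQ (fun z => F z + G z).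
Proof.
move=> [a [b [d [ha hb hd eF]]]] [a' [b' [d' [ha' hb' hd' eG]]]].
(* Denominators are stored minus one, hence the final [- 1]. *)
exists (fun z => a z * (d' z).+1 + a' z * (d z).+1)%N,
  (fun z => b z * (d' z).+1 + b' z * (d z).+1)%N,
  (fun z => (d z).+1 * (d' z).+1 - 1)%N; split; try by cmp_solve.
move=> z; have -> : ((d z).+1 * (d' z).+1 - 1).+1 = ((d z).+1 * (d' z).+1)%N by lia.
rewrite eF eG !natrD !natrM.
have := pnatr_eq0 R (d z).+1; have := pnatr_eq0 R (d' z).+1 => /= /negbT + /negbT.
by move: (_.+1%:R) => D; move: (_.+1%:R) => D' *; field; apply/andP.
Qed.

Lemma cmpQ_mul F G : cmpQ F -> cmpQ G -> cmpQ (fun z => F z * G z).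
Proof.
move=> [a [b [d [ha hb hd eF]]]] [a' [b' [d' [ha' hb' hd' eG]]]].
exists (fun z => a z * a' z + b z * b' z)%N,
  (fun z => a z * b' z + b z * a' z)%N,
  (fun z => (d z).+1 * (d' z).+1 - 1)%N; split; try by cmp_solve.
move=> z; have -> : ((d z).+1 * (d' z).+1 - 1).+1 = ((d z).+1 * (d' z).+1)%N by lia.
rewrite eF eG !natrD !natrM.
have := pnatr_eq0 R (d z).+1; have := pnatr_eq0 R (d' z).+1 => /= /negbT + /negbT.
by move: (_.+1%:R) => D; move: (_.+1%:R) => D' *; field; apply/andP.
Qed.

Lemma cmpQ_opp F : cmpQ F -> cmpQ (fun z => - F z).
Proof.
move=> [a [b [d [ha hb hd eF]]]]; exists b, a, d; split=> // z.
by rewrite eF -mulNr opprB.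
Qed.

Lemma cmpQ_norm F : cmpQ F -> cmpQ (fun z => `|F z|).
Proof.
move=> [a [b [d [ha hb hd eF]]]].
exists (fun z => (a z - b z) + (b z - a z))%N, (fun=> 0%N), d.
split=> //; try by cmp_solve.
move=> z; rewrite eF subr0 normrM (@ger0_norm _ _^-1) ?invr_ge0 //; congr (_ / _).
case: (leqP (a z) (b z)) => h.
  rewrite ler0_norm ?subr_le0 ?ler_nat // opprB -natrB //; congr _%:R; lia.
rewrite ger0_norm ?subr_ge0 ?ler_nat 1?ltnW // -natrB 1?ltnW //; congr _%:R; lia.
Qed.

Lemma cmpQ_int (m : nat) : cmpQ (fun=> m%:R).
Proof. by apply: cmpQ_nat; apply: cmp_const. Qed.

Lemma cmpQ_exp F (k : nat) : cmpQ F -> cmpQ (fun z => F z ^+ k).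
Proof.
move=> hF; elim: k => [|k IH]; first exact: (cmpQ_int 1).
by apply: (@cmpQ_ext _ (fun z => F z * F z ^+ k)); [move=> z; rewrite exprS|apply: cmpQ_mul].
Qed.

Lemma cmpQ_exp2 J : cmp J -> cmpQ (fun z => (2 ^+ J z)^-1).
Proof.
move=> hJ; apply: (@cmpQ_ext _ (fun z => (2 ^ J z - 1).+1%:R^-1)%N).
  by move=> z; rewrite -subSn ?expn_gt0 // subSS subn0 natrX.
by apply: cmpQ_inv; cmp_solve.
Qed.

Lemma cmpQ_sum n (F : 'I_n -> nat -> R) : (forall i, cmpQ (F i)) ->
  cmpQ (fun z => \sum_i F i z).
Proof.
move=> h; elim: (index_enum _) => [|i s IH].
  by apply: cmpQ_ext (cmpQ_int 0) => z; rewrite big_nil.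
apply: (@cmpQ_ext _ (fun z => F i z + \sum_(i <- s) F i z)); last exact: cmpQ_add.
by move=> z; rewrite big_cons.
Qed.

Lemma cmpQ_le F G : cmpQ F -> cmpQ G -> cmpb (fun z => F z <= G z).
Proof.
move=> [a [b [d [ha hb hd eF]]]] [a' [b' [d' [ha' hb' hd' eG]]]].
apply: (@cmp_ext _ (fun z => (a z * (d' z).+1 + b' z * (d z).+1 <=
     a' z * (d z).+1 + b z * (d' z).+1)%N)); last by cmp_solve.
move=> z; rewrite eF eG ler_pdivrMr // mulrAC ler_pdivlMr //.
by rewrite !mulrBl -!natrM lerBlDr addrAC lerBrDr -!natrD ler_nat.
Qed.

Lemma cmpQ_lt F G : cmpQ F -> cmpQ G -> cmpb (fun z => F z < G z).
Proof.
move=> hF hG; apply: (@cmp_ext _ (fun z => ~~ (G z <= F z))) => [z|].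
  by rewrite ltNge.
by apply: cmp_neg; apply: cmpQ_le.
Qed.

Definition qR (n : nat) : R := ratr (qdec n).

Lemma cmpQ_qR N : cmp N -> cmpQ (fun z => qR (N z)).
Proof.
move=> hN; exists
  (fun z => if (cunpair (N z)).1 %% 2 == 1 then 0 else (cunpair (N z)).1 %/ 2)%N,
  (fun z => if (cunpair (N z)).1 %% 2 == 1 then (cunpair (N z)).1.+1 %/ 2 else 0)%N,
  (fun z => (cunpair (N z)).2).
split; try by cmp_solve.
move=> z; rewrite /qR /qdec; set ab := cunpair _.
rewrite fmorph_div /= ratr_int ratr_nat; congr (_ / _).
rewrite /zz modn2 !divn2; case: (odd _) => /=; first by rewrite mulrNz sub0r.
by rewrite subr0.
Qed.

Lemma qdec_surj (r : rat) : exists n, qdec n = r.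
Proof.
have [k hk] : exists k, zz k = numq r.
  case: (numq r) => n; first by exists n.*2; rewrite /zz odd_double doubleK.
  by exists n.*2.+1; rewrite /zz /= odd_double /= doubleK NegzE.
exists (cpair k `|denq r|%N.-1); rewrite /qdec cunpairK /= hk.
rewrite -[RHS]divq_num_den; congr (_ / _).
by have := denq_gt0 r; case: (denq r) => // -[].
Qed.

Lemma qR_dense (x e : R) : 0 < e -> exists n, `|qR n - x| < e.
Proof.
move=> e0; have [r] := @rat_in_itvoo R (x - e) (x + e) ltac:(lra).
have [n <-] := qdec_surj r; rewrite in_itv /= => /andP[h1 h2]; exists n.
by rewrite ltr_norml /qR; lra.
Qed.

Lemma qR_between (x y : R) : x < y -> exists n, x < qR n < y.
Proof.
move=> xy; have [n] := @qR_dense ((x + y) / 2) ((y - x) / 2) ltac:(lra).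
by rewrite ltr_norml => /andP[? ?]; exists n; lra.
Qed.

End CompRat.

Ltac cmpQ_step := first
  [ assumption
  | lazymatch goal with
    | |- cmpQ (fun=> _%:R) => exact: cmpQ_int
    | |- cmpQ (fun=> 1) => exact: (cmpQ_int 1)
    | |- cmpQ (fun=> 0) => exact: (cmpQ_int 0)
    | |- cmpQ (fun z => (@?F z) + (@?G z)) => apply: (@cmpQ_add _ F G)
    | |- cmpQ (fun z => (@?F z) * (@?G z)) => apply: (@cmpQ_mul _ F G)
    | |- cmpQ (fun z => - (@?F z)) => apply: (@cmpQ_opp _ F)
    | |- cmpQ (fun z => `|@?F z|) => apply: (@cmpQ_norm _ F)
    | |- cmpQ (fun z => (2 ^+ (@?F z))^-1) => apply: (@cmpQ_exp2 _ F)
    | |- cmpQ (fun z => (@?F z) ^+ ?k) => apply: (@cmpQ_exp _ F k)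
    | |- cmpQ (fun z => qR (@?F z)) => apply: (@cmpQ_qR _ F)
    | |- cmpQ (fun z => (S (@?F z))%:R^-1) => apply: (@cmpQ_inv _ F)
    | |- cmpQ (fun z => (@?F z)%:R) => apply: (@cmpQ_nat _ F)
    | |- cmpQ (fun z => \sum_i _) => apply: cmpQ_sum => ?
    | |- computable_seq (fun z => nat_of_bool (@Order.le _ _ (@?F z) (@?G z))) =>
        apply: (@cmpQ_le _ F G)
    | |- computable_seq (fun z => nat_of_bool (@Order.lt _ _ (@?F z) (@?G z))) =>
        apply: (@cmpQ_lt _ F G)
    | |- computable_seq (fun z => nat_of_bool [forall i, _]) => apply: cmp_big_and => ?
    | |- computable_seq (fun z => nat_of_bool [exists i, _]) => apply: cmp_big_or => ?
    | |- computable_seq (fun z => (\sum_i _)%N) => apply: cmp_sum => ?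
    | |- computable_seq (fun z => nthc (@?F z) (@?G z)) => apply: (@cmp_nthc F G)
    | |- computable_seq (fun z => runm ?E (nthc (@?F z)) (@?G z) (@?H z)) =>
        apply: (@cmp_runm E F G H)
    end | cmp_step ].
Ltac cmpQ_solve := repeat cmpQ_step.

(** * A discrete Poincare-Miranda theorem *)

Section DiscretePM.
Variables (n N : nat) (s : 'I_n -> 'rV[nat]_n -> bool).
Local Notation V := 'rV[nat]_n.
Implicit Types (u v : V) (A : {set 'I_n}) (L : seq 'I_n).

Definition ei (j : 'I_n) : V := delta_mx 0 j.

Lemma eiE j v i : (v + ei j) 0 i = (v 0%R i + (i == j))%N.
Proof. by rewrite !mxE eqxx /=; case: (i == j). Qed.

Lemma eiME j t v i : (v + ei j *+ t) 0 i = (v 0%R i + (i == j) * t)%N.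
Proof.
elim: t => [|t IH]; first by rewrite mulr0n addr0 muln0 addn0.
by rewrite mulrSr addrA eiE IH mulnS -addnA (addnC (_ * t)%N).
Qed.

(** Addition on [bool] is exclusive or: this is the difference in direction [j] modulo 2. *)
Definition diffb (j : 'I_n) (g : V -> bool) (v : V) : bool := g (v + ei j) + g v.

(* The cup product of the coboundaries of the [s k], [k] in [L], on the cubical
   lattice, in the directions of [A],
   modulo 2. *)
Fixpoint cup A L v : bool :=
  if L is k :: L' then \sum_(j in A) diffb j (s k) v * cup (A :\ j) L' (v + ei j)
  else 1.

Lemma addbb_ring (b : bool) : b + b = 0.
Proof. by case: b. Qed.

Lemma sum_sym0 (T : 'I_n -> 'I_n -> bool) : (forall j k, T j k = T k j) ->
  (forall j, T j j = 0) -> \sum_j \sum_k T j k = 0.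
Proof.
move=> sT T0.
have -> : \sum_j \sum_k T j k =
    \sum_(j < n) \sum_(k < n | (k < j)%N) T j k + \sum_(j < n) \sum_(k < n | (j < k)%N) T j k.
  rewrite -big_split /=; apply: eq_bigr => j _.
  rewrite (bigID (fun k : 'I_n => (k < j)%N)) /=; congr (_ + _).
  rewrite (bigD1 j) ?ltnn //= T0 add0r; apply: eq_bigl => k.
  by rewrite -leqNgt ltn_neqAle eq_sym andbC.
have -> : \sum_(j < n) \sum_(k < n | (j < k)%N) T j k = \sum_(j < n) \sum_(k < n | (k < j)%N) T j k.
  rewrite (exchange_big_dep predT) //=; apply: eq_bigr => j _; apply: eq_bigr => k _.
  exact: sT.
exact: addbb_ring.
Qed.

(** The Leibniz rule: since the product over [L] is closed, multiplying it by the coboundary of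
    [s k] gives the coboundary of its product with [s k]. *)
Lemma cup_exact A L k v : cup A (k :: L) v =
  \sum_(j in A) diffb j (fun u => s k u * cup (A :\ j) L u) v.
Proof.
elim: L A k v => [|k' L IH] A k v.
  by apply: eq_bigr => j _; rewrite /diffb /= !mulr1.
(* By induction this is a sum of second differences, symmetric in the two directions, so it cancels
   modulo 2. *)
have closed (B : {set 'I_n}) w : \sum_(j in B) diffb j (cup (B :\ j) (k' :: L)) w = 0.
  pose T j i := if [&& j \in B, i \in B & i != j] then
    diffb j (diffb i (fun u => s k' u * cup (B :\ j :\ i) L u)) w else 0.
  rewrite (eq_bigr (fun j => \sum_(i in B :\ j)
      diffb j (diffb i (fun u => s k' u * cup (B :\ j :\ i) L u)) w)).
    rewrite big_mkcond /= -[RHS](@sum_sym0 T); first last.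
    - by move=> j; rewrite /T eqxx !andbF.
    - move=> j i; rewrite /T (andbCA (j \in B)) eq_sym; case: ifP => // _.
      rewrite /diffb !finset.setDDl (finset.setUC [set j]%SET) (addrAC _ (ei j)).
      by rewrite -!addrA; congr (_ + _); rewrite addrCA.
    apply: eq_bigr => j _; rewrite /T; case: (j \in B); last by rewrite big1.
    rewrite big_mkcond /=; apply: eq_bigr => i _.
    by rewrite finset.in_setD1 /= andbC.
  move=> j jB; rewrite /diffb !IH -big_split; exact: eq_bigr.
transitivity (\sum_(j in A) diffb j (s k) v * cup (A :\ j) (k' :: L) (v + ei j) +
    s k v * \sum_(j in A) diffb j (cup (A :\ j) (k' :: L)) v).
  by rewrite closed mulr0 addr0.
rewrite mulr_sumr -big_split; apply: eq_bigr => j _; rewrite /diffb.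
move: (cup _ _ _) (cup _ _ _) (s k _) (s k _) => a b c d.
by case: a; case: b; case: c; case: d.
Qed.

Definition cubeb A v u := forall i, (v 0%R i <= u 0%R i <= v 0%R i + (i \in A))%N.

Lemma cubeb_refl A v : cubeb A v v.
Proof. by move=> i; rewrite leqnn leq_addr. Qed.

Lemma cubeb_ei A v j : j \in A -> cubeb A v (v + ei j).
Proof.
move=> jA i; rewrite eiE leq_addr leq_add2l /=.
by case: eqP => // ->; rewrite jA.
Qed.

Lemma sub_cubeb A v j u : j \in A -> cubeb (A :\ j) (v + ei j) u -> cubeb A v u.
Proof.
move=> jA h i; have := h i; rewrite eiE finset.in_setD1.
by case: eqP => [->|_] /=; rewrite ?jA ?addn0 //; lia.
Qed.

(** The coboundary of [s k] is one of the factors and vanishes on every edge of the face. *)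
Lemma cup_const A L k c v : k \in L -> (forall u, cubeb A v u -> s k u = c) ->
  cup A L v = 0.
Proof.
elim: L A v => // k' L IH A v; rewrite inE => kL h /=; rewrite big1 // => j jA.
case/orP: kL => [/eqP<-|kL].
  by rewrite /diffb !h ?addbb_ring ?mul0r //; [apply: cubeb_refl|apply: cubeb_ei].
rewrite IH ?mulr0 // => u hu; apply: h; exact: sub_cubeb hu.
Qed.

(** The sum over the box of side [N] at [v] in the directions of [L], nested so that it can
    telescope in each direction. *)
Fixpoint boxsum L (g : V -> bool) v : bool :=
  if L is j :: L' then \sum_(t < N) boxsum L' g (v + ei j *+ t) else g v.

Lemma eq_boxsum L g g' v :
  (forall u, (forall i, i \notin L -> u 0 i = v 0 i) -> g u = g' u) ->
  boxsum L g v = boxsum L g' v.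
Proof.
elim: L v => [|j L IH] v h /=; first exact: h.
apply: eq_bigr => t _; apply: IH => u hu; apply: h => i; rewrite inE negb_or => /andP[ij iL].
by rewrite hu // eiME (negbTE ij) addn0.
Qed.

Lemma boxsum0 L v : boxsum L (fun=> 0) v = 0.
Proof. by elim: L v => //= j L IH v; rewrite big1. Qed.

Lemma boxsumD L g g' v : boxsum L (fun u => g u + g' u) v = boxsum L g v + boxsum L g' v.
Proof.
by elim: L v => //= j L IH v; rewrite -big_split; apply: eq_bigr => t _; apply: IH.
Qed.

Lemma boxsum_sum (I : Type) (r : seq I) (P : pred I) L (g : I -> V -> bool) v :
  boxsum L (fun u => \sum_(i <- r | P i) g i u) v = \sum_(i <- r | P i) boxsum L (g i) v.
Proof.
elim: r => [|i r IH].
  by rewrite big_nil -[RHS](boxsum0 L v); apply: eq_boxsum => u _; rewrite big_nil.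
rewrite big_cons -IH; case: ifP => h; [rewrite -boxsumD|];
  by apply: eq_boxsum => u _; rewrite big_cons h.
Qed.

Lemma boxsum_shift L g w v : boxsum L (fun u => g (u + w)) v = boxsum L g (v + w).
Proof.
by elim: L v => //= j L IH v; apply: eq_bigr => t _; rewrite IH addrAC.
Qed.

(** Telescoping in direction [j] leaves the two opposite faces. *)
Lemma boxsum_diff L j g v : j \in L ->
  boxsum L (diffb j g) v = boxsum (rem j L) g (v + ei j *+ N) + boxsum (rem j L) g v.
Proof.
elim: L v => // k L IH v; rewrite inE [rem _ _]/=; have [->|jk] := eqVneq k j.
  move=> _ /=; rewrite (eq_bigr (fun t : 'I_N => boxsum L g (v + ei j *+ t.+1) +
     boxsum L g (v + ei j *+ t))); last first.
    by move=> t _; rewrite boxsumD boxsum_shift mulrSr addrA.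
  elim: (N) => [|M IHM]; first by rewrite big_ord0 mulr0n addr0 addbb_ring.
  rewrite big_ord_recr /= IHM.
  by move: (boxsum _ _ _) (boxsum _ _ _) (boxsum _ _ _) => a b c; case: a; case: b; case: c.
rewrite /= => jL; rewrite -big_split; apply: eq_bigr => t _.
by rewrite IH // addrAC.
Qed.

Lemma boxsum_neq0 L g v : uniq L -> boxsum L g v ->
  exists2 u, g u & forall i, if i \in L then (u 0%R i < v 0%R i + N)%N else u 0%R i == v 0%R i.
Proof.
elim: L v => [|j L IH] v /=; first by exists v.
move=> /andP[jL uL] h; have [t /(IH _ uL)[u gu hu]] : exists t : 'I_N, boxsum L g (v + ei j *+ t).
  apply: contrapT => h0; move: h; rewrite big1 // => t _.
  by apply/negbTE/negP => ht; apply: h0; exists t.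
exists u => // i; have := hu i; rewrite inE eiME; case: eqP => [->|_] /=.
  by rewrite (negbTE jL) => /eqP->; rewrite mul1n ltn_add2l.
by rewrite addn0.
Qed.

Hypothesis s0 : forall i v, v 0 i = 0%N -> s i v = false.
Hypothesis sN : forall i v, v 0 i = N -> s i v = true.

(** By [cup_exact] and telescoping, only faces contribute. In direction [k] the upper face gives the
    same sum in one dimension less and the lower face gives 0; all other directions give 0. *)
Lemma boxsum_cup L v : uniq L -> (forall i, i \in L -> v 0 i = 0%N) ->
  boxsum L (cup [set i in L]%SET L) v = 1.
Proof.
elim: L v => // k L IH v /andP[kL uL] v0.
set A := [set i in _ :: _]%SET.
have AkL : A :\ k = [set i in L]%SET.
  by apply/setP => i; rewrite !inE; case: eqP => // ->; rewrite (negbTE kL).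
pose G j u := s k u * cup (A :\ j) L u.
have -> : boxsum (k :: L) (cup A (k :: L)) v =
    \sum_(j in A) (boxsum (rem j (k :: L)) (G j) (v + ei j *+ N) +
      boxsum (rem j (k :: L)) (G j) v).
  rewrite (eq_boxsum (g' := fun v => \sum_(j in A) diffb j (G j) v));
    last by move=> u _; apply: cup_exact.
  rewrite boxsum_sum; apply: eq_bigr => j jA; apply: boxsum_diff.
  by move: jA; rewrite inE.
rewrite (bigD1 k) ?inE ?eqxx // big1 ?addr0.
  rewrite /= eqxx (eq_boxsum (g' := cup [set i in L]%SET L) (v := v + _)); last first.
    move=> u hu; rewrite /G AkL sN ?mul1r // hu // eiME v0 ?inE ?eqxx //.
    by rewrite add0n mul1n.
  rewrite IH // => [|i iL].
    rewrite (eq_boxsum (g' := fun=> 0)) ?boxsum0 ?addr0 // => u hu.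
    by rewrite /G s0 ?mul0r // hu // v0 // inE eqxx.
  rewrite eiME v0 ?inE ?iL ?orbT //; case: eqP => // e.
  by move: kL; rewrite -e iL.
move=> j; rewrite !inE => /andP[/orP[/eqP->|jL] jk]; first by rewrite eqxx in jk.
(* On a face orthogonal to [j] the function [s j] is constant, and [j] still occurs in [L]. *)
have vanish (w : V) : w 0 j = 0%N \/ w 0 j = N ->
    boxsum (rem j (k :: L)) (G j) w = 0.
  move=> wj; rewrite /G -[RHS](boxsum0 (rem j (k :: L)) w); apply: eq_boxsum => u hu.
  have uj : u 0 j = w 0 j by apply: hu; rewrite mem_rem_uniqF //= kL.
  have c u' : cubeb (A :\ j) u u' -> u' 0 j = u 0 j.
    by move=> /(_ j); rewrite !inE eqxx addn0 -eqn_leq => /eqP.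
  case: wj => wj; [rewrite (@cup_const _ _ j false)|rewrite (@cup_const _ _ j true)];
    rewrite ?mulr0 // => u' /c e; [apply: s0|apply: sN]; by rewrite e uj.
by rewrite !vanish ?addr0 //; [left|right]; rewrite ?eiME v0 ?inE ?jL ?orbT // eqxx mul1n.
Qed.

(** The sum over the whole box is 1, so the product is nonzero on some cell, and by [cup_const] no
    sign function is constant there. *)
Lemma discrete_PM : exists2 v : V, (forall i, v 0%R i < N)%N & forall i,
  exists u w : V, [/\ forall j, (v 0%R j <= u 0%R j <= (v 0%R j).+1)%N,
    forall j, (v 0%R j <= w 0%R j <= (v 0%R j).+1)%N, s i u & ~~ s i w].
Proof.
have := @boxsum_cup (enum 'I_n) 0 (enum_uniq _); set A := [set i in _]%SET => h.
have {h} : boxsum (enum 'I_n) (cup A (enum 'I_n)) 0 by rewrite h // => i; rewrite mxE.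
move=> /(boxsum_neq0 (enum_uniq _))[v cv hv]; exists v => [i|i].
  by have := hv i; rewrite mem_enum mxE.
have [u hu siu] : exists2 u, cubeb A v u & s i u != s i v.
  apply: contrapT => h; suff : cup A (enum 'I_n) v = 0 by rewrite cv.
  apply: (@cup_const _ _ i (s i v)); first by rewrite mem_enum.
  by move=> u hu; apply/eqP/negPn/negP => hs; apply: h; exists u.
have cA u' j : cubeb A v u' -> (v 0%R j <= u' 0%R j <= (v 0%R j).+1)%N.
  by move=> /(_ j); rewrite !inE mem_enum addn1.
have vv := cubeb_refl A v.
case e : (s i v) siu; case e' : (s i u) => // _; [exists v, u|exists u, v];
  by split=> [j|j||]; rewrite ?e ?e' //; apply: cA.
Qed.

End DiscretePM.

(** * Sup norm and compactness *)

Section NormRV.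
Context {R : realType} {n : nat}.
Implicit Types (x y z : 'rV[R]_n).

Lemma rV_norm_coord x i : `|x 0 i| <= `|x|.
Proof.
by rewrite [leRHS]mx_normrE; exact: (le_bigmax 0 (fun ij : 'I_1 * 'I_n => `|x ij.1 ij.2|) (0, i)).
Qed.

Lemma rV_norm_coordB x y i : `|x 0 i - y 0 i| <= `|x - y|.
Proof. by have := rV_norm_coord (x - y) i; rewrite !mxE. Qed.

Lemma rV_norm_coordBB x y z i : `|x 0 i - y 0 i - z 0 i| <= `|x - y - z|.
Proof. by have := rV_norm_coord (x - y - z) i; rewrite !mxE. Qed.

Lemma rV_norm_le x (d : R) : 0 <= d -> (forall i, `|x 0 i| <= d) -> `|x| <= d.
Proof.
move=> d0 h; rewrite [leLHS]mx_normrE; apply/bigmax_leP; split=> // -[i j] _ /=.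
by rewrite ord1.
Qed.

Lemma rV_norm_lt x (d : R) : 0 < d -> (forall i, `|x 0 i| < d) -> `|x| < d.
Proof.
move=> d0 h; rewrite [ltLHS]mx_normrE; apply/bigmax_ltP; split=> // -[i j] _ /=.
by rewrite ord1.
Qed.

Lemma rV_norm_attained x : (0 < n)%N -> exists i, `|x| = `|x 0 i|.
Proof.
move=> n0; have [x0|/mx_norm_neq0[[j i]]] := eqVneq (`|x| : R) 0; last first.
  by rewrite ord1 /= => e; exists i.
exists (Ordinal n0); rewrite x0; apply/esym/eqP; rewrite normr_eq0.
by move/eqP: x0; rewrite normr_eq0 => /eqP->; rewrite mxE.
Qed.

Lemma compact_cube (c : 'rV[R]_n) (r : R) : compact [set x | `|x - c| <= r].
Proof.
apply: bounded_closed_compact.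
  exists (`|c| + r); split; first exact: num_real.
  move=> M hM x /= hx; rewrite (le_trans _ (ltW hM)) // -(subrK c x).
  by rewrite addrC (le_trans (ler_normD _ _)) // lerD2l.
have -> : [set x | `|x - c| <= r] = closed_ball_ Num.norm c r.
  by apply/seteqP; split=> x /=; rewrite distrC.
exact: closed_closed_ball_.
Qed.

(** The near-covering form of compactness along the filter [0^'+]; it replaces choices of finite
    subcovers below. *)
Lemma compact_uniform (K : set 'rV[R]_n) (P : R -> 'rV[R]_n -> Prop) : compact K ->
  (forall x, K x -> exists2 d, 0 < d &
     forall y e, `|y - x| < d -> 0 < e <= d -> P e y) ->
  exists2 d, 0 < d & forall x, K x -> P d x.
Proof.
move=> /compact_near_coveringP cK h.
have : \forall d \near 0^'+, K `<=` P d.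
  apply: (cK R) => x /h[d d0 hd].
  exists (ball x d, [set e | 0 < e <= d]); last first.
    by move=> [y e] /= [+ e0]; rewrite -ball_normE /ball_ /= distrC => yx; apply: hd.
  split; first exact: nbhsx_ballx.
  have h1 := nbhs_right_gt (0 : R); have h2 := nbhs_right_le d0.
  by apply: filterS2 h1 h2 => e /= -> ->.
move=> hn; have /filter_ex[d [d0 hd]] : \forall d \near 0^'+, 0 < d /\ K `<=` P d.
  by apply: filterS2 (nbhs_right_gt (0 : R)) hn.
by exists d.
Qed.

End NormRV.

Section ContE.
Context {R : realType} {U V : normedModType R}.

Lemma contP (f : U -> V) x : {for x, continuous f} <->
  forall e, 0 < e -> exists2 d, 0 < d & forall y, `|y - x| < d -> `|f y - f x| < e.
Proof.
split=> [/cvgrPdist_lt h e /h /nbhs_ballP[d d0 hd]|h].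
  exists d => // y yx; rewrite distrC; apply: hd.
  by rewrite -ball_normE /ball_ /= distrC.
apply/cvgrPdist_lt => e /h[d d0 hd]; apply/nbhs_ballP; exists d => // y.
by rewrite -ball_normE /ball_ /= distrC => /hd; rewrite distrC.
Qed.

End ContE.

Lemma rV_contP {R : realType} {n : nat} {U : normedModType R} (f : U -> 'rV[R]_n) x :
  {for x, continuous f} <-> forall i, {for x, continuous (fun y => f y 0 i)}.
Proof.
split=> [/contP h i|h].
  apply/contP => e /h[d d0 hd]; exists d => // y /hd; apply: le_lt_trans.
  by have := rV_norm_coord (f y - f x) i; rewrite !mxE.
apply/contP => e e0.
have /choice[d hd] : forall i, exists d, 0 < d /\
    forall y, `|y - x| < d -> `|f y 0 i - f x 0 i| < e.
  by move=> i; have /contP/(_ _ e0)[d ? ?] := h i; exists d.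
exists (\big[Order.min/1]_i d i).
  by apply/bigmin_gtP; split=> // i _; case: (hd i).
move=> y hy; apply: rV_norm_lt => // i; rewrite !mxE; apply: (hd i).2.
by apply: lt_le_trans hy _; apply: bigmin_le_cond.
Qed.

(** * The Poincare-Miranda theorem *)

Section PoincareMiranda.
Context {R : realType}.

(** Without a zero, compactness gives one [d] such that around each point some component keeps a
    strict sign up to distance [d]. A lattice of mesh at most [d] then contradicts [discrete_PM]. *)
Lemma poincare_miranda n (rho : R) (H : 'rV[R]_n -> 'rV[R]_n) : 0 < rho -> continuous H ->
  (forall (x : 'rV[R]_n) i, `|x| <= rho -> x 0 i = - rho -> H x 0 i <= 0) ->
  (forall (x : 'rV[R]_n) i, `|x| <= rho -> x 0 i = rho -> 0 <= H x 0 i) ->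
  exists2 x, `|x| <= rho & H x = 0.
Proof.
move=> rho0 cH Hl Hr; apply: contrapT => noz.
pose P (d : R) (x : 'rV[R]_n) := exists i, (forall y, `|y - x| <= d -> 0 < H y 0 i) \/
  (forall y, `|y - x| <= d -> H y 0 i < 0).
have [d d0 hd] : exists2 d, 0 < d & forall x, `|x| <= rho -> P d x.
  have := @compact_uniform R n [set x | `|x - 0| <= rho] P (@compact_cube R n 0 rho).
  move=> h; have [|d d0 hd] := h; last by exists d => // x hx; apply: hd; rewrite /= subr0.
  move=> x /=; rewrite subr0 => hx.
  have [i Hi] : exists i, H x 0 i != 0.
    apply: contrapT => h0; apply: noz; exists x => //; apply/rowP => i; rewrite mxE.
    by apply/eqP/negPn/negP => ?; apply: h0; exists i.
  have /rV_contP/(_ i)/contP/(_ `|H x 0 i|) := cH x.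
  rewrite normr_gt0 => /(_ Hi)[d d0 hd].
  exists (d / 2); first by lra.
  move=> y e yx /andP[e0 ed].
  have near z : `|z - y| <= e -> `|H z 0 i - H x 0 i| < `|H x 0 i|.
    move=> zy; apply: hd; rewrite -(subrK y z) -addrA (le_lt_trans (ler_normD _ _)) //; lra.
  exists i; case: (ltrP 0 (H x 0 i)) => h0; [left|right] => z /near.
    by rewrite (gtr0_norm h0) ltr_norml; lra.
  by rewrite (ler0_norm h0) ltr_norml; move/eqP: Hi; lra.
pose N := (Num.truncn (2 * rho / d)).+1.
have N0 : 0 < N%:R :> R by [].
have Nd : 2 * rho / N%:R <= d.
  rewrite ler_pdivrMr // -ler_pdivrMl // mulrC.
  exact/ltW/truncnS_gt.
pose pt (v : 'rV[nat]_n) : 'rV[R]_n := \row_i (rho * (2 * (v 0 i)%:R / N%:R - 1)).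
(* The sign is prescribed on the two faces, where the hypotheses give only weak inequalities for
   [H]. *)
pose s (i : 'I_n) (v : 'rV[nat]_n) := (N <= v 0%R i)%N || (0 < v 0%R i)%N && (0 < H (pt v) 0 i).
have [||v vN hv] := @discrete_PM n N s.
- by move=> i v /= v0; rewrite /s v0.
- by move=> i v /= vN; rewrite /s vN leqnn.
have ptK (u : 'rV[nat]_n) : (forall j, (u 0%R j <= N)%N) -> `|pt u| <= rho.
  move=> uN; apply: rV_norm_le => [|i]; first exact: ltW.
  have h1 : (u 0 i)%:R / N%:R <= 1 :> R by rewrite ler_pdivrMr // mul1r ler_nat.
  have h2 : 0 <= (u 0 i)%:R / N%:R :> R by rewrite divr_ge0.
  by rewrite mxE -mulrA ler_norml; nra.
have [i hi] := hd _ (ptK v (fun j => ltnW (vN j))).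
have [u [w [hu hw su sw]]] := hv i.
have close (z : 'rV[nat]_n) : (forall j, (v 0%R j <= z 0%R j <= (v 0%R j).+1)%N) ->
    `|pt z - pt v| <= d /\ (forall j, (z 0%R j <= N)%N).
  move=> hz; split; last by move=> j; have := hz j; have := vN j; lia.
  apply: rV_norm_le => [|j]; first exact: ltW.
  rewrite !mxE; have -> : rho * (2 * (z 0 j)%:R / N%:R - 1) - rho * (2 * (v 0 j)%:R / N%:R - 1)
     = 2 * rho / N%:R * ((z 0 j)%:R - (v 0 j)%:R) by ring.
  have /andP[vz zv] := hz j.
  rewrite -natrB // normrM ger0_norm; last by rewrite divr_ge0 // mulr_ge0 // ltW.
  rewrite normr_nat (le_trans _ Nd) // -[leRHS]mulr1 ler_wpM2l //.
    by rewrite divr_ge0 // mulr_ge0 // ltW.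
  by rewrite lern1; lia.
have [ud uN] := close _ hu; have [wd wN] := close _ hw.
have Hu : 0 <= H (pt u) 0 i.
  case/orP: su => [Nu|/andP[_ /ltW//]].
  apply: Hr; first exact: ptK.
  have -> : pt u 0 i = rho * (2 * N%:R / N%:R - 1).
    by rewrite mxE; congr (_ * (_ * _%:R / _ - _)); apply/eqP; rewrite eqn_leq uN.
  by rewrite mulfK ?gt_eqF //; lra.
have Hw : H (pt w) 0 i <= 0.
  move: sw; rewrite negb_or negb_and -leNgt -eqn0Ngt.
  case/andP => _ /orP[/eqP w0|//]; apply: Hl; first exact: ptK.
  by rewrite mxE w0 mulr0 mul0r; lra.
by case: hi => hi; [have := hi _ wd|have := hi _ ud]; lra.
Qed.

(* The image has too few points: a grid of [(T+1)^n] targets would need that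
   many cells of the boundary, which only has [O(T^(n-1))] of them. *)
Lemma lipschitz_sphere_misses n (P : 'rV[R]_n.+1 -> 'rV[R]_n.+1) (c : 'rV[R]_n.+1)
    (Lam eps eta : R) : 0 < eps -> 0 < eta -> 0 <= Lam ->
  (forall x y, `|P x - P y| <= Lam * `|x - y|) ->
  exists2 a, `|a| <= eta & forall y, `|y - c| = eps -> P y != a.
Proof.
move=> eps0 eta0 Lam0 lip; apply: contrapT => none.
have /choice[g hg] : forall a : 'rV[R]_n.+1, exists y,
    `|a| <= eta -> `|y - c| = eps /\ P y = a.
  move=> a; apply: contrapT => h.
  have [ale|ale] := leP `|a| eta; last by apply: h; exists 0; rewrite leNgt ale.
  apply: none; exists a => // y yc; apply/negP => /eqP e; apply: h; exists y; split=> //.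
pose k := (Num.truncn (Lam * eps / eta)).+1.
have kgt : Lam * eps / eta < k%:R by exact: truncnS_gt.
(* There are [T.+1 ^ n.+1] targets and [2 * n.+1 * N.+1 ^ n] classes of boundary points; this [T]
   makes the former more numerous. The factor [k] in [N] makes cells so fine that [P] maps two
   points of one cell closer than the step of the target grid. *)
pose T := (2 * n.+1 * k ^ n)%N.
pose N := (k * T)%N.
have k0 : (0 < k)%N by [].
have T0 : (0 < T)%N by rewrite /T !muln_gt0 expn_gt0.
have N0 : (0 < N)%N by rewrite muln_gt0 k0.
have TR : 0 < T%:R :> R by rewrite ltr0n.
have NR : 0 < N%:R :> R by rewrite ltr0n.
pose pt (s : {ffun 'I_n.+1 -> 'I_T.+1}) : 'rV[R]_n.+1 :=
  \row_i (eta * (2 * (s i)%:R / T%:R - 1)).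
have ptle s : `|pt s| <= eta.
  apply: rV_norm_le => [|i]; first exact: ltW.
  have h1 : (s i)%:R / T%:R <= 1 :> R by rewrite ler_pdivrMr // mul1r ler_nat -ltnS.
  have h2 : 0 <= (s i)%:R / T%:R :> R by rewrite divr_ge0.
  by rewrite mxE -mulrA ler_norml; nra.
have /choice[dir hdir] : forall s, exists i, `|(g (pt s) - c) 0 i| = eps.
  move=> s; have [i hi] := rV_norm_attained (g (pt s) - c) isT.
  by exists i; rewrite -hi; have [] := hg _ (ptle s).
have coord s i : `|(g (pt s) - c) 0 i| <= eps.
  by rewrite (le_trans (rV_norm_coord _ _)) //; have [->] := hg _ (ptle s).
pose cell (s : {ffun 'I_n.+1 -> 'I_T.+1}) (i : 'I_n.+1) : nat :=
  Num.truncn (((g (pt s) - c) 0 i + eps) / (2 * eps) * N%:R).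
have cellE s i : (cell s i)%:R <= ((g (pt s) - c) 0 i + eps) / (2 * eps) * N%:R < (cell s i).+1%:R.
  apply: truncn_itv; rewrite mulr_ge0 // divr_ge0 //; last by lra.
  by have := coord s i; rewrite ler_norml; lra.
have cellN s i : (cell s i < N.+1)%N.
  rewrite ltnS -(ler_nat R); have /andP[h _] := cellE s i; rewrite (le_trans h) //.
  rewrite -[leRHS]mul1r ler_wpM2r // ler_pdivrMr; last by lra.
  by have := coord s i; rewrite ler_norml; lra.
(* The class of the chosen preimage: the direction and side of a face containing it, and its cell in
   the other [n] coordinates. *)
pose cls s : 'I_n.+1 * bool * {ffun 'I_n -> 'I_N.+1} :=
  (dir s, 0 < (g (pt s) - c) 0 (dir s), [ffun i => inord (cell s (lift (dir s) i))]).
have inj : injective cls.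
  move=> s s' [e1 e2 /ffunP e3].
  have close : `|g (pt s) - g (pt s')| <= 2 * eps / N%:R.
    apply: rV_norm_le => [|i]; first by rewrite divr_ge0 // mulr_ge0 // ltW.
    have -> : (g (pt s) - g (pt s')) 0 i = (g (pt s) - c) 0 i - (g (pt s') - c) 0 i.
      by rewrite !mxE; ring.
    case: (unliftP (dir s) i) => [j ->|->]; last first.
      have := hdir s; have := hdir s'; rewrite -e1 in e2 *.
      have e0 : 0 <= 2 * eps / N%:R by rewrite divr_ge0 // mulr_ge0 // ltW.
      case: (ltrP 0 ((g (pt s) - c) 0 (dir s))) e2 => h1 /esym h2.
        by rewrite (gtr0_norm h1) (gtr0_norm h2) => -> ->; rewrite subrr normr0.
      move/negbT: h2; rewrite -leNgt => h2.
      rewrite (ler0_norm h1) (ler0_norm h2) => a b.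
      have -> : (g (pt s) - c) 0 (dir s) - (g (pt s') - c) 0 (dir s) = 0 by lra.
      by rewrite normr0.
    have := e3 j; rewrite !ffunE -e1 => /(congr1 (@nat_of_ord _)); rewrite !inordK // => ec.
    have := cellE s (lift (dir s) j); have := cellE s' (lift (dir s) j); rewrite -ec.
    move: ((g (pt s) - c) 0 _) ((g (pt s') - c) 0 _) => A B.
    move: (cell s _) => K; rewrite -[K.+1%:R]natr1.
    have e a : (a + eps) / (2 * eps) * N%:R = (a + eps) / (2 * eps / N%:R).
      by field; rewrite !gt_eqF.
    have d0 : 0 < 2 * eps / N%:R by rewrite divr_gt0 // mulr_gt0.
    rewrite !e; move: (_ / N%:R) d0 => d d0.
    rewrite !ler_pdivlMr // !ltr_pdivrMr // mulrDl mul1r => hB hA.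
    by rewrite ler_norml; lra.
  apply/ffunP => i; apply: val_inj => /=.
  have := lip (g (pt s)) (g (pt s')).
  have [_ ->] := hg _ (ptle s); have [_ ->] := hg _ (ptle s').
  move=> /(le_trans (rV_norm_coord _ i)) h.
  have {h} := le_trans h (ler_wpM2l Lam0 close).
  rewrite !mxE; have -> : eta * (2 * (s i)%:R / T%:R - 1) - eta * (2 * (s' i)%:R / T%:R - 1) =
    2 * eta / T%:R * ((s i)%:R - (s' i)%:R) by ring.
  rewrite normrM ger0_norm; last by rewrite divr_ge0 // mulr_ge0 // ltW.
  move=> h; apply/eqP; apply: contraT => ne.
  have ge1 : 1 <= `|(s i)%:R - (s' i)%:R| :> R.
    case: (ltngtP (s i) (s' i)) ne => // lt _; [rewrite distrC|];
      by rewrite -natrB 1?ltnW // normr_nat ler1n subn_gt0.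
  have : 2 * eta / T%:R <= Lam * (2 * eps / N%:R).
    rewrite (le_trans _ h) // -[leLHS]mulr1 ler_wpM2l // divr_ge0 // mulr_ge0 // ltW //.
  rewrite /N natrM; have kR : 0 < k%:R :> R by [].
  have -> : Lam * (2 * eps / (k%:R * T%:R)) = (2 * (Lam * eps / k%:R)) / T%:R.
    by field; rewrite !gt_eqF.
  rewrite ler_pM2r ?invr_gt0 // ler_pM2l // ler_pdivlMr // => h2.
  by move: kgt; rewrite ltr_pdivrMr // [_ * eta]mulrC ltNge h2.
have := leq_card _ inj; rewrite !card_prod !card_ffun !card_ord card_bool leqNgt.
have -> // : (n.+1 * 2 * N.+1 ^ n < T.+1 ^ n.+1)%N.
have h1 : (N.+1 ^ n <= k ^ n * T.+1 ^ n)%N.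
  have h : (N.+1 <= k * T.+1)%N by rewrite /N mulnS -add1n leq_add2r.
  by rewrite -expnMn; case: (n) => // n'; rewrite leq_exp2r.
rewrite expnS (leq_ltn_trans (leq_mul (leqnn _) h1)) //.
by rewrite mulnA ltn_mul2r expn_gt0 /= /T (mulnC 2).
Qed.

End PoincareMiranda.

(** * Invariance of domain *)

Section DomainInvariance.
Context {R : realType}.

(** A modulus of continuity for the inverse of [F], by compactness first in [y] for fixed [x], then
    in [x]. *)
Lemma uniform_injectivity n (F : 'rV[R]_n -> 'rV[R]_n) (rho delta : R) :
  continuous F -> (forall x y, `|x| <= rho -> `|y| <= rho -> F x = F y -> x = y) ->
  0 < delta -> exists2 mu, 0 < mu &
    forall x y, `|x| <= rho -> `|y| <= rho -> `|F x - F y| < mu -> `|x - y| < delta.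
Proof.
move=> cF injF delta0.
pose Q (x : 'rV[R]_n) (d : R) (y : 'rV[R]_n) := delta / 2 <= `|x - y| -> d <= `|F x - F y|.
have cK := @compact_cube R n 0 rho.
have hQ x : `|x| <= rho -> exists2 d, 0 < d & forall y, `|y| <= rho -> Q x d y.
  move=> hx; have [|d d0 hd] := compact_uniform (P := Q x) cK; last first.
    by exists d => // y hy; apply: hd; rewrite /= subr0.
  move=> y /=; rewrite subr0 => hy; have [->|xy] := eqVneq y x.
    exists (delta / 2) => [|z e]; first by rewrite divr_gt0.
    by rewrite distrC => h1 _ h2; move: h1; rewrite ltNge h2.
  have F0 : 0 < `|F x - F y|.
    by rewrite normr_gt0 subr_eq0; apply: contraNneq xy => /(injF _ _ hx hy)->.
  have /contP/(_ (`|F x - F y| / 2)) := cF y.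
  rewrite divr_gt0 // => /(_ isT)[d d0 hd].
  exists (Num.min d (`|F x - F y| / 2)); first by rewrite lt_min d0 divr_gt0.
  move=> z e; rewrite lt_min => /andP[/hd h1 _] /andP[_]; rewrite le_min => /andP[_ h2] _.
  have := ler_distD (F z) (F x) (F y); move: h1 h2.
  by move: (`|F x - F y|) (`|F z - F y|) (`|F x - F z|) => A B C; lra.
pose P (d : R) (x : 'rV[R]_n) := forall y, `|y| <= rho -> delta <= `|x - y| -> d <= `|F x - F y|.
have [|mu mu0 hmu] := compact_uniform (P := P) cK; last first.
  exists mu => // x y hx hy; apply: contra_lt => h; apply: hmu => //.
  by rewrite /= subr0.
move=> x /=; rewrite subr0 => hx; have [d d0 hd] := hQ _ hx.
have /contP/(_ (d / 2)) := cF x; rewrite divr_gt0 // => /(_ isT)[d' d'0 hd'].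
exists (Num.min (Num.min d' (delta / 2)) (d / 2)); first by rewrite !lt_min d'0 !divr_gt0.
move=> z e; rewrite !lt_min => /andP[/andP[/hd' h1 h2] _] /andP[_]; rewrite !le_min => /andP[_ h3].
move=> y hy h4; have {hd} hd := hd y hy.
have h5 : d <= `|F x - F y|.
  apply: hd; have := ler_distD x z y; move: h2 h4.
  by move: (`|z - x|) (`|x - y|) (`|z - y|) => A B C; lra.
have := ler_distD (F z) (F x) (F y); rewrite (distrC (F x) (F z)); move: h1 h3 h5.
by move: (`|F x - F y|) (`|F z - F y|) (`|F z - F x|) => A B C; lra.
Qed.

(** McShane's extension formula applied to each coordinate of the inverse: an infimum of functions
    with the same Lipschitz constant. *)
Lemma lipschitz_left_inverse n (F : 'rV[R]_n -> 'rV[R]_n) (rho delta : R) :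
  continuous F -> (forall x y, `|x| <= rho -> `|y| <= rho -> F x = F y -> x = y) ->
  0 < rho -> 0 < delta -> exists P : 'rV[R]_n -> 'rV[R]_n, exists2 Lam, 0 <= Lam &
    (forall x y, `|P x - P y| <= Lam * `|x - y|) /\
    (forall x, `|x| <= rho -> `|P (F x) - x| <= delta).
Proof.
move=> cF injF rho0 delta0.
have [mu mu0 hmu] := uniform_injectivity cF injF delta0.
(* With this slope a competitor whose image is at distance at least [mu] pays [2 * rho], the largest
   possible difference of coordinates; the other competitors are within [delta] by the choice of
   [mu]. *)
pose Lam := 2 * rho / mu.
have Lam0 : 0 <= Lam by rewrite divr_ge0 // ?ltW // mulr_gt0.
pose S i (y : 'rV[R]_n) : set R :=
  [set t | exists2 x : 'rV[R]_n, `|x| <= rho & x 0 i + Lam * `|y - F x| = t].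
have S0 i y : S i y !=set0 by exists ((0 : 'rV[R]_n) 0 i + Lam * `|y - F 0|), 0; rewrite // normr0 ltW.
have coordle (x : 'rV[R]_n) i : `|x| <= rho -> - rho <= x 0 i <= rho.
  by rewrite -ler_norml; apply: le_trans; apply: rV_norm_coord.
have lbS i y : lbound (S i y) (- rho).
  move=> _ [x hx <-]; have /andP[h _] := coordle x i hx.
  by rewrite (le_trans h) // lerDl mulr_ge0.
pose P y := \row_i inf (S i y); exists P, Lam => //; split.
  have half x y i : inf (S i x) <= inf (S i y) + Lam * `|x - y|.
    rewrite -lerBlDr; apply: lb_le_inf => // _ [z hz <-].
    rewrite lerBlDr -addrA -mulrDr; apply: (@le_trans _ _ (z 0 i + Lam * `|x - F z|)).
      apply: ge_inf; first by exists (- rho); apply: lbS.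
      by exists z.
    by rewrite lerD2l ler_wpM2l // [leRHS]addrC; apply: ler_distD.
  move=> x y; apply: rV_norm_le => [|i]; first by rewrite mulr_ge0.
  rewrite !mxE; have := half x y i; have := half y x i; rewrite (distrC y x) ler_norml.
  by move: (inf _) (inf _) (Lam * _) => A B C; lra.
move=> x hx; apply: rV_norm_le => [|i]; first exact: ltW.
rewrite !mxE; have h1 : inf (S i (F x)) <= x 0 i.
  apply: ge_inf; first by exists (- rho); apply: lbS.
  by exists x; rewrite // subrr normr0 mulr0 addr0.
have h2 : x 0 i - delta <= inf (S i (F x)).
  apply: lb_le_inf => // _ [z hz <-].
  have [h|h] := ltP `|F x - F z| mu.
    have := le_lt_trans (rV_norm_coord _ i) (hmu _ _ hx hz h); rewrite !mxE ltr_norml => /andP[_ h'].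
    have : 0 <= Lam * `|F x - F z| by rewrite mulr_ge0.
    by move: (Lam * _) h' => A; lra.
  have : 2 * rho <= Lam * `|F x - F z|.
    rewrite /Lam mulrAC ler_pdivlMr //.
    by rewrite ler_wpM2l // mulr_ge0 // ltW.
  have := coordle x i hx; have := coordle z i hz; move: (Lam * _) => A; lra.
by rewrite ler_norml; lra.
Qed.

Lemma continuous_clamp (U : topologicalType) (f g h : U -> R) x :
  {for x, continuous f} -> {for x, continuous g} -> {for x, continuous h} ->
  {for x, continuous (fun y => Num.max (f y) (Num.min (g y) (h y)))}.
Proof.
move=> cf cg ch; apply: (@continuous_max R U f (g \min h)) => //.
exact: continuous_min.
Qed.

Lemma coord_cont n (x : 'rV[R]_n) i : {for x, continuous (fun y : 'rV[R]_n => y 0 i)}.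
Proof. exact: coord_continuous. Qed.

Lemma cst_cont (U : topologicalType) (V : normedModType R) (c : V) (x : U) :
  {for x, continuous (fun=> c)}.
Proof. exact: cvg_cst. Qed.

Lemma id_cont (U : topologicalType) (x : U) : {for x, continuous (fun y : U => y)}.
Proof. exact: cvg_id. Qed.

Lemma contD (U : topologicalType) (V : normedModType R) (f g : U -> V) x :
  {for x, continuous f} -> {for x, continuous g} ->
  {for x, continuous (fun y => f y + g y)}.
Proof. by move=> cf cg; exact: (cvgD cf cg). Qed.

Lemma contB (U : topologicalType) (V : normedModType R) (f g : U -> V) x :
  {for x, continuous f} -> {for x, continuous g} ->
  {for x, continuous (fun y => f y - g y)}.
Proof. by move=> cf cg; exact: (cvgB cf cg). Qed.

Lemma contZ (U : topologicalType) (V : normedModType R) (f : U -> R) (g : U -> V) x :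
  {for x, continuous f} -> {for x, continuous g} ->
  {for x, continuous (fun y => f y *: g y)}.
Proof. by move=> cf cg; exact: (cvgZ cf cg). Qed.

Lemma contM (U : topologicalType) (f g : U -> R) x :
  {for x, continuous f} -> {for x, continuous g} ->
  {for x, continuous (fun y => f y * g y)}.
Proof. by move=> cf cg; exact: (cvgM cf cg). Qed.

(** The retraction onto the cube; composing with it makes a map continuous on the cube continuous
    everywhere. *)
Definition clampv n (rho : R) (x : 'rV[R]_n) : 'rV[R]_n :=
  \row_i Num.max (- rho) (Num.min rho (x 0 i)).

Lemma clampv_le n (rho : R) (x : 'rV[R]_n) : 0 <= rho -> `|clampv rho x| <= rho.
Proof.
move=> rho0; apply: rV_norm_le => // i.
by rewrite mxE ler_norml le_max lexx /= ge_max ge_min lexx; rewrite andbT; lra.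
Qed.

Lemma clampv_id n (rho : R) (x : 'rV[R]_n) : `|x| <= rho -> clampv rho x = x.
Proof.
move=> hx; apply/rowP => i; rewrite mxE.
have := le_trans (rV_norm_coord x i) hx; rewrite ler_norml => /andP[h1 h2].
by rewrite (min_idPr h2) (max_idPr h1).
Qed.

Lemma clampv_cont n (rho : R) (x : 'rV[R]_n) : {for x, continuous (clampv rho)}.
Proof.
apply/rV_contP => i.
rewrite (_ : (fun y => _) = fun y : 'rV[R]_n => Num.max (- rho) (Num.min rho (y 0 i)));
  last by apply/funext => y; rewrite mxE.
by apply: continuous_clamp; [apply: cst_cont..|apply: coord_cont].
Qed.

Theorem invariance_of_domain n (F : 'rV[R]_n -> 'rV[R]_n) (rho : R) :
  0 < rho -> continuous F ->
  (forall x y, `|x| <= rho -> `|y| <= rho -> F x = F y -> x = y) ->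
  exists2 eta, 0 < eta & forall y, `|y - F 0| < eta -> exists2 x, `|x| <= rho & F x = y.
Proof.
case: n F => [|n] F rho0 cF injF.
  exists 1 => // y _; exists 0; first by rewrite normr0 ltW.
  by apply/rowP => -[].
apply: contrapT => notint.
have {}notint eta : 0 < eta -> exists2 y, `|y - F 0| < eta &
    forall x, `|x| <= rho -> F x != y.
  move=> eta0; apply: contrapT => h; apply: notint; exists eta => // y hy.
  apply: contrapT => h'; apply: h; exists y => // x hx; apply/eqP => e.
  by apply: h'; exists x.
have rho4 : 0 < rho / 4 by lra.
have [mu mu0 hmu] := uniform_injectivity cF injF rho4.
(* Half of [mu]: if [F x] and [F 0] are both within [eps] of [c], then [x] is within [rho / 4] of
   [0]. *)
pose eps := mu / 2; have eps0 : 0 < eps by rewrite /eps; lra.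
have [c cF0 cNF] := notint _ eps0.
have [d0 d00 hd0] : exists2 d, 0 < d & forall y, `|y| < d -> `|F y - c| < eps.
  have /contP/(_ (eps - `|c - F 0|)) := cF 0; rewrite subr_gt0 => /(_ cF0)[d dp hd].
  exists d => // y yd; have := hd y; rewrite subr0 => /(_ yd).
  have := ler_distD (F 0) (F y) c; rewrite (distrC (F 0)).
  by move: (`|F y - c|) (`|F y - F 0|) (`|c - F 0|) => A B C; lra.
(* [P] and the shift by [a] each cost [delta], and [2 * delta] has to be below both [d0] and
   [rho]. *)
pose delta := Num.min d0 rho / 4.
have delta_0 : 0 < delta by rewrite divr_gt0 // lt_min d00.
have delta_d0 : delta <= d0 / 4 by rewrite ler_pM2r ?invr_gt0 // ge_min lexx.
have delta_rho : delta <= rho / 4 by rewrite ler_pM2r ?invr_gt0 // ge_min lexx orbT.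
have [P [Lam Lam0 [lipP hP]]] := lipschitz_left_inverse cF injF rho0 delta_0.
have [a ad hPa] := lipschitz_sphere_misses c eps0 delta_0 Lam0 lipP.
pose cl := @clampv n.+1 rho.
have cl_le x : `|cl x| <= rho by apply: clampv_le; exact: ltW.
have cl_id x : `|x| <= rho -> cl x = x by exact: clampv_id.
have F1c x : F (cl x) != c by apply: cNF.
(* The radial push out of the cube of radius [eps] about [c]: the identity outside, a projection
   onto the boundary inside, continuous away from [c], which the image misses. *)
pose Phi (y : 'rV[R]_n.+1) := c + Num.max (eps / `|y - c|) 1 *: (y - c).
pose q (x : 'rV[R]_n.+1) := P (Phi (F (cl x))) - a.
(* Clamping [q x] to within [rho] of [x] forces the boundary signs required by
   [poincare_miranda]. *)
pose H (x : 'rV[R]_n.+1) : 'rV[R]_n.+1 := \row_i Num.max (x 0 i - rho) (Num.min (x 0 i + rho) (q x 0 i)).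
have cont_Phi y : y != c -> {for y, continuous Phi}.
  move=> yc; have yc0 : `|y - c| != 0 by rewrite normr_eq0 subr_eq0.
  have cB : {for y, continuous (fun z : 'rV[R]_n.+1 => z - c)}.
    by apply: contB; [exact: id_cont|exact: cst_cont].
  apply: contD; first exact: cst_cont.
  apply: contZ => //.
  apply: (@continuous_max R 'rV[R]_n.+1 (fun z => eps / `|z - c|) (fun=> 1)); last exact: cst_cont.
  apply: contM; first exact: cst_cont.
  exact: (@cvgV _ _ _ _ (fun z => `|z - c|) _ yc0 (cvg_norm cB)).
have cont_P y : {for y, continuous P}.
  apply/contP => e e0; exists (e / (Lam + 1)); first by rewrite divr_gt0 // ltr_pwDr.
  move=> z; rewrite ltr_pdivlMr ?ltr_pwDr // => h; rewrite (le_lt_trans (lipP _ _)) //.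
  by rewrite (le_lt_trans _ h) // mulrC ler_wpM2l // lerDl.
have cont_q x : {for x, continuous q}.
  apply: contB; last exact: cst_cont.
  apply: (@continuous_comp _ _ _ (fun x => Phi (F (cl x))) P); last exact: cont_P.
  apply: (@continuous_comp _ _ _ (fun x => F (cl x)) Phi); last exact: cont_Phi.
  by apply: (@continuous_comp _ _ _ cl F); [exact: clampv_cont|exact: cF].
have cont_H : continuous H.
  move=> x; apply/rV_contP => i.
  rewrite (_ : (fun y => _) = fun y : 'rV[R]_n.+1 =>
    Num.max (y 0 i - rho) (Num.min (y 0 i + rho) (q y 0 i)));
    last by apply/funext => y; rewrite mxE.
  apply: continuous_clamp.
  - by apply: contB; [exact: coord_cont|exact: cst_cont].
  - by apply: contD; [exact: coord_cont|exact: cst_cont].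
  - exact: ((rV_contP _ _).1 (cont_q x)).
have [||x xrho Hx] := poincare_miranda rho0 cont_H.
- move=> x i _ xi; rewrite mxE xi addNr ge_max; apply/andP; split; first lra.
  by rewrite ge_min lexx.
- by move=> x i _ xi; rewrite mxE xi subrr le_max lexx.
have Hxi i : Num.max (x 0 i - rho) (Num.min (x 0 i + rho) (q x 0 i)) = 0.
  by have /rowP/(_ i) := Hx; rewrite !mxE.
(* In the far case [Phi] does nothing, so [q x] is within [2 * delta] of [x] and the clamp is
   inactive. Hence [q x = 0] and [x] is closer to [0] than [d0], which brings [F x] within [eps] of
   [c]. *)
have [far|near] := leP eps `|F x - c|.
  have PhiE : Phi (F (cl x)) = F x.
    have h : eps / `|F x - c| <= 1.
      by rewrite ler_pdivrMr; [rewrite mul1r|exact: lt_le_trans eps0 far].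
    by rewrite cl_id // /Phi (max_idPr h) scale1r addrC subrK.
  have qx : `|q x - x| <= 2 * delta.
    rewrite /q PhiE addrAC (le_trans (ler_normB _ _)) // mulrDl mul1r lerD //.
    exact: hP.
  have x0 i : `|x 0 i| <= 2 * delta.
    have := Hxi i; have := qx; move: (q x) => Q hQ e.
    have := le_trans (rV_norm_coord _ i) hQ; rewrite !mxE ler_norml => /andP[h1 h2].
    move: e; rewrite (min_idPr _); last by lra.
    rewrite (max_idPr _); last by lra.
    by move=> t0; rewrite ler_norml; lra.
  have : `|x| < d0.
    by apply: (@le_lt_trans _ _ (2 * delta)); [apply: rV_norm_le => //; lra|lra].
  by move=> /hd0; rewrite ltNge far.
(* In the near case [x] is too small for the clamp to produce a zero, so [q x = 0]; but [Phi (F x)]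
   is on the sphere where [P] misses [a]. *)
have x4 : `|x| < rho / 4.
  have := hmu x 0 xrho; rewrite normr0 subr0; apply; first exact: ltW.
  have := ler_distD c (F x) (F 0); move: near cF0; rewrite /eps.
  by move: (`|F x - F 0|) (`|F x - c|) (`|c - F 0|) => A B C; lra.
have Fxc : 0 < `|F x - c| by rewrite normr_gt0 subr_eq0; apply: cNF.
have : P (Phi (F x)) != a.
  apply: hPa; rewrite /Phi addrC addKr (max_idPl _).
    by rewrite normrZ ger0_norm ?divr_ge0 // ?ltW // divfK ?gt_eqF.
  by rewrite ler_pdivlMr // mul1r ltW.
move=> /eqP; apply; apply/eqP; rewrite -subr_eq0; apply/eqP/rowP => i.
have := Hxi i; rewrite /q cl_id //; move: (_ - a) => t.
have -> : (0 : 'rV[R]_n.+1) 0 i = 0 by rewrite mxE.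
have := le_lt_trans (rV_norm_coord x i) x4; rewrite ltr_norml => /andP[h1 h2].
rewrite maxEle; case: ifP => _; last by lra.
by rewrite minEle; case: ifP => _; lra.
Qed.

End DomainInvariance.

(** * Cubes inside images *)

Section ImageCubes.
Context {R : realType}.

Lemma convex_comb_le_max (t a b : R) : 0 <= t <= 1 -> t * a + (1 - t) * b <= Num.max a b.
Proof.
move=> /andP[t0 t1]; have [ab|ab] := leP a b; nra.
Qed.

Lemma poincare_miranda_image m (rho : R) (H : 'rV[R]_m -> 'rV[R]_m) (z : 'rV[R]_m) :
  0 < rho -> continuous H ->
  (forall (x : 'rV[R]_m) i, `|x| <= rho -> x 0 i = - rho -> H x 0 i <= z 0 i) ->
  (forall (x : 'rV[R]_m) i, `|x| <= rho -> x 0 i = rho -> z 0 i <= H x 0 i) ->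
  exists2 x, `|x| <= rho & H x = z.
Proof.
move=> rho0 cH Hl Hr.
have [|||x hx /eqP] := @poincare_miranda R m rho (fun x => H x - z) rho0.
- by move=> x; apply: contB; [exact: cH|exact: cst_cont].
- by move=> x i hx xi; rewrite !mxE subr_le0; apply: Hl.
- by move=> x i hx xi; rewrite !mxE subr_ge0; apply: Hr.
by rewrite subr_eq0 => /eqP ?; exists x.
Qed.

(* [F] maps the open cube onto the component of [F 0] in the complement of the
   image of its boundary, so it covers a cube around [q] missing that image. *)
Lemma injective_image_cube n (F : 'rV[R]_n -> 'rV[R]_n) (rho t : R) (q z : 'rV[R]_n) :
  0 < rho -> continuous F ->
  (forall x y, `|x| <= rho -> `|y| <= rho -> F x = F y -> x = y) ->
  (forall x, `|x| = rho -> t <= `|F x - q|) ->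
  `|F 0 - q| < t -> `|z - q| < t -> exists2 x, `|x| <= rho & F x = z.
Proof.
move=> rho0 cF injF bd F0 zq.
pose O := F @` [set x | `|x - 0| <= rho].
have clO : closed O.
  apply: compact_closed; first exact: norm_hausdorff.
  apply: continuous_compact; last exact: compact_cube.
  by apply: continuous_subspaceT.
(* The segment from [F 0] to [z] stays closer than [t] to [q], hence off the image of the boundary.
   Its points in the image form a closed set, which is open by invariance of domain. *)
pose g (tau : R) := F 0 + tau *: (z - F 0).
have cg : continuous g.
  move=> tau; apply: (@contD R R 'rV[R]_n (fun=> F 0) (fun tau => tau *: (z - F 0))).
    exact: cst_cont.
  by apply: (@contZ R R 'rV[R]_n id (fun=> z - F 0)); [exact: id_cont|exact: cst_cont].
have gq tau : 0 <= tau <= 1 -> `|g tau - q| < t.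
  move=> /andP[h0 h1].
  have -> : g tau - q = (1 - tau) *: (F 0 - q) + tau *: (z - q).
    by apply/rowP => i; rewrite !mxE; ring.
  rewrite (le_lt_trans (ler_normD _ _)) // !normrZ !ger0_norm ?subr_ge0 //.
  move: (`|F 0 - q|) (`|z - q|) F0 zq => A B At Bt.
  apply: (@le_lt_trans _ _ (Num.max A B)); last by rewrite gt_max At.
  have := @convex_comb_le_max (1 - tau) A B; rewrite subKr; apply.
  by apply/andP; split; lra.
have openO tau : 0 <= tau <= 1 -> O (g tau) -> O° (g tau).
  move=> h [x /=]; rewrite subr0 => hx Fx.
  have {}hx : `|x| < rho.
    rewrite lt_neqAle hx andbT; apply/eqP => /bd; rewrite Fx.
    by rewrite leNgt gq.
  have [|||eta eta0 heta] := @invariance_of_domain R n (fun u => F (x + u)) (rho - `|x|).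
  - by rewrite subr_gt0.
  - move=> u; apply: (@continuous_comp _ _ _ (fun u => x + u) F); last exact: cF.
    by apply: contD; [exact: cst_cont|exact: id_cont].
  - have tr v : `|v| <= rho - `|x| -> `|x + v| <= rho.
      by rewrite lerBrDl; apply: le_trans; apply: ler_normD.
    by move=> u v /tr hu /tr hv /(injF _ _ hu hv) /addrI.
  apply/nbhs_ballP; exists eta => // y.
  rewrite -ball_normE /ball_ /= -Fx distrC -{1}[x]addr0 => /heta[u hu <-].
  exists (x + u) => //=; rewrite subr0 (le_trans (ler_normD _ _)) //.
  by rewrite -lerBrDl.
have Oseg : `[0, 1] `&` g @^-1` O = `[0, 1].
  apply: segment_connected.
  - exists 0; split; first by rewrite /= in_itv /= lexx ler01.
    by exists 0; rewrite /g /= ?subr0 ?normr0 ?ltW // scale0r addr0.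
  - exists (g @^-1` O°).
      by apply: open_comp; [move=> tau _; exact: cg|exact: open_interior].
    apply/seteqP; split=> tau [h1 h2]; split=> //; last exact: interior_subset h2.
    by apply: openO => //; move: h1; rewrite /= in_itv.
  - exists (g @^-1` O) => //.
    by apply: preimage_closed => // tau _; exact: cg.
have : (`[0, 1] `&` g @^-1` O) 1 by rewrite Oseg /= in_itv /= lexx ler01.
case=> _ [x /=]; rewrite subr0 => hx Fx; exists x => //.
by rewrite Fx /g scale1r addrC subrK.
Qed.

(** The coordinates are adjusted one at a time: two points on either side of [z] in coordinate [k],
    and agreeing with [z] in the earlier ones, have a convex combination that also matches
    coordinate [k]. The later sign conditions survive. *)
Lemma convex_signs m (C : set 'rV[R]_m) (z : 'rV[R]_m) : convex_in C ->
  (forall sg : 'I_m -> bool, exists2 y, C y &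
     forall i, if sg i then z 0 i <= y 0 i else y 0 i <= z 0 i) -> C z.
Proof.
move=> cvC h.
have fixed k : (k <= m)%N -> forall sg : 'I_m -> bool, exists2 y, C y & forall i : 'I_m,
    if (i < k)%N then y 0 i == z 0 i else if sg i then z 0 i <= y 0 i else y 0 i <= z 0 i.
  elim: k => [|k IH] km sg; first by have [y ? ?] := h sg; exists y.
  pose ik := Ordinal km.
  have [y1 C1 h1] := IH (ltnW km) (fun i => if i == ik then true else sg i).
  have [y2 C2 h2] := IH (ltnW km) (fun i => if i == ik then false else sg i).
  have := h1 ik; have := h2 ik; rewrite /= ltnn eqxx => le2 le1.
  have [t [t01 ht]] : exists t : R, 0 <= t <= 1 /\
      t * y1 0 ik + (1 - t) * y2 0 ik = z 0 ik.
    have [e|ne] := eqVneq (y1 0 ik) (y2 0 ik).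
      by exists 0; split; [lra|rewrite mul0r add0r subr0 mul1r; lra].
    have lt21 : y2 0 ik < y1 0 ik by rewrite lt_neqAle eq_sym ne (le_trans le2).
    have d0 : 0 < y1 0 ik - y2 0 ik by rewrite subr_gt0.
    exists ((z 0 ik - y2 0 ik) / (y1 0 ik - y2 0 ik)); split.
      apply/andP; split; first by rewrite divr_ge0 ?subr_ge0 // ltW.
      by rewrite ler_pdivrMr // mul1r; lra.
    by field; lra.
  exists (t *: y1 + (1 - t) *: y2); first exact: cvC.
  move=> i; have := h1 i; have := h2 i; rewrite !mxE [(i < k.+1)%N]ltnS [(i <= k)%N]leq_eqVlt.
  have [->|ne] := eqVneq i ik; first by rewrite /= eqxx ht eqxx.
  have -> : (i == k :> nat) = false by apply: contraNF ne => /eqP e; apply/eqP/val_inj.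
  rewrite /=; case: ifP => [_ /eqP-> /eqP->|_]; first by apply/eqP; ring.
  by case: (sg i) => a b; nra.
have [y Cy hy] := fixed m (leqnn m) (fun=> true).
suff <- : y = z by [].
by apply/rowP => i; have := hy i; rewrite ltn_ord => /eqP.
Qed.

End ImageCubes.

(** * Finite prefixes of names *)

Lemma cmpQ_comp {R : realType} (F : nat -> R) G : cmpQ F -> cmp G -> cmpQ (fun z => F (G z)).
Proof.
move=> [a [b [d [ha hb hd e]]]] hG.
by exists (fun z => a (G z)), (fun z => b (G z)), (fun z => d (G z)); split=> //; apply: (cmp_comp (G := G)).
Qed.

Section Atoms.
Context {R : realType}.

Lemma expr2V_gt0 k : 0 < (2 ^+ k)^-1 :> R.
Proof. by rewrite invr_gt0 exprn_gt0. Qed.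

Lemma tol_half a n : (2 ^+ a)^-1 / n.+1%:R / 2 <= (2 ^+ a)^-1 / n.+1%:R :> R.
Proof.
have : 0 <= (2 ^+ a)^-1 / n.+1%:R :> R by rewrite divr_ge0 // ltW // expr2V_gt0.
by move: (_ / n.+1%:R) => A; lra.
Qed.

Lemma le_expr2V j k : (j <= k)%N -> (2 ^+ k)^-1 <= (2 ^+ j)^-1 :> R.
Proof. by move=> jk; rewrite lef_pV2 ?posrE ?exprn_gt0 // ler_weXn2l // ler1n. Qed.

Lemma expr2V_small (e : R) : 0 < e -> exists j, (2 ^+ j)^-1 < e.
Proof.
move=> e0; exists (Num.truncn e^-1); rewrite invf_plt ?posrE ?exprn_gt0 //.
rewrite (lt_le_trans (truncnS_gt _)) // -natrX ler_nat.
exact: ltn_expl.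
Qed.

(** The factor [n.+1] turns coordinate bounds into the Euclidean bound, since [n <= n.+1 ^ 2]. *)
Lemma rho_of_coord n p (x : 'rV[R]_n) :
  (forall a (j : 'I_n), `|qR (p (cpair a (cpair 0 j))) - x 0 j| <= (2 ^+ a)^-1 / n.+1%:R) ->
  rho p x.
Proof.
move=> h a; rewrite big_ord1.
set B := (2 ^+ a)^-1 / n.+1%:R : R.
have B0 : 0 <= B by rewrite divr_ge0 // ltW // expr2V_gt0.
apply: (@le_trans _ _ (\sum_(j < n) B ^+ 2)).
  apply: ler_sum => j _; rewrite -(@real_normK _ (_ - _)) ?num_real //.
  by rewrite lerXn2r ?nnegrE //; apply: h.
rewrite sumr_const card_ord -[_ *+ n]mulr_natl /B expr_div_n mulrCA -[leRHS]mulr1.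
rewrite ler_wpM2l //.
rewrite ler_pdivrMr ?exprn_gt0 // mul1r -natrX ler_nat; nia.
Qed.

Lemma rho_coord m q (y : 'rV[R]_m) j (i : 'I_m) : rho q y ->
  `|qR (q (cpair j (cpair 0 i))) - y 0 i| <= (2 ^+ j)^-1.
Proof.
move=> /(_ j); rewrite big_ord1 => h.
set A := qR _; have : `|A - y 0 i| ^+ 2 <= ((2 ^+ j)^-1) ^+ 2.
  rewrite real_normK ?num_real // (le_trans _ h) // (bigD1 i) //= lerDl sumr_ge0 // => k _.
  exact: sqr_ge0.
by rewrite ler_pXn2r // nnegrE ltW // expr2V_gt0.
Qed.

(** Only half of the tolerance of [rho_of_coord] is spent, which leaves room to move the point. *)
Lemma good_name n (x : 'rV[R]_n) : exists p : nat -> nat, forall a (j : 'I_n),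
  `|qR (p (cpair a (cpair 0 j))) - x 0 j| <= (2 ^+ a)^-1 / n.+1%:R / 2.
Proof.
have /choice[p hp] : forall k, exists v, forall j : 'I_n, (cunpair (cunpair k).2).2 = j ->
    `|qR v - x 0 j| <= (2 ^+ (cunpair k).1)^-1 / n.+1%:R / 2.
  move=> k; case: (ltnP (cunpair (cunpair k).2).2 n) => h; last first.
    by exists 0%N => j e; have := ltn_ord j; rewrite -e ltnNge h.
  have [|v hv] := @qR_dense R (x 0 (Ordinal h)) ((2 ^+ (cunpair k).1)^-1 / n.+1%:R / 2).
    by rewrite !divr_gt0 // expr2V_gt0.
  exists v => j e; have -> : j = Ordinal h by apply: val_inj.
  exact: ltW.
exists p => a j; have := hp (cpair a (cpair 0 j)) j; rewrite !cunpairK /=; exact.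
Qed.

(* The first [L] entries of the word [w] can be continued to a name of every
   point of the cube of centre [g] and radius [h]. *)
Definition cellok n (w L : nat) (g : 'rV[R]_n) (h : R) : bool :=
  allb L (fun k => ((cunpair (cunpair k).2).1 == 0%N) ==>
    [forall i : 'I_n, ((cunpair (cunpair k).2).2 == i) ==>
      (`|qR (nthc w k) - g 0 i| + h <= (2 ^+ (cunpair k).1)^-1 * n.+1%:R^-1)]).

Lemma cmp_cellok n W L (g : nat -> 'rV[R]_n) (h : nat -> R) : cmp W -> cmp L ->
  (forall i, cmpQ (fun z => g z 0 i)) -> cmpQ h ->
  cmpb (fun z => cellok (W z) (L z) (g z) (h z)).
Proof.
move=> hW hL hg hh; apply: (cmp_allb (P := fun z k => _)) => //=; cmpQ_solve.
- by apply: (cmpQ_comp (hg _)); cmp_solve.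
- by apply: (cmpQ_comp hh); cmp_solve.
Qed.

(** From position [L] on the name continues as a good name of [x]. *)
Lemma cellok_name n w L (g : 'rV[R]_n) h x : cellok w L g h -> `|x - g| <= h ->
  exists2 p, rho p x & forall k, (k < L)%N -> nthc w k = p k.
Proof.
move=> /allbP ok xg; have [p0 hp0] := good_name x.
exists (fun k => if (k < L)%N then nthc w k else p0 k); last by move=> k ->.
apply: rho_of_coord => a j; case: ifP => kL; last first.
  exact: le_trans (hp0 a j) (tol_half a n).
have := ok _ kL; rewrite !cunpairK /= => /forallP/(_ j); rewrite eqxx /=.
apply: le_trans; rewrite -(subrKA (g 0 j)) (le_trans (ler_normD _ _)) // lerD2l.
by have := le_trans (rV_norm_coord _ j) xg; rewrite !mxE distrC.
Qed.

(** One notion for functions and multi-valued functions: [Q] is [rho q (f x)] or [h x (q 0)]. *)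
Definition answers n (E : nat -> nat) (x : 'rV[R]_n) (Q : (nat -> nat) -> Prop) :=
  forall p, rho p x -> exists q, (forall o, exists L, runm E p L o = (q o).+1) /\ Q q.

(** Take a prefix of a good name of [x] that answers all of [os]. All precisions in it are at most
    [L], so the unspent half of the tolerance at precision [L] serves as [d]. *)
Lemma prefix_complete n E (x : 'rV[R]_n) Q (os : seq nat) : answers E x Q ->
  exists w L, exists2 d, 0 < d & (forall o, o \in os -> runm E (nthc w) L o != 0%N) /\
    forall g h, `|x - g| + h <= d -> cellok w L g h.
Proof.
move=> hE; have [p hp] := good_name x.
have [q [hq _]] : exists q, (forall o, exists L, runm E p L o = (q o).+1) /\ Q q.
  apply: hE; apply: rho_of_coord => a j; exact: le_trans (hp a j) (tol_half a n).
have [L hL] : exists L, forall o, o \in os -> runm E p L o != 0%N.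
  elim: os => [|o os [L IH]]; first by exists 0%N.
  have [L' hL'] := hq o; exists (maxn L L') => u; rewrite inE => /predU1P[->|/IH].
    by rewrite (runm_mono hL') ?leq_maxr.
  case e : (runm E p L u) => [|y] // _.
  by rewrite (runm_mono e) ?leq_maxl.
exists (lcode (mkseq p L)), L, ((2 ^+ L)^-1 / n.+1%:R / 2).
  by rewrite !divr_gt0 // expr2V_gt0.
split=> [u /hL|g h gh].
  by rewrite (@eq_runm E p (nthc (lcode (mkseq p L)))) // => i iL; rewrite nthc_mkseq.
apply/allbP => k kL; apply/implyP => /eqP k0; apply/forallP => i; apply/implyP => /eqP ki.
rewrite nthc_mkseq //.
have ek : k = cpair (cunpair k).1 (cpair 0 i) by rewrite -{1}(cpairK k) -(cpairK (cunpair k).2) k0 ki.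
move: ek kL {k0 ki}; move: (cunpair k).1 => a -> kL.
have aL : (a <= L)%N by apply: leq_trans (ltnW kL); apply: cpair_ge1.
have gi : `|x 0 i - g 0 i| <= `|x - g| by have := rV_norm_coord (x - g) i; rewrite !mxE.
have := hp a i.
have : (2 ^+ L)^-1 / n.+1%:R / 2 <= (2 ^+ a)^-1 / n.+1%:R / 2 :> R.
  by rewrite ler_pM2r ?invr_gt0 // ler_pM2r ?invr_gt0 // le_expr2V.
have := ler_distD (x 0 i) (qR (p (cpair a (cpair 0 i)))) (g 0 i).
move: gi gh; move: (`|_ - g 0 i|) (`|_ - g 0 i|) (`|_ - x 0 i|) (`|x - g|) (_^-1 / _ / 2) => A B C D F.
move: (_ / n.+1%:R) => G; lra.
Qed.

Variables (n m : nat) (X : set 'rV[R]_n) (f : 'rV[R]_n -> 'rV[R]_m) (E : nat -> nat).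
Hypothesis hE : forall x, X x -> answers E x (fun q => rho q (f x)).

Definition atomok (w L j : nat) (g : 'rV[R]_n) (h : R) : bool :=
  cellok w L g h && [forall i : 'I_m, runm E (nthc w) L (cpair j (cpair 0 i)) != 0%N].

Definition atomval (w L j : nat) : 'rV[R]_m :=
  \row_i qR (runm E (nthc w) L (cpair j (cpair 0 i))).-1.

(** The answers on the prefix are also the answers on a name of [x] extending it. *)
Lemma atom_sound w L j g h x : atomok w L j g h -> X x -> `|x - g| <= h ->
  `|f x - atomval w L j| <= (2 ^+ j)^-1.
Proof.
move=> /andP[ok /forallP out] Xx xg; have [p px wp] := cellok_name ok xg.
have [q [hq qfx]] := hE Xx px.
apply: rV_norm_le => [|i]; first by rewrite ltW // expr2V_gt0.
rewrite !mxE distrC; have := rho_coord j i qfx; have := out i.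
rewrite (eq_runm E _ wp); set o := cpair j _.
have [L' hL'] := hq o.
case e : (runm E p L o) => [|y] // _ /=.
have -> // : y = q o.
have := runm_mono e (leq_maxl L L'); have := runm_mono hL' (leq_maxr L L').
by move=> -> [].
Qed.

Lemma atom_complete x j : X x -> exists w L, exists2 d, 0 < d &
  forall g h, `|x - g| + h <= d -> atomok w L j g h.
Proof.
move=> /hE /(prefix_complete [seq cpair j (cpair 0 (val i)) | i <- enum 'I_m])
  [w [L [d d0 [out ok]]]].
exists w, L, d => // g h gh; rewrite /atomok ok //=; apply/forallP => i.
by apply: out; apply/mapP; exists i; rewrite ?mem_enum.
Qed.

(** One answer of precision [2^-j] is valid on a whole cube around [x]. *)
Lemma computes_continuous x : open X -> X x -> {for x, continuous f}.
Proof.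
move=> oX Xx; apply/contP => e e0.
have [|j hj] := @expr2V_small (e / 2); first by rewrite divr_gt0.
have [w [L [d d0 ok]]] := atom_complete j Xx.
have /nbhs_ballP[d' d'0 hd'] : nbhs x X by apply: open_nbhs_nbhs.
exists (Num.min d d') => [|y]; first by rewrite lt_min d0.
rewrite lt_min => /andP[yd yd'].
have {}ok : atomok w L j x d by apply: ok; rewrite subrr normr0 add0r.
have Xy : X y by apply: hd'; rewrite -ball_normE /ball_ /= distrC.
have := atom_sound ok Xx; rewrite subrr normr0 => /(_ (ltW d0)).
have := atom_sound ok Xy (ltW yd); have := ler_distD (atomval w L j) (f y) (f x).
rewrite (distrC (atomval _ _ _)).
move: (`|f y - f x|) (`|f y - _|) (`|f x - _|) hj => A B C; lra.
Qed.

End Atoms.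

Lemma cmp_atomok {R : realType} n m E W L J (g : nat -> 'rV[R]_n) (h : nat -> R) :
  cmp E -> cmp W -> cmp L -> cmp J ->
  (forall i, cmpQ (fun z => g z 0 i)) -> cmpQ h ->
  cmpb (fun z => atomok m E (W z) (L z) (J z) (g z) (h z)).
Proof.
move=> hE hW hL hJ hg hh; apply: cmp_and; first exact: cmp_cellok.
cmpQ_solve.
Qed.

Lemma cmp_atomval {R : realType} m E W L J (i : 'I_m) :
  cmp E -> cmp W -> cmp L -> cmp J ->
  cmpQ (fun z => @atomval R m E (W z) (L z) (J z) 0 i).
Proof.
move=> hE hW hL hJ.
apply: (@cmpQ_ext _ _ (fun z => qR (runm E (nthc (W z)) (L z) (cpair (J z) (cpair 0 i))).-1)).
  by move=> z; rewrite mxE.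
by cmpQ_solve.
Qed.

Lemma computable_fun_answers {R : realType} n m (X : set 'rV[R]_n) (f : 'rV[R]_n -> 'rV[R]_m) :
  computable_fun X f -> exists2 E, cmp E &
    forall x, X x -> answers E x (fun q => rho q (f x)).
Proof.
move=> [e [/cmp_of_total[E hE eE] h]]; exists E => // x Xx p px.
by have [q [/(runs_fun _ _ eE) hq qf]] := h x p Xx px; exists q.
Qed.

Lemma computable_mv_answers {R : realType} n (X : set 'rV[R]_n) (h : 'rV[R]_n -> set nat) :
  computable_mv X h -> exists2 E, cmp E &
    forall x, X x -> answers E x (fun q => h x (q 0%N)).
Proof.
move=> [e [/cmp_of_total[E hE eE] he]]; exists E => // x Xx p px.
by have [q [/(runs_fun _ _ eE) hq qf]] := he x p Xx px; exists q.
Qed.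

(** * A criterion for effective openness *)

Section Criterion.
Context {R : realType}.

Definition qv m (q : 'I_m -> nat) : 'rV[R]_m := \row_i qR (q i).

Variables (n m : nat) (X : set 'rV[R]_n) (f : 'rV[R]_n -> 'rV[R]_m).
Variables (G : nat -> bool) (c : nat -> 'rV[R]_n) (r : nat -> R)
  (q : nat -> 'I_m -> nat) (t : nat -> nat).
Hypotheses (cG : cmpb G) (cc : forall i, cmpQ (fun z => c z 0 i)) (cr : cmpQ r)
  (cq : forall i, cmp (fun z => q z i)) (ct : cmp t).

(** A sufficient test that the ball of certificate [z] lies in the [k]-th input ball: each
    coordinate of the distance between centres is enlarged by [r z]. *)
Definition inball (p : nat -> nat) (k z : nat) : bool :=
  [&& G z, 0 < r z, p (cpair k 0) != 0%N, 0 < (qR (p (cpair k 0)).-1 : R) &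
    \sum_i (`|c z 0 i - qR (p (cpair k i.+1))| + r z) ^+ 2 < qR (p (cpair k 0)).-1 ^+ 2].

(** Output ball [cpair k z] is the target ball of [z], or empty if the test fails. Position 0 holds
    the radius code plus one, and the sum selects the coordinate at the other positions. *)
Definition outval (p : nat -> nat) (o : nat) : nat :=
  let K := (cunpair o).1 in let z := (cunpair K).2 in
  if (cunpair o).2 == 0%N then
    (if inball p (cunpair K).1 z then (t z).+1 else 0%N)
  else (\sum_(i < m) ((cunpair o).2 == i.+1) * q z i)%N.

(** The answer 0 means that the prefix does not yet reach position [cpair k n], the largest one
    consulted. *)
Definition outcode (x : nat) : nat :=
  if iter (cpair (cunpair (cunpair (cunpair x).2).1).1 n) tlc (cunpair x).1 == 0%N then 0%N
  else (outval (nthc (cunpair x).1) (cunpair x).2).+1.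

Lemma cmp_outcode : cmp outcode.
Proof.
have hG := cG; have hr := cr; have ht := ct.
apply: cmp_if; last apply: cmp_S.
- apply: cmp_eq; last exact: cmp_const.
  by apply: cmp_iter; rewrite /tlc; cmp_solve.
- exact: cmp_const.
have cK : cmp (fun x => (cunpair (cunpair x).2).1) by cmp_solve.
have cZ : cmp (fun x => (cunpair (cunpair (cunpair x).2).1).2) by cmp_solve.
apply: cmp_if; first by cmp_solve.
- apply: cmp_if; [rewrite /inball; cmpQ_solve|by cmp_solve..].
  + exact: (cmp_comp hG cZ).
  + exact: (cmpQ_comp hr cZ).
  + exact: (cmpQ_comp (cc _) cZ).
  + exact: (cmpQ_comp hr cZ).
- cmpQ_solve; exact: (cmp_comp (cq _) cZ).
Qed.

Lemma eq_outval p p' o :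
  (forall i, (i <= cpair (cunpair (cunpair o).1).1 n)%N -> p i = p' i) ->
  outval p o = outval p' o.
Proof.
move=> h; rewrite /outval /inball !(h (cpair _ 0)) ?leq_cpair //.
set S := \sum_(i < n) _; set S' := \sum_(i < n) _.
have -> // : S = S' :> R.
by apply: eq_bigr => i _; rewrite h // leq_cpair.
Qed.

Hypothesis sound : forall z, G z -> 0 < r z -> eball (c z) (r z) `<=` X ->
  eball (qv (q z)) (qR (t z)) `<=` f @` eball (c z) (r z).
Hypothesis complete : forall x e, 0 < e -> (forall y, `|y - x| <= e -> X y) ->
  exists z, [/\ G z, 0 < r z <= e, `|c z - x| <= e & eball (qv (q z)) (qR (t z)) (f x)].

Lemma ball_ofE d (p : nat -> nat) k y : @ball_of R d p k y <->
  exists2 s, p (cpair k 0) = s.+1 & eball (\row_i qR (p (cpair k i.+1))) (qR s) y.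
Proof.
rewrite /ball_of; case: (p _) => [|s]; split=> //; first by case.
- by move=> ?; exists s.
- by case=> _ [<-].
Qed.

(** Of the slack [2 * e], one half is for moving the centre of a certificate and one half for its
    radius. *)
Lemma eball_open_radius d (c0 x : 'rV[R]_d) (r0 : R) : eball c0 r0 x ->
  exists2 e, 0 < e & \sum_i (`|x 0 i - c0 0 i| + 2 * e) ^+ 2 < r0 ^+ 2.
Proof.
move=> [r00]; set S := \sum_i _ => hS.
pose C := \sum_i (4 * `|x 0 i - c0 0 i| + 4).
have C0 : 0 <= C by apply: sumr_ge0 => i _; rewrite addr_ge0 // mulr_ge0.
(* The bound [e <= 1] makes the square linear: with [A] the coordinate distance,
   [(A + 2 e)^2 <= A^2 + e (4 A + 4)]. *)
pose e := Num.min 1 ((r0 ^+ 2 - S) / (C + 1)).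
have e0 : 0 < e by rewrite lt_min ltr01 divr_gt0 ?subr_gt0 // ltr_wpDl.
have e1 : e <= 1 by rewrite ge_min lexx.
exists e => //; apply: (@le_lt_trans _ _ (S + e * C)).
  rewrite mulr_sumr -big_split; apply: ler_sum => i _ /=.
  rewrite -[(_ - _) ^+ 2]real_normK ?num_real //.
  by move: (`|_ - _|) (normr_ge0 (x 0 i - c0 0 i)) => A A0; nra.
have : e <= (r0 ^+ 2 - S) / (C + 1) by rewrite ge_min lexx orbT.
by rewrite ler_pdivlMr ?ltr_wpDl //; nra.
Qed.

Lemma eball_cube d (c0 y : 'rV[R]_d) (r0 : R) i : eball c0 r0 y -> `|y 0 i - c0 0 i| < r0.
Proof.
move=> [r00 h]; have : `|y 0 i - c0 0 i| ^+ 2 < r0 ^+ 2.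
  rewrite real_normK ?num_real // (le_lt_trans _ h) // (bigD1 i) //= lerDl sumr_ge0 // => k _.
  exact: sqr_ge0.
by rewrite ltr_pXn2r // nnegrE ltW.
Qed.

(** The machine tries every certificate against every input ball. [sound] keeps the listed balls
    inside the image; [complete], at a small scale around each point of [U], makes them cover it. *)
Lemma eff_open_crit : eff_open X f.
Proof.
have [e he] := cmp_outcode; exists e; split; first by move=> x; exists (outcode x).
move=> U p oU UX thU.
have inballP k z : inball p k z -> eball (c z) (r z) `<=` ball_of p k.
  case/and5P=> [_ r0 p0 s0 hs] y hy; apply/ball_ofE.
  case e0 : (p (cpair k 0)) p0 s0 hs => [//|s] _ s0 hs; exists s => //; split=> //.
  apply: le_lt_trans hs; apply: ler_sum => i _; rewrite mxE.
  rewrite -[leLHS]real_normK ?num_real // lerXn2r ?nnegrE ?addr_ge0 ?(ltW r0) //.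
  rewrite [leRHS]addrC; apply: le_trans (ler_distD (c z 0 i) _ _) _.
  by rewrite lerD2r; apply/ltW/eball_cube.
have ballU k : ball_of p k `<=` U by move=> y hy; rewrite thU; exists k.
exists (outval p); split.
  move=> o; set B := cpair (cunpair (cunpair o).1).1 n.
  exists B.+1, (outval p o); split; last split=> //.
    have <- : outcode (cpair (prefix_code p B.+1) o) = (outval p o).+1; last exact: he.
    rewrite /outcode !cunpairK /= -/B lcode_eq0 size_mkseq ltnn; congr S.
    by apply: eq_outval => i iB; rewrite nthc_mkseq // ltnS.
  move=> k' k'B.
  have <- : outcode (cpair (prefix_code p k') o) = 0%N; last exact: he.
  by rewrite /outcode !cunpairK /= -/B lcode_eq0 size_mkseq -ltnS k'B.
have outball K y : ball_of (outval p) K y <-> inball p (cunpair K).1 (cunpair K).2 /\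
    eball (qv (q (cunpair K).2)) (qR (t (cunpair K).2)) y.
  rewrite ball_ofE; set z := (cunpair K).2.
  have -> : (\row_i qR (outval p (cpair K i.+1)) : 'rV[R]_m) = qv (q z).
    apply/rowP => i; rewrite !mxE /outval !cunpairK /= -/z (bigD1 i) //= eqxx mul1n big1 ?addn0 //.
    move=> j ji; rewrite eqSS (_ : (i == j :> nat) = false) //.
    by apply: contraNF ji => /eqP/val_inj->.
  rewrite /outval cunpairK /= -/z; case: (inball _ _ _); last by split=> [[]|[]].
  by split=> [[s [<-]]|[_ ?]]; [|exists (t z)].
apply/seteqP; split=> y; last first.
  case=> K _ /outball[hin /sound].
  have /and5P[Gz r0 _ _ _] := hin.
  move=> /(_ Gz r0) [|x hx <-].
    exact: subset_trans (inballP _ _ hin) (subset_trans (ballU _) UX).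
  by exists x => //; apply: ballU (inballP _ _ hin x hx).
case=> x Ux <-.
have [k _ xk] : (\bigcup_k ball_of p k) x by rewrite -thU.
have /ball_ofE[s ps hs] := xk.
have [d d0 hd] := eball_open_radius hs.
have /nbhs_ballP[d' d'0 hd'] : nbhs x X by apply: filterS UX _; apply: open_nbhs_nbhs.
pose eps := Num.min d (d' / 2).
have eps0 : 0 < eps by rewrite lt_min d0 divr_gt0.
have [|z [Gz /andP[r0 rd] cx fx]] := @complete x eps eps0.
  move=> u hu; apply: hd'; rewrite -ball_normE /ball_ /= distrC (le_lt_trans hu) //.
  by rewrite gt_min; apply/orP; right; rewrite ltr_pdivrMr // ltr_pMr // ltr1n.
exists (cpair k z) => //; apply/outball; rewrite !cunpairK; split=> //.
apply/and5P; split=> //; rewrite ps //=; first by case: hs.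
apply: le_lt_trans hd; apply: ler_sum => i _; rewrite mxE.
have ed : eps <= d by rewrite ge_min lexx.
rewrite lerXn2r ?nnegrE ?addr_ge0 ?mulr_ge0 ?(ltW d0) ?(ltW r0) //.
have := le_trans (rV_norm_coord _ i) cx; rewrite !mxE.
have := ler_distD (x 0 i) (c z 0 i) (qR (p (cpair k i.+1))).
move: (`|_ - _|) (`|c z 0 i - _|) (`|_ - _|) => A B C; lra.
Qed.

End Criterion.

(** * Covering the boundary of a cube by finitely many prefixes *)

Section Digits.
Local Open Scope nat_scope.

(** Base [b] digits number the functions from ['I_m] to [b] values, so that [allb] can range over
    them. *)
Definition dig (b s i : nat) := (s %/ b ^ i) %% b.

Lemma dig_surj (b m : nat) (a : nat -> nat) : (forall i, a i < b) ->
  exists2 s, s < b ^ m & forall i, i < m -> dig b s i = a i.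
Proof.
elim: m a => [|m IH] a ab; first by exists 0.
have b0 : 0 < b by apply: leq_ltn_trans (ab 0).
have [s sb hs] := IH (fun i => a i.+1) (fun i => ab i.+1).
exists (s * b + a 0).
  by rewrite expnS; have := ab 0; nia.
case=> [_|i im]; rewrite /dig; first by rewrite expn0 divn1 modnMDl modn_small.
by rewrite expnS divnMA divnMDl // (divn_small (ab 0)) addn0; apply: hs.
Qed.

Lemma dig_surj_ord (b m : nat) (a : 'I_m -> nat) : 0 < b -> (forall i, a i < b) ->
  exists2 s, s < b ^ m & forall i : 'I_m, dig b s i = a i.
Proof.
move=> b0 ab; have [|s sb hs] := @dig_surj b m (fun i => oapp a 0 (insub i)).
  by move=> i; case: (insub i) => //= j.
by exists s => // i; rewrite hs // valK.
Qed.

Lemma dig_lt b s i : 0 < b -> dig b s i < b.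
Proof. exact: ltn_pmod. Qed.

End Digits.

(** * Matrix bounds, Euclidean balls and rational vectors *)

Section MatrixBound.
Context {R : realType}.

(** A bound for the operator norm in the sup norm, computable from the entries. *)
Definition kappa m n (M : 'M[R]_(m, n)) : R := \sum_i \sum_k `|M i k|.

Lemma kappa_ge0 m n (M : 'M[R]_(m, n)) : 0 <= kappa M.
Proof. by do 2! (apply: sumr_ge0 => ? _). Qed.

Lemma mulmx_norm m n (u : 'rV[R]_m) (M : 'M[R]_(m, n)) : `|u *m M| <= kappa M * `|u|.
Proof.
apply: rV_norm_le => [|k]; first by rewrite mulr_ge0 // kappa_ge0.
rewrite !mxE (le_trans (ler_norm_sum _ _ _)) // /kappa mulr_suml; apply: ler_sum => i _.
rewrite normrM mulrC ler_pM // ?rV_norm_coord // (bigD1 k) //= lerDl.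
exact: sumr_ge0.
Qed.

Lemma mulmx_cont m n (M : 'M[R]_(m, n)) (u : 'rV[R]_m) :
  {for u, continuous (fun u : 'rV[R]_m => u *m M)}.
Proof.
apply/contP => e e0; exists (e / (kappa M + 1)) => [|v].
  by rewrite divr_gt0 // ltr_wpDl // kappa_ge0.
rewrite ltr_pdivlMr ?ltr_wpDl ?kappa_ge0 // -mulmxBl => h.
apply: le_lt_trans (mulmx_norm _ _) _.
by apply: le_lt_trans h; rewrite mulrC ler_wpM2l // lerDl.
Qed.

Lemma eball_small n (c x : 'rV[R]_n) (r : R) : 0 < r -> `|x - c| <= r / n.+1%:R -> eball c r x.
Proof.
move=> r0 h; split=> //; apply: (@le_lt_trans _ _ (\sum_(i < n) (r / n.+1%:R) ^+ 2)).
  apply: ler_sum => i _; rewrite -[leLHS]real_normK ?num_real //.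
  rewrite lerXn2r ?nnegrE ?divr_ge0 ?(ltW r0) //.
  by have := le_trans (rV_norm_coord _ i) h; rewrite !mxE.
rewrite sumr_const card_ord -[_ *+ n]mulr_natl expr_div_n mulrCA -[ltRHS]mulr1.
rewrite ltr_pM2l ?exprn_gt0 // ltr_pdivrMr ?exprn_gt0 // mul1r -natrX ltr_nat; nia.
Qed.

Lemma eball_norm n (c x : 'rV[R]_n) (r : R) : eball c r x -> `|x - c| < r.
Proof.
move=> h; apply: rV_norm_lt => [|i]; first by case: h.
by rewrite !mxE; apply: eball_cube.
Qed.

Lemma open_eball n (c : 'rV[R]_n) (r : R) : open (eball c r).
Proof.
rewrite openE => x hx; have [e e0 he] := eball_open_radius hx.
apply/nbhs_ballP; exists e => // y; rewrite -ball_normE /ball_ /= distrC => yx.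
split; first by case: hx.
apply: le_lt_trans he; apply: ler_sum => i _; rewrite -[leLHS]real_normK ?num_real //.
have yi : `|y 0 i - x 0 i| <= e.
  by have := le_trans (rV_norm_coord _ i) (ltW yx); rewrite !mxE.
rewrite lerXn2r ?nnegrE ?addr_ge0 ?mulr_ge0 ?(ltW e0) //.
have := ler_distD (x 0 i) (y 0 i) (c 0 i).
by move: yi; move: (`|_ - _|) (`|_ - c 0 i|) (`|_ - c 0 i|) => A B C; lra.
Qed.

Definition vecc d (w : nat) : 'rV[R]_d := \row_i qR (nthc w i).

Lemma vecc_dense d (x : 'rV[R]_d) e : 0 < e -> exists w, `|vecc d w - x| < e.
Proof.
move=> e0; have /choice[a ha] : forall i : 'I_d, exists v, `|qR v - x 0 i| < e.
  by move=> i; apply: qR_dense.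
exists (lcode [seq a i | i <- enum 'I_d]); apply: rV_norm_lt => // i; rewrite !mxE nthcE.
rewrite (nth_map i) ?size_enum_ord // nth_ord_enum; exact: ha.
Qed.

Lemma cmp_vecc d W i : cmp W -> cmpQ (fun z => vecc d (W z) 0 i).
Proof.
move=> hW; apply: (@cmpQ_ext _ _ (fun z => qR (nthc (W z) i))); first by move=> z; rewrite mxE.
by cmpQ_solve.
Qed.

End MatrixBound.

Section GridCover.
Context {R : realType}.
Variables (n m : nat) (E : nat -> nat).

(* The grid [{-rho, ..., rho}^m] has [2 * N.+1 + 1] points in each direction;
   its points are numbered by [s] through base [gbase N] digits. *)
Definition gbase (N : nat) := (2 * N.+1).+1.

Definition gridu (rho : R) (N s : nat) : 'rV[R]_m :=
  \row_i (rho * ((dig (gbase N) s i)%:R / N.+1%:R - 1)).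

Definition gbnd (N s : nat) : bool :=
  [exists i : 'I_m, (dig (gbase N) s i == 0%N) || (dig (gbase N) s i == 2 * N.+1)%N].

Definition gval (W J s : nat) : 'rV[R]_m :=
  atomval m E (nthc (nthc W s) 0) (nthc (nthc W s) 1) J.

(** [W] codes a word and a length for each grid point. The affine map enlarges the mesh by at most
    [kappa M], so each prefix is valid on the image of a whole cell. *)
Definition gcover (x0 : 'rV[R]_n) (M : 'M[R]_(m, n)) (rho : R) (N J W : nat) : bool :=
  allb (gbase N ^ m) (fun s => gbnd N s ==>
    atomok m E (nthc (nthc W s) 0) (nthc (nthc W s) 1) J
      (x0 + gridu rho N s *m M) (rho * N.+1%:R^-1 * kappa M)).

Lemma gridu_coord rho N s (i : 'I_m) c : dig (gbase N) s i = c ->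
  gridu rho N s 0 i = rho * (c%:R / N.+1%:R - 1).
Proof. by rewrite mxE => ->. Qed.

Lemma gridu_le (rho : R) N s : 0 <= rho -> `|gridu rho N s| <= rho.
Proof.
move=> rho0; apply: rV_norm_le => // i; rewrite mxE normrM ger0_norm // -[leRHS]mulr1.
rewrite ler_wpM2l // ler_norml; have N0 : 0 < N.+1%:R :> R by [].
have := @dig_lt (gbase N) s i isT; rewrite ltnS -(ler_nat R) natrM => h.
have h1 : (dig (gbase N) s i)%:R / N.+1%:R <= 2 :> R by rewrite ler_pdivrMr.
have h2 : 0 <= (dig (gbase N) s i)%:R / N.+1%:R :> R by rewrite divr_ge0.
by move: (_ / _) h1 h2 => A; lra.
Qed.

(** Each coordinate is rounded down; this is exact at [- rho] and [rho], so boundary points get grid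
    points on the same faces. *)
Lemma grid_near (rho : R) N (u : 'rV[R]_m) : 0 < rho -> `|u| <= rho ->
  exists2 s, (s < gbase N ^ m)%N & `|u - gridu rho N s| <= rho * N.+1%:R^-1 /\
    forall i : 'I_m, (u 0 i = - rho -> dig (gbase N) s i = 0%N) /\
      (u 0 i = rho -> dig (gbase N) s i = (2 * N.+1)%N).
Proof.
move=> rho0 hu; have N0 : 0 < N.+1%:R :> R by [].
pose y (i : 'I_m) : R := (u 0 i / rho + 1) * N.+1%:R.
have ui (i : 'I_m) : - 1 <= u 0 i / rho <= 1.
  have := le_trans (rV_norm_coord u i) hu; rewrite ler_norml => /andP[h1 h2].
  by rewrite ler_pdivlMr // ler_pdivrMr // mulN1r mul1r h1.
have y0 i : 0 <= y i <= (2 * N.+1)%:R.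
  have := ui i; rewrite /y; move: (_ / rho) => A /andP[h1 h2]; rewrite natrM.
  by apply/andP; split; [rewrite mulr_ge0 //; lra|rewrite ler_wpM2r //; lra].
have [//||s sb hs] := @dig_surj_ord (gbase N) m (fun i => Num.truncn (y i)).
  move=> i; rewrite ltnS -(ler_nat R); have /andP[h1 h2] := y0 i.
  by apply: le_trans h2; have /andP[] := truncn_itv h1.
exists s => //; split=> [|i].
  apply: rV_norm_le => [|i]; first by rewrite mulr_ge0 // ?invr_ge0 // ltW.
  rewrite !mxE hs //; have /andP[h1 _] := y0 i; have /andP := truncn_itv h1.
  rewrite -natr1; move: (Num.truncn _) => K; rewrite /y => -[h3 h4].
  have -> : u 0 i - rho * (K%:R / N.+1%:R - 1) =
      rho * N.+1%:R^-1 * ((u 0 i / rho + 1) * N.+1%:R - K%:R).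
    by field; rewrite !gt_eqF.
  rewrite normrM ger0_norm ?mulr_ge0 ?invr_ge0 ?(ltW rho0) //.
  rewrite -[leRHS]mulr1 ler_wpM2l ?mulr_ge0 ?invr_ge0 ?(ltW rho0) // ler_norml.
  by move: (_ * N.+1%:R) h3 h4 => A; lra.
rewrite hs /y; split=> ->.
  by rewrite mulNr divff ?gt_eqF // addNr mul0r truncn0.
by rewrite divff ?gt_eqF // -[1 + 1]/(2%:R) -natrM natrK.
Qed.

Variables (X : set 'rV[R]_n) (f : 'rV[R]_n -> 'rV[R]_m).
Hypothesis hE : forall x, X x -> answers E x (fun q => rho q (f x)).

Lemma cover_sound x0 M rho N J W (u : 'rV[R]_m) : gcover x0 M rho N J W ->
  0 < rho -> `|u| <= rho -> X (x0 + u *m M) ->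
  (exists i, `|u 0 i| = rho) ->
  exists s, [/\ (s < gbase N ^ m)%N, gbnd N s, `|f (x0 + u *m M) - gval W J s| <= (2 ^+ J)^-1 &
    forall i : 'I_m, (u 0 i = - rho -> dig (gbase N) s i = 0%N) /\
      (u 0 i = rho -> dig (gbase N) s i = (2 * N.+1)%N)].
Proof.
move=> /allbP cov rho0 hu Xu [i ui].
have [s sb [us hs]] := grid_near N rho0 hu.
have bs : gbnd N s.
  apply/existsP; exists i; have [h1 h2] := hs i.
  case: (leP 0 (u 0 i)) => h.
    by rewrite h2 ?eqxx ?orbT // -ui ger0_norm.
  by rewrite h1 ?eqxx // -ui ltr0_norm // opprK.
exists s; split=> //.
have /implyP/(_ bs) ok := cov _ sb; apply: (atom_sound hE ok) => //.
rewrite opprD addrACA subrr add0r -mulmxBl (le_trans (mulmx_norm _ _)) // mulrC.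
by rewrite ler_wpM2r // kappa_ge0.
Qed.

(** By compactness one [d] serves on the whole cube; [N] makes the images of cells fit into [d], and
    the finitely many prefixes are collected in [W]. *)
Lemma cover_complete x0 M rho J : 0 < rho ->
  (forall u : 'rV[R]_m, `|u| <= rho -> X (x0 + u *m M)) ->
  exists N W, gcover x0 M rho N J W /\
    forall s, (s < gbase N ^ m)%N -> gbnd N s ->
      `|f (x0 + gridu rho N s *m M) - gval W J s| <= (2 ^+ J)^-1.
Proof.
move=> rho0 inX.
pose P (d : R) (u : 'rV[R]_m) := exists w L, forall g h,
  `|x0 + u *m M - g| + h <= d -> atomok m E w L J g h.
have k1 : 0 < kappa M + 1 by rewrite ltr_wpDl // kappa_ge0.
have [|d d0 hd] := @compact_uniform R m _ P (@compact_cube R m 0 rho).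
  move=> u /=; rewrite subr0 => /inX Xu.
  have [w [L [d d0 hd]]] := atom_complete hE J Xu.
  exists (Num.min (d / 2) (d / 2 / (kappa M + 1))); first by rewrite lt_min !divr_gt0.
  move=> v e; rewrite lt_min => /andP[_ vu] /andP[_]; rewrite le_min => /andP[ed _].
  exists w, L => g h gh; apply: hd.
  have h1 : `|(u - v) *m M| <= d / 2.
    apply: (le_trans (mulmx_norm _ _)); rewrite distrC.
    move: vu; rewrite ltr_pdivlMr // => /ltW; apply: le_trans.
    by rewrite mulrC ler_wpM2l // lerDl.
  have -> : x0 + u *m M - g = (u - v) *m M + (x0 + v *m M - g).
    by rewrite mulmxBl; apply/rowP => i; rewrite !mxE; ring.
  have := ler_normD ((u - v) *m M) (x0 + v *m M - g).
  by move: (`|_ + _|) (`|(u - v) *m M|) h1 (`|_ - g|) gh => A B ? C; lra.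
have {}hd u : `|u| <= rho -> P d u by move=> hu; apply: hd; rewrite /= subr0.
pose N := Num.truncn (rho * kappa M / d).
have Nd : rho * N.+1%:R^-1 * kappa M <= d.
  rewrite mulrAC ler_pdivrMr // -ler_pdivrMl // mulrC; exact/ltW/truncnS_gt.
have hP s : P d (gridu rho N s) by apply/hd/gridu_le/ltW.
have /choice[wl hwl] : forall s, exists wl : nat * nat, forall g h,
    `|x0 + gridu rho N s *m M - g| + h <= d -> atomok m E wl.1 wl.2 J g h.
  by move=> s; have [w [L h]] := hP s; exists (w, L).
pose W := lcode (mkseq (fun s => lcode [:: (wl s).1; (wl s).2]) (gbase N ^ m)).
have WE s : (s < gbase N ^ m)%N ->
    nthc (nthc W s) 0 = (wl s).1 /\ nthc (nthc W s) 1 = (wl s).2.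
  by move=> sb; rewrite /W nthc_mkseq // !nthcE.
exists N, W; split.
  apply/allbP => s sb; have [-> ->] := WE s sb; apply/implyP => _.
  by apply: hwl; rewrite subrr normr0 add0r.
move=> s sb _; rewrite /gval; have [-> ->] := WE s sb.
apply: (atom_sound hE (g := x0 + gridu rho N s *m M) (h := 0)).
- by apply: hwl; rewrite subrr normr0 add0r ltW.
- by apply/inX/gridu_le/ltW.
- by rewrite subrr normr0.
Qed.

Lemma cmp_gbase N : cmp N -> cmp (fun z => gbase (N z)).
Proof. by move=> hN; rewrite /gbase; cmp_solve. Qed.

Lemma cmp_dig B S i : cmp B -> cmp S -> cmp (fun z => dig (B z) (S z) i).
Proof. by move=> hB hS; rewrite /dig; cmp_solve. Qed.

Lemma cmp_gbnd N S : cmp N -> cmp S -> cmpb (fun z => gbnd (N z) (S z)).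
Proof.
move=> hN hS; rewrite /gbnd; cmpQ_solve; apply: cmp_dig => //; exact: cmp_gbase.
Qed.

Hypothesis cE : cmp E.

Lemma cmp_gval W J S i : cmp W -> cmp J -> cmp S -> cmpQ (fun z => gval (W z) (J z) (S z) 0 i).
Proof. by move=> hW hJ hS; apply: cmp_atomval => //; cmpQ_solve. Qed.

Lemma cmpQ_kappa (M : nat -> 'M[R]_(m, n)) : (forall i k, cmpQ (fun z => M z i k)) ->
  cmpQ (fun z => kappa (M z)).
Proof. by move=> hM; do 2! apply: cmpQ_sum => ?; apply: cmpQ_norm. Qed.

Lemma cmp_cover (x0 : nat -> 'rV[R]_n) (M : nat -> 'M[R]_(m, n)) (rho : nat -> R) N J W : (forall i, cmpQ (fun z => x0 z 0 i)) ->
  (forall i k, cmpQ (fun z => M z i k)) -> cmpQ rho -> cmp N -> cmp J -> cmp W ->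
  cmpb (fun z => gcover (x0 z) (M z) (rho z) (N z) (J z) (W z)).
Proof.
move=> hx hM hr hN hJ hW; apply: (cmp_allb (P := fun z s => _)) => /=.
  by apply: cmp_exp; [exact: cmp_gbase|exact: cmp_const].
have c1 : cmp (fun t => (cunpair t).1) by cmp_solve.
have c2 : cmp (fun t => (cunpair t).2) by cmp_solve.
apply: cmp_imp; first by apply: cmp_gbnd => //; exact: (cmp_comp hN c1).
have hNS : cmp (fun t => (N (cunpair t).1)) by exact: (cmp_comp hN c1).
apply: cmp_atomok => //.
- by cmpQ_solve.
- by cmpQ_solve.
- exact: (cmp_comp hJ c1).
- move=> k; apply: (@cmpQ_ext R _ (fun t => x0 (cunpair t).1 0 k + \sum_(i < m)
    (rho (cunpair t).1 * ((dig (gbase (N (cunpair t).1)) (cunpair t).2 i)%:R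
      * (N (cunpair t).1).+1%:R^-1 + - 1) * M (cunpair t).1 i k))).
    by move=> t; rewrite !mxE; congr (_ + _); apply: eq_bigr => i _; rewrite !mxE.
  apply: cmpQ_add; first exact: (cmpQ_comp (hx k) c1).
  apply: cmpQ_sum => i; apply: cmpQ_mul; last exact: (cmpQ_comp (hM i k) c1).
  apply: cmpQ_mul; first exact: (cmpQ_comp hr c1).
  apply: cmpQ_add; last by cmpQ_solve.
  apply: cmpQ_mul; last by cmpQ_solve.
  by apply: cmpQ_nat; apply: cmp_dig => //; apply: cmp_gbase.
- apply: cmpQ_mul; last exact: (cmpQ_comp (cmpQ_kappa hM) c1).
  by apply: cmpQ_mul; [exact: (cmpQ_comp hr c1)|cmpQ_solve].
Qed.

End GridCover.

(** * Convex images of balls *)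

Lemma re_open_open {R : realType} d (X : set 'rV[R]_d) : re_open X -> open X.
Proof.
move=> [p [_ ->]]; apply: bigcup_open => k _; rewrite /ball_of.
by case: (p _) => [|s]; [exact: open0|exact: open_eball].
Qed.

Section ConvexImages.
Context {R : realType}.
Variables (n m : nat) (X : set 'rV[R]_n) (f : 'rV[R]_n -> 'rV[R]_m) (E : nat -> nat).
Hypotheses (cE : cmp E) (hE : forall x, X x -> answers E x (fun q => rho q (f x))).
Hypothesis of_ : open_fun X f.
Hypothesis cvf : forall (c : 'rV[R]_n) (r : R), 0 < r -> eball c r `<=` X ->
  convex_in (f @` eball c r).

Definition cvx_c (z : nat) : 'rV[R]_n := vecc n (nthc z 0).
Definition cvx_r (z : nat) : R := qR (nthc z 1).
Definition cvx_q (z : nat) (i : 'I_m) : nat := nthc (nthc z 2) i.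
Definition cvx_t (z : nat) : nat := nthc z 3.
Definition cvx_J (z : nat) : nat := nthc z 4.
Definition cvx_g (z s : nat) : 'rV[R]_n := vecc n (nthc (nthc (nthc z 5) s) 2).

(* [s] ranges over sign vectors; the [s]-th sample point lies in the ball and
   its image lies in the [s]-th orthant seen from the cube to be covered. *)
Definition cvx_check (z : nat) : bool :=
  allb (2 ^ m) (fun s =>
    [&& atomok m E (nthc (nthc (nthc z 5) s) 0) (nthc (nthc (nthc z 5) s) 1) (cvx_J z) (cvx_g z s) 0,
      \sum_i (cvx_g z s 0 i - cvx_c z 0 i) ^+ 2 < cvx_r z ^+ 2 &
      [forall i : 'I_m,
        ((dig 2 s i == 1%N) ==> (qR (cvx_q z i) + qR (cvx_t z) + (2 ^+ cvx_J z)^-1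
            <= @gval R m E (nthc z 5) (cvx_J z) s 0 i)) &&
        ((dig 2 s i == 0%N) ==> (@gval R m E (nthc z 5) (cvx_J z) s 0 i
            <= qR (cvx_q z i) + - qR (cvx_t z) + - (2 ^+ cvx_J z)^-1))]]).

Lemma cmp_cvx_check : cmpb cvx_check.
Proof.
apply: (cmp_allb (P := fun z s => _)) => /=; first by cmp_solve.
rewrite /cvx_J /cvx_r /cvx_q /cvx_t.
apply: cmp_and; [|apply: cmp_and].
- apply: (@cmp_atomok R n m E _ _ _ (fun t => cvx_g (cunpair t).1 (cunpair t).2) (fun=> 0))
    => //; cmpQ_solve.
  by move=> i; apply: cmp_vecc; cmpQ_solve.
- cmpQ_solve.
  + by apply: cmp_vecc; cmpQ_solve.
  + by apply: cmp_vecc; cmpQ_solve.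
- cmpQ_solve.
  + by apply: cmp_dig; cmpQ_solve.
  + by apply: cmp_gval; cmpQ_solve.
  + by apply: cmp_dig; cmpQ_solve.
  + by apply: cmp_gval; cmpQ_solve.
Qed.

(** Soundness is [convex_signs]. For completeness, openness gives a cube of radius [T] around [f x]
    in the image, whose inner corners are nearly attained at rational sample points. *)
Lemma eff_open_convex : eff_open X f.
Proof.
apply: (@eff_open_crit R n m X f cvx_check cvx_c cvx_r cvx_q cvx_t).
- exact: cmp_cvx_check.
- by move=> i; apply: cmp_vecc; cmpQ_solve.
- by rewrite /cvx_r; cmpQ_solve.
- by move=> i; rewrite /cvx_q; cmpQ_solve.
- by rewrite /cvx_t; cmpQ_solve.
- move=> z /allbP ok r0 BX y hy.
  apply: (convex_signs (cvf r0 BX)) => sg.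
  have [//||s sb hs] := @dig_surj_ord 2 m (fun i => nat_of_bool (sg i)).
    by move=> i; case: (sg i).
  have /and3P[h1 h2 /forallP h3] := ok s sb.
  have gB : eball (cvx_c z) (cvx_r z) (cvx_g z s) by split.
  exists (f (cvx_g z s)); first by exists (cvx_g z s).
  move=> i; have := atom_sound hE h1 (BX _ gB); rewrite subrr normr0 lexx => /(_ isT).
  move=> /(le_trans (rV_norm_coord _ i)).
  have := eball_cube i hy; have /andP[] := h3 i; rewrite hs /gval !mxE ltr_norml ler_norml.
  move: (f _ 0 i) (qR (cvx_q z i)) (qR (cvx_t z)) (qR (runm _ _ _ _).-1) ((2 ^+ cvx_J z)^-1).
  move=> F q t v p; clear -R; case: (sg i) => /= h4 h5 /andP[h6 h7] /andP[h8 h9]; lra.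
move=> x e e0 inX.
have [r' /andP[r0 re]] := @qR_between R 0 (e / 2) ltac:(lra).
have [cw hc] := @vecc_dense R n x (qR r' / n.+1%:R) ltac:(by rewrite divr_gt0).
have rn : qR r' / n.+1%:R <= qR r' :> R by rewrite ler_pdivrMr // ler_peMr ?ler1n // ltW.
have Bx : eball (vecc n cw) (qR r') x by apply: eball_small => //; rewrite distrC ltW.
have BX : eball (vecc n cw) (qR r') `<=` X.
  move=> y /eball_norm hy; apply: inX.
  have := ler_distD (vecc n cw) y x.
  have := lt_le_trans hc rn.
  by move: (`|y - x|) (`|y - _|) hy (`|_ - x|) => A B ? C; lra.
have /nbhs_ballP[T /= T0 hT] : nbhs (f x) (f @` eball (vecc n cw) (qR r')).
  by apply: open_nbhs_nbhs; split; [apply: of_ => //; exact: open_eball|exists x].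
have {}hT y : `|y - f x| < T -> exists2 x', eball (vecc n cw) (qR r') x' & f x' = y.
  by move=> h; apply: hT; rewrite -ball_normE /ball_ /= distrC.
(* The error of [q], two errors [2^-J] and [t < T / 4] add up to less than the [T / 2] of the
   corners, while [t > T / 16] keeps [f x] in the target ball. *)
have [J hJ] := @expr2V_small R (T / 16) ltac:(lra).
have [t /andP[t0 tT]] := @qR_between R (T / 8) (T / 4) ltac:(lra).
have [qw hq] := @vecc_dense R m (f x) (T / 16 / m.+1%:R) ltac:(by rewrite !divr_gt0).
have Tm : T / 16 / m.+1%:R <= T / 16 :> R.
  by rewrite ler_pdivrMr // ler_peMr ?ler1n // divr_ge0 // ltW.
have /choice[W hW] : forall s : nat, exists W : nat * (nat * nat),
    [/\ atomok m E W.1 W.2.1 J (vecc n W.2.2 : 'rV[R]_n) 0,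
      eball (vecc n cw : 'rV[R]_n) (qR r') (vecc n W.2.2) &
      forall i : 'I_m, `|@atomval R m E W.1 W.2.1 J 0 i
        - (f x 0 i + (if dig 2 s i == 1%N then T / 2 else - (T / 2)))| <= (2 ^+ J)^-1].
  (* The prefix comes from a preimage of the corner of sign vector [s]; the sample point is a
     rational point near it. *)
  move=> s; pose y := f x + \row_(i < m) (if dig 2 s i == 1%N then T / 2 else - (T / 2)) : 'rV[R]_m.
  have [x' Bx' fx'] : exists2 x', eball (vecc n cw) (qR r') x' & f x' = y.
    apply: hT; rewrite addrC addKr; apply: rV_norm_lt => // i; rewrite mxE.
    by case: ifP => _; rewrite ltr_norml; lra.
  have [w [L [d d0 hd]]] := atom_complete hE J (BX _ Bx').
  have /nbhs_ballP[d' /= d'0 hd'] : nbhs x' (eball (vecc n cw) (qR r')).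
    by apply: open_nbhs_nbhs; split=> //; exact: open_eball.
  have [gw hg] := @vecc_dense R n x' (Num.min d d') ltac:(by rewrite lt_min d0).
  move: hg; rewrite lt_min distrC => /andP[hg1 hg2].
  exists (w, (L, gw)); split=> /=.
  - by apply: hd; rewrite addr0 ltW.
  - by apply: hd'; rewrite -ball_normE.
  - move=> i; have := atom_sound hE (hd x' 0 _) (BX _ Bx').
    rewrite subrr normr0 addr0 lexx (ltW d0) => /(_ isT isT)/(le_trans (rV_norm_coord _ i)).
    by rewrite fx' !mxE distrC.
pose Wc := lcode (mkseq (fun s => lcode [:: (W s).1; (W s).2.1; (W s).2.2]) (2 ^ m)).
pose z := lcode [:: cw; r'; qw; t; J; Wc].
have [z0 z1 z2 z3 z4] : [/\ nthc z 0 = cw, nthc z 1 = r', nthc z 2 = qw, nthc z 3 = t & nthc z 4 = J].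
  by split; rewrite nthcE.
have z5 s : (s < 2 ^ m)%N -> [/\ nthc (nthc (nthc z 5) s) 0 = (W s).1,
    nthc (nthc (nthc z 5) s) 1 = (W s).2.1 & nthc (nthc (nthc z 5) s) 2 = (W s).2.2].
  move=> sb; have -> : nthc z 5 = Wc by rewrite nthcE.
  by rewrite /Wc nthc_mkseq // !nthcE.
exists z; rewrite /cvx_c /cvx_r /cvx_t z0 z1 z3; split; last first.
- have -> : qv (cvx_q z) = vecc m qw :> 'rV[R]_m by apply/rowP => i; rewrite !mxE /cvx_q z2.
  apply: eball_small; first lra.
  rewrite distrC (le_trans (ltW hq)) // ler_pM2r ?invr_gt0 //; lra.
- by rewrite (le_trans (ltW hc)) // (le_trans rn) // (le_trans (ltW re)) //; lra.
- by rewrite r0; lra.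
apply/allbP => s sb; have [e0' e1 e2] := z5 s sb.
rewrite /cvx_J /cvx_g /cvx_c /cvx_r /cvx_t /cvx_q /gval z0 z1 z2 z3 z4 e0' e1 e2.
have [W1 [_ W2] W3] := hW s; rewrite W1 W2 /=; apply/forallP => i.
have := W3 i; have := le_trans (rV_norm_coord _ i) (le_trans (ltW hq) Tm); rewrite [(_ - f x) 0 i]mxE.
rewrite [(- f x) 0 i]mxE [vecc m qw 0 i]mxE.
move: (atomval _ _ _ _ _ 0 i) (qR (nthc qw i)) => v q; rewrite !ler_norml => /andP[q1 q2].
case: eqP => [->|_] /= /andP[v1 v2]; first by rewrite andbT; lra.
by case: eqP => _ //=; lra.
Qed.

End ConvexImages.

(** * Real-valued and affine maps have convex images of balls *)

Section AffineAndReal.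
Context {R : realType}.

Lemma eball_convex n (c : 'rV[R]_n) (r : R) : convex_in (eball c r).
Proof.
move=> y z t [r0 hy] [_ hz] /andP[t0 t1]; split=> //.
apply: (@le_lt_trans _ _ (t * \sum_(i < n) (y 0 i - c 0 i) ^+ 2 +
    (1 - t) * \sum_(i < n) (z 0 i - c 0 i) ^+ 2)).
  rewrite !mulr_sumr -big_split; apply: ler_sum => i _; rewrite !mxE /=.
  have -> : t * y 0 i + (1 - t) * z 0 i - c 0 i =
    t * (y 0 i - c 0 i) + (1 - t) * (z 0 i - c 0 i) by ring.
  move: (y 0 i - c 0 i) (z 0 i - c 0 i) => a b.
  rewrite -subr_ge0 (_ : _ - _ = t * (1 - t) * (a - b) ^+ 2); last by ring.
  by apply: mulr_ge0; [apply: mulr_ge0; rewrite ?subr_ge0|exact: sqr_ge0].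
apply: (@le_lt_trans _ _ (Num.max (\sum_(i < n) (y 0 i - c 0 i) ^+ 2)
    (\sum_(i < n) (z 0 i - c 0 i) ^+ 2))); last by rewrite gt_max hy.
by apply: convex_comb_le_max; rewrite t0.
Qed.

(** The intermediate value theorem along a segment inside the ball. *)
Lemma convex_image_real n (X : set 'rV[R]_n) (f : 'rV[R]_n -> 'rV[R]_1) (c : 'rV[R]_n) (r : R) :
  (forall x, X x -> {for x, continuous f}) -> eball c r `<=` X -> convex_in (f @` eball c r).
Proof.
move=> cf BX _ _ t [a Ba <-] [b Bb <-] /andP[t0 t1].
pose p (s : R) := s *: a + (1 - s) *: b.
have pB s : 0 <= s <= 1 -> eball c r (p s) by move=> h; apply: eball_convex.
have cg : {within `[0, 1], continuous (fun s => f (p s) 0 0)}.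
  apply: continuous_in_subspaceT => s; rewrite inE /= in_itv /= => /pB/BX/cf cs.
  have cp : {for s, continuous p}.
    apply: (@contD R R 'rV[R]_n (fun s => s *: a) (fun s => (1 - s) *: b)).
      by apply: (@contZ R R 'rV[R]_n id (fun=> a)); [exact: id_cont|exact: cst_cont].
    apply: (@contZ R R 'rV[R]_n (fun s => 1 - s) (fun=> b)); last exact: cst_cont.
    by apply: (@contB R R R (fun=> 1) id); [exact: cst_cont|exact: id_cont].
  apply: (@continuous_comp _ _ _ (fun s => f (p s)) (fun y : 'rV[R]_1 => y 0 0)).
    exact: (@continuous_comp _ _ _ p f).
  exact: coord_continuous.
have [||s s01 hs] := IVT (v := (t *: f a + (1 - t) *: f b) 0 0) _ cg; first exact: ler01.
  rewrite /p !mxE scale1r scale0r subrr subr0 scale0r scale1r add0r addr0.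
  move: (f a 0 0) (f b 0 0) => A B; rewrite ge_min le_max.
  by case: (leP A B) => AB; apply/andP; split; apply/orP; [right|left|left|right]; nra.
exists (p s); first by apply: pB; move: s01; rewrite in_itv.
by apply/rowP => i; rewrite ord1.
Qed.

(** Preimages of the unit vectors give [C] with [C *m A = 1], through which small displacements of
    the image lift. *)
Lemma affine_open n m (A : 'M[R]_(n, m)) (b : 'rV[R]_m) (f : 'rV[R]_n -> 'rV[R]_m) :
  (forall x, f x = x *m A + b) -> (forall y, exists x, f x = y) -> open_fun setT f.
Proof.
move=> fE sf U oU _.
have /choice[B hB] : forall i : 'I_m, exists x : 'rV[R]_n, x *m A = delta_mx 0 i.
  by move=> i; have [x] := sf (delta_mx 0 i + b); rewrite fE => /addIr; exists x.
pose C : 'M[R]_(m, n) := \matrix_i B i.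
have CA : C *m A = 1%:M.
  by apply/row_matrixP => i; rewrite row_mul rowK hB rowE mulmx1.
rewrite openE => _ [x Ux <-].
have /nbhs_ballP[d /= d0 hd] : nbhs x U by apply: open_nbhs_nbhs.
have k1 : 0 < kappa C + 1 by rewrite ltr_wpDl // kappa_ge0.
apply/nbhs_ballP; exists (d / (kappa C + 1)) => [|y]; first by rewrite /= divr_gt0.
rewrite -ball_normE /ball_ /= distrC ltr_pdivlMr // => hy.
exists (x + (y - f x) *m C); last first.
  by rewrite fE mulmxDl -mulmxA CA mulmx1 addrAC -fE addrC subrK.
apply: hd; rewrite -ball_normE /ball_ /= opprD addNKr normrN.
apply: le_lt_trans (mulmx_norm _ _) _.
by apply: le_lt_trans hy; rewrite mulrC ler_wpM2l // lerDl.
Qed.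

Lemma affine_convex n m (A : 'M[R]_(n, m)) (b : 'rV[R]_m) (f : 'rV[R]_n -> 'rV[R]_m)
  (c : 'rV[R]_n) (r : R) :
  (forall x, f x = x *m A + b) -> convex_in (f @` eball c r).
Proof.
move=> fE _ _ t [x Bx <-] [y By <-] t01; exists (t *: x + (1 - t) *: y); first exact: eball_convex.
by rewrite !fE mulmxDl -!scalemxAl; apply/rowP => i; rewrite !mxE; ring.
Qed.

End AffineAndReal.

(** * Submersions *)

Section Submersion.
Context {R : realType}.

Lemma diff_eps n m (f : 'rV[R]_n -> 'rV[R]_m) x eta : differentiable f x -> 0 < eta ->
  exists2 d, 0 < d &
    forall v, `|v| < d -> `|f (x + v) - f x - v *m lin1_mx ('d f x)| <= eta * `|v|.
Proof.
move=> /diff_locallyP[_ /eqaddoP h] /h /nbhs_ballP[d /= d0 hd]; exists d => // v vd.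
have := hd v; rewrite -ball_normE /ball_ /= sub0r normrN => /(_ vd).
by rewrite mul_rV_lin1 !fctE /= (addrC v) opprD addrA.
Qed.

Lemma affine_clamp_cont n m (f : 'rV[R]_n -> 'rV[R]_m) (c : 'rV[R]_n) (M : 'M[R]_(m, n))
    (rho : R) : 0 < rho ->
  (forall u : 'rV[R]_m, `|u| <= rho -> {for c + u *m M, continuous f}) ->
  continuous (fun u => f (c + clampv rho u *m M)).
Proof.
move=> rho0 cf u.
apply: (@continuous_comp _ _ _ (fun u => c + clampv rho u *m M) f); last first.
  by apply/cf/clampv_le/ltW.
apply: (@contD R _ _ (fun=> c) (fun u => clampv rho u *m M)); first exact: cst_cont.
apply: (@continuous_comp _ _ _ (clampv rho) (fun u => u *m M)); first exact: clampv_cont.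
exact: mulmx_cont.
Qed.

Variables (n m : nat) (X : set 'rV[R]_n) (f : 'rV[R]_n -> 'rV[R]_m) (E : nat -> nat).
Hypotheses (cE : cmp E) (hE : forall x, X x -> answers E x (fun q => rho q (f x))).
Hypothesis oX : open X.

Definition sub_c (z : nat) : 'rV[R]_n := vecc n (nthc z 0).
Definition sub_rho (z : nat) : R := qR (nthc z 1).
Definition sub_q (z : nat) (i : 'I_m) : nat := nthc (nthc z 5) i.
Definition sub_t (z : nat) : nat := nthc z 6.
Definition sub_M (z : nat) : 'M[R]_(m, n) := \matrix_(i, k) qR (nthc (nthc (nthc z 7) i) k).
(** The radius of a Euclidean ball containing the affine cube; [n.+1] passes from the sup norm to
    the Euclidean one. *)
Definition sub_r (z : nat) : R := n.+1%:R * (sub_rho z * (kappa (sub_M z) + 1)).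

(* The affine cube [u |-> sub_c z + u *m sub_M z], [`|u| <= sub_rho z], and on the
   boundary of the cube the Poincare-Miranda inequalities with a margin [t]. *)
Definition sub_check (z : nat) : bool :=
  let N := nthc z 2 in let J := nthc z 3 in let W := nthc z 4 in
  [&& 0 < sub_rho z, gcover E (sub_c z) (sub_M z) (sub_rho z) N J W &
  allb (gbase N ^ m) (fun s => gbnd m N s ==> [forall i : 'I_m,
    ((dig (gbase N) s i == 0%N) ==> (@gval R m E W J s 0 i
      <= qR (sub_q z i) + - qR (sub_t z) + - (2 ^+ J)^-1)) &&
    ((dig (gbase N) s i == 2 * N.+1)%N ==> (qR (sub_q z i) + qR (sub_t z) + (2 ^+ J)^-1
      <= @gval R m E W J s 0 i))])].

Lemma cmpQ_sub_M i k : cmpQ (fun z => sub_M z i k).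
Proof.
apply: (@cmpQ_ext _ _ (fun z => qR (nthc (nthc (nthc z 7) i) k))) => [z|]; first by rewrite mxE.
by cmpQ_solve.
Qed.

Lemma cmp_sub_check : cmpb sub_check.
Proof.
apply: cmp_and; [|apply: cmp_and].
- by rewrite /sub_rho; cmpQ_solve.
- apply: cmp_cover => //; rewrite /sub_rho; cmpQ_solve.
  + by move=> i; apply: cmp_vecc; cmpQ_solve.
  + exact: cmpQ_sub_M.
apply: (cmp_allb (P := fun z s => _)) => /=.
  by apply: cmp_exp; [apply: cmp_gbase|]; cmpQ_solve.
rewrite /sub_q /sub_t; apply: cmp_imp; first by apply: cmp_gbnd; cmpQ_solve.
cmpQ_solve; by [apply: cmp_gval; cmpQ_solve|apply: cmp_dig; cmpQ_solve; apply: cmp_gbase; cmpQ_solve|apply: cmp_gbase; cmpQ_solve].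
Qed.

Hypothesis dX : forall x, X x -> exists A : 'M[R]_(n, m), (exists B, B *m A = 1%:M) /\
  forall eta, 0 < eta -> exists2 d, 0 < d &
    forall v, `|v| < d -> `|f (x + v) - f x - v *m A| <= eta * `|v|.

Lemma sub_ball z (u : 'rV[R]_m) : 0 < sub_rho z -> `|u| <= sub_rho z ->
  eball (sub_c z) (sub_r z) (sub_c z + u *m sub_M z).
Proof.
move=> rho0 hu; have k0 := kappa_ge0 (sub_M z).
have k1 : 0 < kappa (sub_M z) + 1 by rewrite ltr_wpDl.
apply: eball_small; first by rewrite mulr_gt0 // mulr_gt0.
rewrite addrC addKr (le_trans (mulmx_norm _ _)) // /sub_r [leRHS]mulrAC divff ?pnatr_eq0 // mul1r.
rewrite mulrC; apply: ler_pM => //; by rewrite ?lerDl.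
Qed.

Lemma matrix_dense (B : 'M[R]_(m, n)) (e : R) : 0 < e ->
  exists w, kappa (\matrix_(i, k) qR (nthc (nthc w i) k) - B) < e.
Proof.
move=> e0; pose d := e / (m * n).+1%:R.
have d0 : 0 < d by rewrite divr_gt0.
have /choice[w hw] : forall i : 'I_m, exists w, `|vecc n w - row i B| < d.
  by move=> i; apply: vecc_dense.
exists (lcode [seq w i | i <- enum 'I_m]).
apply: (@le_lt_trans _ _ (\sum_(i < m) \sum_(k < n) d)).
  apply: ler_sum => i _; apply: ler_sum => k _; rewrite !mxE nthcE.
  rewrite (nth_map i) ?size_enum_ord // nth_ord_enum.
  by have := le_trans (rV_norm_coord _ k) (ltW (hw i)); rewrite !mxE.
rewrite !sumr_const !card_ord -mulrnA -mulr_natr /d mulrAC ltr_pdivrMr // mulnC.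
by rewrite ltr_pM2l // ltr_nat.
Qed.

(** Soundness is the Poincare-Miranda theorem for the clamped map. For completeness,
    [u |-> f (c + u *m M)] is shown to be close to [u |-> f x + u] on a small cube. *)
Lemma eff_open_submersion : eff_open X f.
Proof.
apply: (@eff_open_crit R n m X f sub_check sub_c sub_r sub_q sub_t).
- exact: cmp_sub_check.
- by move=> i; apply: cmp_vecc; cmpQ_solve.
- apply: cmpQ_mul; first by cmpQ_solve.
  apply: cmpQ_mul; first by rewrite /sub_rho; cmpQ_solve.
  by apply: cmpQ_add; [apply: cmpQ_kappa; exact: cmpQ_sub_M|cmpQ_solve].
- by move=> i; rewrite /sub_q; cmpQ_solve.
- by rewrite /sub_t; cmpQ_solve.
- move=> z /and3P[rho0 cov /allbP ok] r0 BX y hy.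
  have inX u : `|u| <= sub_rho z -> X (sub_c z + u *m sub_M z).
    by move=> hu; apply/BX/sub_ball.
  have cF : continuous (fun u => f (sub_c z + clampv (sub_rho z) u *m sub_M z)).
    apply: affine_clamp_cont => // u /inX Xu; exact: (computes_continuous hE).
  have bd (u : 'rV[R]_m) i : `|u| <= sub_rho z -> `|u 0 i| = sub_rho z ->
      exists s, [/\ (s < gbase (nthc z 2) ^ m)%N, gbnd m (nthc z 2) s,
        `|f (sub_c z + u *m sub_M z) - gval m E (nthc z 4) (nthc z 3) s| <= (2 ^+ nthc z 3)^-1 &
        forall i : 'I_m, (u 0 i = - sub_rho z -> dig (gbase (nthc z 2)) s i = 0%N) /\
        (u 0 i = sub_rho z -> dig (gbase (nthc z 2)) s i = (2 * (nthc z 2).+1)%N)].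
    by move=> hu ui; apply: (cover_sound hE cov) => //; [exact: inX|exists i].
  have [||u hu <-] := poincare_miranda_image (z := y) rho0 cF.
  + move=> u i hu ui; rewrite clampv_id //.
    have [|s [sb bs hs hd]] := bd u i hu; first by rewrite ui normrN gtr0_norm.
    have /implyP/(_ bs)/forallP/(_ i)/andP[h1 _] := ok s sb.
    move: h1; rewrite (hd i).1 // eqxx /= => h1.
    have := le_trans (rV_norm_coord _ i) hs; have := eball_cube i hy; move: h1.
    rewrite !mxE ltr_norml ler_norml.
    move: (f _ 0 i) (qR (sub_q z i)) (qR (sub_t z)) (qR (runm _ _ _ _).-1) ((2 ^+ nthc z 3)^-1).
    by move=> F q t v p; clear -R => h2 /andP[h3 h4] /andP[h5 h6]; lra.
  + move=> u i hu ui; rewrite clampv_id //.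
    have [|s [sb bs hs hd]] := bd u i hu; first by rewrite ui gtr0_norm.
    have /implyP/(_ bs)/forallP/(_ i)/andP[_ h1] := ok s sb.
    move: h1; rewrite (hd i).2 // eqxx /= => h1.
    have := le_trans (rV_norm_coord _ i) hs; have := eball_cube i hy; move: h1.
    rewrite !mxE ltr_norml ler_norml.
    move: (f _ 0 i) (qR (sub_q z i)) (qR (sub_t z)) (qR (runm _ _ _ _).-1) ((2 ^+ nthc z 3)^-1).
    by move=> F q t v p; clear -R => h2 /andP[h3 h4] /andP[h5 h6]; lra.
  exists (sub_c z + u *m sub_M z); first exact: sub_ball.
  by rewrite clampv_id.
move=> x e e0 inX; have Xx : X x by apply: inX; rewrite subrr normr0 ltW.
have [A [[B BA] dA]] := dX Xx.
have kA := kappa_ge0 A.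
have kA1 : 0 < kappa A + 1 by rewrite ltr_wpDl.
(* So close to [B] that [u *m M *m A] differs from [u] by at most an eighth of its norm. *)
have [wM] := @matrix_dense B (8^-1 / (kappa A + 1)) ltac:(by rewrite divr_gt0 // ltr_wpDl).
set M := (\matrix_(i, k) _ : 'M[R]_(m, n)) => hM.
have kM := kappa_ge0 M.
have MA (u : 'rV[R]_m) : `|u *m M *m A - u| <= 8^-1 * `|u|.
  have -> : u *m M *m A - u = u *m (M - B) *m A.
    by rewrite mulmxBr mulmxBl -[u *m B *m A]mulmxA BA mulmx1.
  apply: (le_trans (mulmx_norm _ _)).
  apply: (@le_trans _ _ (kappa A * (kappa (M - B) * `|u|))).
    by rewrite ler_wpM2l // mulmx_norm.
  rewrite mulrA ler_wpM2r // mulrC; move: hM; rewrite ltr_pdivlMr ?ltr_wpDl // => /ltW.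
  by apply: le_trans; rewrite ler_wpM2l ?kappa_ge0 // lerDl.
have k1 : 0 < kappa M + 1 by rewrite ltr_wpDl.
(* Displacements have size at most [rh * (kappa M + 1)], so this makes the remainder at most
   [rh / 8]. *)
have [d d0 hd] := dA (8^-1 / (kappa M + 1)) ltac:(by rewrite divr_gt0).
pose top := Num.min d (e / n.+1%:R) / (kappa M + 1).
have [r /andP[r0 rtop]] := @qR_between R 0 top
  ltac:(by rewrite !divr_gt0 // lt_min d0 divr_gt0).
set rh := qR r in r0 rtop.
have {rtop} [rd re] : rh * (kappa M + 1) < d /\ n.+1%:R * (rh * (kappa M + 1)) <= e.
  move: rtop; rewrite ltr_pdivlMr // lt_min => /andP[-> /ltW].
  by rewrite ler_pdivlMr // mulrC.
have rsmall : rh * (kappa M + 1) <= e.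
  by apply: le_trans re; rewrite ler_peMl ?ler1n //; apply: mulr_ge0; exact: ltW.
have [wc hc] := @vecc_dense R n x (rh / 8 / (kappa A + 1))
  ltac:(by rewrite divr_gt0 // divr_gt0).
set c := vecc n wc in hc.
have hcr : `|c - x| <= rh / 8.
  by apply: (le_trans (ltW hc)); rewrite ler_pdivrMr ?ltr_wpDl // ler_peMr ?lerDr // divr_ge0 // ltW.
have hv (u : 'rV[R]_m) : `|u| <= rh -> `|c - x + u *m M| <= rh * (kappa M + 1).
  move=> hu; rewrite (le_trans (ler_normD _ _)) // mulrDr mulr1 addrC lerD //.
    by rewrite (le_trans (mulmx_norm _ _)) // mulrC ler_wpM2r.
  lra.
have cu (u : 'rV[R]_m) : c + u *m M = x + (c - x + u *m M).
  by rewrite addrA addrCA subrr addr0.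
have uX (u : 'rV[R]_m) : `|u| <= rh -> X (c + u *m M).
  move=> hu; apply: inX; rewrite cu addrAC subrr add0r.
  exact: le_trans (hv u hu) rsmall.
(* Three errors of [rh / 8]: the remainder, the offset of the centre and the inexact inverse. *)
have approx (u : 'rV[R]_m) : `|u| <= rh -> `|f (c + u *m M) - f x - u| <= 3 / 8 * rh.
  move=> hu; have := hd (c - x + u *m M); rewrite -cu => /(_ (le_lt_trans (hv u hu) rd)) h1.
  have {}h1 : `|f (c + u *m M) - f x - (c - x + u *m M) *m A| <= rh / 8.
    apply: (le_trans h1); rewrite mulrC mulrA ler_pdivrMr //.
    by rewrite [leRHS]mulrAC ler_wpM2r // hv.
  have h2 : `|(c - x) *m A| <= rh / 8.
    apply: (le_trans (mulmx_norm _ _)); rewrite mulrC.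
    move: hc; rewrite ltr_pdivlMr ?ltr_wpDl // => /ltW; apply: le_trans.
    by rewrite ler_wpM2l // lerDl.
  have h3 := MA u.
  have -> : f (c + u *m M) - f x - u = (f (c + u *m M) - f x - (c - x + u *m M) *m A) +
      ((c - x) *m A + (u *m M *m A - u)).
    by rewrite [(c - x + _) *m A]mulmxDl; apply/rowP => i; rewrite !mxE; ring.
  move: h1 h2 h3; set a1 := _ - (c - x + u *m M) *m A; set a2 := (c - x) *m A.
  set a3 := u *m M *m A - u => h1 h2 h3.
  apply: (le_trans (ler_normD _ _)); have := ler_normD a2 a3.
  move: (`|a1|) (`|a2|) (`|a3|) (`|a2 + a3|) (`|u|) h1 h2 h3 hu => b1 b2 b3 b4 b5; lra.
(* On a face the relevant coordinate of [f] is at least [5 / 8 * rh] away from that of [f x]; the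
   errors of [q] and of the answers together with [t] stay below this. *)
have [J hJ] := @expr2V_small R (rh / 16) ltac:(lra).
have [t /andP[t0 tT]] := @qR_between R (rh / 8) (rh / 4) ltac:(lra).
have [qw hq] := @vecc_dense R m (f x) (rh / 16 / m.+1%:R) ltac:(by rewrite divr_gt0 // divr_gt0).
have rm : rh / 16 / m.+1%:R <= rh / 16.
  by rewrite ler_pdivrMr // ler_peMr ?ler1n // divr_ge0 // ltW.
have [N [W [cov hval]]] := cover_complete hE J r0 uX.
exists (lcode [:: wc; r; N; J; W; qw; t; wM]).
rewrite /sub_check /sub_r /sub_c /sub_rho /sub_t !nthcE.
have -> : sub_M (lcode [:: wc; r; N; J; W; qw; t; wM]) = M by rewrite /sub_M nthcE.
have -> : qv (sub_q (lcode [:: wc; r; N; J; W; qw; t; wM])) = vecc m qw :> 'rV[R]_m.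
  by apply/rowP => i; rewrite !mxE /sub_q nthcE.
rewrite -/c -/rh; split.
- apply/and3P; split=> //; apply/allbP => s sb; apply/implyP => bs; apply/forallP => i.
  rewrite /sub_q nthcE /=.
  have hs := le_trans (rV_norm_coordB _ _ i) (hval s sb bs).
  have ha := le_trans (rV_norm_coordBB _ _ _ i) (approx _ (gridu_le m N s (ltW r0))).
  have hq' := le_trans (rV_norm_coordB _ _ i) (le_trans (ltW hq) rm).
  have N0 : N.+1%:R != 0 :> R by rewrite pnatr_eq0.
  move: hs ha hq'; rewrite [vecc _ _ 0 i]mxE !ler_norml.
  move: (f _ 0 i) (f x 0 i) (gval _ _ _ _ _ 0 i) (qR (nthc qw i)) => F1 F0 v q hs ha hq'.
  apply/andP; split; apply/implyP => /eqP di; move: ha; rewrite (gridu_coord rh di).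
    by rewrite mul0r sub0r => ha; lra.
  by rewrite natrM mulfK // => ha; lra.
- by rewrite re andbT mulr_gt0 // mulr_gt0.
- by apply: (le_trans hcr); apply: le_trans rsmall; move: kM r0; nra.
- apply: eball_small; first lra.
  rewrite distrC (le_trans (ltW hq)) // ler_pM2r ?invr_gt0 //; lra.
Qed.

End Submersion.

(** * Locally injective maps *)

Section LocallyInjective.
Context {R : realType}.
Variables (n : nat) (X : set 'rV[R]_n) (f : 'rV[R]_n -> 'rV[R]_n) (h : 'rV[R]_n -> set nat)
  (E Eh : nat -> nat).
Hypotheses (cE : cmp E) (hE : forall x, X x -> answers E x (fun q => rho q (f x))).
Hypotheses (cEh : cmp Eh) (hEh : forall x, X x -> answers Eh x (fun q => h x (q 0%N))).
Hypothesis oX : open X.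
Hypothesis injh : forall x l, X x -> h x l -> inj_on (eball x ((2 ^+ l)^-1) `&` X) f.

Definition inj_c (z : nat) : 'rV[R]_n := vecc n (nthc z 0).
Definition inj_rho (z : nat) : R := qR (nthc z 1).
Definition inj_q (z : nat) (i : 'I_n) : nat := nthc (nthc z 5) i.
Definition inj_t (z : nat) : nat := nthc z 6.
Definition inj_r (z : nat) : R := n.+1%:R * inj_rho z.
Definition inj_l (z : nat) : nat := runm Eh (nthc (nthc z 9)) (nthc z 10) 0.

(* [f] keeps the boundary of the cube at distance [t] from [q] and sends its centre
   closer to [q]; the last three conditions make [f] injective on the cube. *)
Definition inj_check (z : nat) : bool :=
  let N := nthc z 2 in let J := nthc z 3 in let W := nthc z 4 in
  [&& 0 < inj_rho z, gcover E (inj_c z) (1%:M : 'M[R]_n) (inj_rho z) N J W,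
  allb (gbase N ^ n) (fun s => gbnd n N s ==> [exists i : 'I_n,
    qR (inj_t z) + (2 ^+ J)^-1 <= `|@gval R n E W J s 0 i - qR (inj_q z i)|]),
  atomok n E (nthc z 7) (nthc z 8) J (inj_c z) 0,
  [forall i : 'I_n,
    `|@atomval R n E (nthc z 7) (nthc z 8) J 0 i - qR (inj_q z i)| + (2 ^+ J)^-1 < qR (inj_t z)],
  cellok (nthc z 9) (nthc z 10) (inj_c z) 0,
  inj_l z != 0%N &
  n.+1%:R * inj_rho z <= (2 ^+ (inj_l z).-1)^-1].

Lemma cmp_inj_check : cmpb inj_check.
Proof.
have hc i : cmpQ (fun z => inj_c z 0 i) by apply: cmp_vecc; cmpQ_solve.
apply: cmp_and; [|apply: cmp_and; [|apply: cmp_and; [|apply: cmp_and; [|apply: cmp_and; [|apply: cmp_and; [|apply: cmp_and]]]]]].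
all: rewrite /inj_rho /inj_l /inj_t /inj_q /=.
- by cmpQ_solve.
- apply: cmp_cover => //; cmpQ_solve.
  by move=> i k; apply: (@cmpQ_ext _ _ (fun=> (i == k)%:R)) => [z|];
    [rewrite mxE|cmpQ_solve].
- apply: (cmp_allb (P := fun z s => _)) => /=.
    by apply: cmp_exp; [apply: cmp_gbase|]; cmpQ_solve.
  apply: cmp_imp; first by apply: cmp_gbnd; cmpQ_solve.
  by cmpQ_solve; apply: cmp_gval; cmpQ_solve.
- by apply: cmp_atomok => //; cmpQ_solve.
- by cmpQ_solve; apply: cmp_atomval; cmpQ_solve.
- by apply: cmp_cellok => //; cmpQ_solve.
- by cmpQ_solve.
- by cmpQ_solve.
Qed.

(** The prefix extends to a name of [c], so its answer is an element of [h c], though another name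
    may give another element. *)
Lemma modulus_sound w L c : cellok w L c 0 -> runm Eh (nthc w) L 0 != 0%N -> X c ->
  h c (runm Eh (nthc w) L 0).-1.
Proof.
move=> ok; have [p pc wp] : exists2 p, rho p c & forall k, (k < L)%N -> nthc w k = p k.
  by apply: cellok_name ok _; rewrite subrr normr0.
rewrite (eq_runm Eh _ wp); case e : (runm _ _ _ _) => [|y] // _ Xc /=.
have [q [hq hqc]] := hEh Xc pc; have [L' hL'] := hq 0%N.
have := runm_mono e (leq_maxl L L'); have := runm_mono hL' (leq_maxr L L').
by move=> -> [<-].
Qed.

(** Compactness on a shell around [x]. The shell contains the boundary of every cube of radius [s]
    whose centre is within [s / 2] of [x]. *)
Lemma image_separated x s : 0 < s -> (forall y, `|y - x| <= 3 / 2 * s -> X y) ->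
  (forall y, `|y - x| <= 3 / 2 * s -> f y = f x -> y = x) ->
  exists2 eta, 0 < eta & forall y, s / 2 <= `|y - x| <= 3 / 2 * s -> eta <= `|f y - f x|.
Proof.
move=> s0 inX inj.
pose P (d : R) (y : 'rV[R]_n) := s / 2 <= `|y - x| -> d <= `|f y - f x|.
have [|d d0 hd] := @compact_uniform R n _ P (@compact_cube R n x (3 / 2 * s)); last first.
  by exists d => // y /andP[h1 h2]; apply: hd.
move=> y /= hy; have [->|yx] := eqVneq y x.
  by exists (s / 2) => [|z e h1 _]; [lra|rewrite /P leNgt h1].
have F0 : 0 < `|f y - f x|.
  by rewrite normr_gt0 subr_eq0; apply: contraNneq yx => /(inj _ hy)->.
have /contP/(_ (`|f y - f x| / 2)) := computes_continuous hE oX (inX _ hy).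
rewrite divr_gt0 // => /(_ isT)[d d0 hd].
exists (Num.min d (`|f y - f x| / 2)); first by rewrite lt_min d0 divr_gt0.
move=> z e; rewrite lt_min => /andP[/hd h1 _] /andP[_]; rewrite le_min => /andP[_ h2] _.
have := ler_distD (f z) (f y) (f x); rewrite (distrC (f y) (f z)).
by move: (`|f y - f x|) (`|f z - f y|) (`|f z - f x|) h1 h2 => A B C; lra.
Qed.

(** Soundness is [injective_image_cube], with injectivity supplied by the answer for [h] at the
    centre. Completeness takes [q] near [f x] and uses [image_separated] on the boundary. *)
Lemma eff_open_locally_injective : eff_open X f.
Proof.
apply: (@eff_open_crit R n n X f inj_check inj_c inj_r inj_q inj_t).
- exact: cmp_inj_check.
- by move=> i; apply: cmp_vecc; cmpQ_solve.
- by rewrite /inj_r /inj_rho; cmpQ_solve.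
- by move=> i; rewrite /inj_q; cmpQ_solve.
- by rewrite /inj_t; cmpQ_solve.
- move=> z /and5P[rho0 cov /allbP ok okc /and4P[/forallP cen okl l0 hl]] r0 BX y hy.
  set c := inj_c z in cov okc okl BX *; set r := inj_rho z in rho0 cov hl *.
  have cB u : `|u| <= r -> eball c (inj_r z) (c + u).
    move=> hu; apply: eball_small; first exact: r0.
    by rewrite addrC addKr (le_trans hu) // /inj_r mulrAC divff ?pnatr_eq0 // mul1r.
  have inX u : `|u| <= r -> X (c + u) by move=> /cB/BX.
  have Xc : X c by rewrite -[c]addr0; apply: inX; rewrite normr0 ltW.
  have inj := injh Xc (modulus_sound okl l0 Xc).
  have cF : continuous (fun u => f (c + clampv r u)).
    have := @affine_clamp_cont R n n f c 1%:M r rho0.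
    rewrite (_ : (fun u => f (c + clampv r u *m 1%:M)) = fun u => f (c + clampv r u)); last first.
      by apply/funext => u; rewrite mulmx1.
    apply=> u hu; rewrite mulmx1; exact: (computes_continuous hE oX (inX _ hu)).
  have [|u hu|||u hu <-] := @injective_image_cube R n _ r (qR (inj_t z)) (qv (inj_q z)) y rho0 cF.
  + have eb u : `|u| <= r -> (eball c ((2 ^+ (inj_l z).-1)^-1) `&` X) (c + u).
      move=> hu; split; last exact: inX.
      apply: eball_small; first exact: expr2V_gt0.
      by rewrite addrC addKr (le_trans hu) // ler_pdivlMr // mulrC.
    move=> u v hu hv; rewrite !clampv_id // => e.
    by apply: (addrI c); apply: inj => //; apply: eb.
  + rewrite clampv_id; last by rewrite hu.
    have [n0|n0] := posnP n.
      have : `|u| = 0 by apply/eqP; rewrite normr_eq0; apply/eqP/rowP => i;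
        have := leq_trans (ltn_ord i) (eq_leq n0).
      by rewrite hu => e; move: rho0; rewrite e ltxx.
    have [i ui] := rV_norm_attained u n0.
    have [|||s [sb bs hs _]] := cover_sound hE cov rho0 (u := u).
    * by rewrite hu.
    * by rewrite mulmx1; apply: inX; rewrite hu.
    * by exists i; rewrite -ui.
    rewrite mulmx1 in hs.
    have /implyP/(_ bs)/existsP[k hk] := ok s sb.
    have := rV_norm_coordB (f (c + u)) (qv (inj_q z)) k; rewrite [qv _ 0 k]mxE.
    have := le_trans (rV_norm_coordB _ _ k) hs.
    have := ler_distD (f (c + u) 0 k) (gval n E (nthc z 4) (nthc z 3) s 0 k) (qR (inj_q z k)).
    move: hk; rewrite (distrC (gval _ _ _ _ _ 0 k) (f _ 0 k)).
    move: (`|f (c + u) - _|) (f (c + u) 0 k) (gval _ _ _ _ _ 0 k) (qR (inj_q z k)) (qR (inj_t z)).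
    move: ((2 ^+ nthc z 3)^-1) => p b F v q t; clear -R.
    by move: (`|v - q|) (`|F - v|) (`|F - q|) => *; lra.
  + rewrite clampv_id ?normr0 ?(ltW rho0) // addr0; apply: rV_norm_lt => [|i]; first by case: hy.
    have := atom_sound hE okc Xc; rewrite subrr normr0 lexx => /(_ isT).
    move=> /(le_trans (rV_norm_coordB _ _ i)); have := cen i.
    have := ler_distD (@atomval R n E (nthc z 7) (nthc z 8) (nthc z 3) 0 i) (f c 0 i) (qR (inj_q z i)).
    have -> : (f c - qv (inj_q z)) 0 i = f c 0 i - qR (inj_q z i) by rewrite 2!mxE [qv _ 0 i]mxE.
    move: (f c 0 i) (atomval _ _ _ _ _ 0 i) (qR (inj_q z i)) (qR (inj_t z)) ((2 ^+ nthc z 3)^-1).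
    move=> F v q t p; clear -R; rewrite (distrC v q) (distrC F q).
    by move: (`|q - v|) (`|F - v|) (`|q - F|) => *; lra.
  + apply: rV_norm_lt => [|i]; first by case: hy.
    by have := eball_cube i hy; rewrite !mxE.
  exists (c + u); first exact: cB.
  by rewrite clampv_id.
move=> x e e0 inX; have Xx : X x by apply: inX; rewrite subrr normr0 ltW.
(* A prefix answered at [x] also begins names of all nearby centres [c], so the same [l] belongs to
   [h c]. *)
have [w9 [L9 [d9 d90 [/(_ 0%N) l0 ok9]]]] := prefix_complete [:: 0%N] (hEh Xx).
have {}l0 : runm Eh (nthc w9) L9 0 != 0%N by apply: l0; rewrite inE.
set l := (runm Eh (nthc w9) L9 0).-1.
have hl : h x l.
  by apply: modulus_sound => //; apply: ok9; rewrite subrr normr0 addr0 ltW.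
have inj := injh Xx hl.
pose top : R := Num.min e ((2 ^+ l)^-1) / (2 * n.+1%:R).
have [r' /andP[r0 rtop]] := @qR_between R 0 top
  ltac:(by rewrite divr_gt0 ?mulr_gt0 // lt_min e0 expr2V_gt0).
set r := qR r' in r0 rtop.
have {rtop} [re rl] : n.+1%:R * (2 * r) <= e /\ n.+1%:R * (2 * r) <= (2 ^+ l)^-1.
  move: rtop; rewrite ltr_pdivlMr ?mulr_gt0 // lt_min => /andP[/ltW h1 /ltW h2].
  by rewrite mulrCA mulrA mulrC.
have r2e : 2 * r <= e.
  by apply: le_trans re; rewrite ler_peMl ?ler1n // mulr_ge0 // ltW.
have near y : `|y - x| <= 2 * r -> (eball x ((2 ^+ l)^-1) `&` X) y.
  move=> hy; split; last by apply: inX; apply: le_trans r2e.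
  apply: eball_small; first exact: expr2V_gt0.
  by rewrite (le_trans hy) // ler_pdivlMr // mulrC.
have xnear : (eball x ((2 ^+ l)^-1) `&` X) x.
  by apply: near; rewrite subrr normr0 mulr_ge0 // ltW.
have near' y : `|y - x| <= 3 / 2 * r -> `|y - x| <= 2 * r by move=> hy; apply: (le_trans hy); lra.
have [|y hy fy|eta eta0 heta] := @image_separated x r r0.
- by move=> y /near'/near[].
- by apply: inj => //; apply/near/near'.
(* Two errors of [eta / 16] separate the computed values from those relative to [f x]: boundary
   values stay beyond [t < eta / 2], the centre value within [t > eta / 4]. *)
have [J hJ] := @expr2V_small R (eta / 16) ltac:(lra).
have [w7 [L7 [d7 d70 ok7]]] := atom_complete hE J Xx.
have [t /andP[t0 tT]] := @qR_between R (eta / 4) (eta / 2) ltac:(lra).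
have [qw hq] := @vecc_dense R n (f x) (eta / 16 / n.+1%:R) ltac:(by rewrite !divr_gt0).
have qn : eta / 16 / n.+1%:R <= eta / 16.
  by rewrite ler_pdivrMr // ler_peMr ?ler1n // divr_ge0 // ltW.
have [wc hc] := @vecc_dense R n x (Num.min (r / 2) (Num.min d7 d9))
  ltac:(by rewrite !lt_min d70 d90 divr_gt0).
set c := vecc n wc in hc.
move: hc; rewrite !lt_min => /and3P[/ltW cx /ltW c7 /ltW c9].
have shell (u : 'rV[R]_n) : `|u| <= r -> `|c + u - x| <= 3 / 2 * r.
  move=> hu; rewrite addrAC (le_trans (ler_normD _ _)) //.
  by move: (`|c - x|) (`|u|) cx hu => a b; lra.
have [N [W [cov hval]]] : exists N W, gcover E c (1%:M : 'M[R]_n) r N J W /\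
    forall s, (s < gbase N ^ n)%N -> gbnd n N s ->
      `|f (c + gridu n r N s *m 1%:M) - gval n E W J s| <= (2 ^+ J)^-1.
  apply: (cover_complete hE J r0) => u hu; rewrite mulmx1.
  by have [] := near _ (near' _ (shell u hu)).
pose z := lcode [:: wc; r'; N; J; W; qw; t; w7; L7; w9; L9].
have zc : inj_c z = c by rewrite /inj_c nthcE.
have zr : inj_rho z = r by rewrite /inj_rho nthcE.
have zl : (inj_l z).-1 = l by rewrite /inj_l !nthcE.
have zq : qv (inj_q z) = vecc n qw :> 'rV[R]_n.
  by apply/rowP => i; rewrite !mxE /inj_q nthcE.
have zt : inj_t z = t by rewrite /inj_t nthcE.
have zqi i : qR (inj_q z i) = vecc n qw 0 i :> R by rewrite -zq mxE.
exists z; rewrite /inj_r zr zc zq zt; split.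
- rewrite /inj_check zr zc zl zt; apply/and5P; split=> //.
  + by rewrite !nthcE.
  + apply/allbP => s; rewrite !nthcE /= => sb; apply/implyP => bs; apply/existsP.
    have gr := @gridu_le R n r N s (ltW r0).
    have /existsP[i0 hi0] := bs.
    have n0 : (0 < n)%N by apply: leq_ltn_trans (ltn_ord i0).
    have gr' : r <= `|gridu n r N s|.
      apply: le_trans (rV_norm_coord _ i0).
      have N0 : N.+1%:R != 0 :> R by rewrite pnatr_eq0.
      case/orP: hi0 => /eqP di; rewrite (gridu_coord r di).
        by rewrite mul0r sub0r mulrN1 normrN ler_norm.
      by rewrite natrM mulfK // (_ : 2 - 1 = 1 :> R) ?mulr1 ?ler_norm //; lra.
    (* The grid point has norm at least [r] and [c] is within [r / 2] of [x], so the point lies in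
       the shell. *)
    have far : eta <= `|f (c + gridu n r N s) - f x|.
      apply: heta; rewrite shell // andbT.
      have := ler_normB (c + gridu n r N s - x) (c - x).
      rewrite (_ : c + gridu n r N s - x - (c - x) = gridu n r N s); last first.
        by apply/rowP => i; rewrite [LHS]mxE [(- (c - x)) 0 i]mxE 2!mxE [(c - x) 0 i]mxE [(- x) 0 i]mxE; ring.
      by move: (`|_ - x|) (`|c - x|) (`|gridu _ _ _ _|) cx gr' => a b c'; lra.
    have [i ei] := rV_norm_attained (f (c + gridu n r N s) - f x) n0.
    exists i; rewrite zqi.
    have hs := hval s sb bs; rewrite mulmx1 in hs.
    have := le_trans (rV_norm_coordB _ _ i) hs.
    have := le_trans (rV_norm_coordB _ _ i) (le_trans (ltW hq) qn).
    move: far; rewrite ei [(_ - f x) 0 i]mxE [(- f x) 0 i]mxE.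
    move: (f _ 0 i) (f x 0 i) (gval _ _ _ _ _ 0 i) (vecc n qw 0 i) => a b v q h1 h2 h3.
    have := ler_distD v a b; have := ler_distD q v b.
    by move: (`|a - b|) (`|q - b|) (`|a - v|) (`|v - b|) (`|v - q|) h1 h2 h3 => *; lra.
  + by rewrite !nthcE /=; apply: ok7; rewrite addr0 distrC.
  + apply/and4P; split=> //.
    * apply/forallP => i; rewrite !nthcE /= zqi.
      have := atom_sound hE (ok7 x 0 _) Xx; rewrite subrr normr0 addr0 (ltW d70) lexx.
      move=> /(_ isT isT)/(le_trans (rV_norm_coordB _ _ i)).
      have := le_trans (rV_norm_coordB _ _ i) (le_trans (ltW hq) qn).
      move: (f x 0 i) (atomval _ _ _ _ _ 0 i) (vecc n qw 0 i) => a v q h1 h2.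
      have := ler_distD a v q; rewrite (distrC v a) (distrC a q).
      by move: (`|q - a|) (`|a - v|) (`|v - q|) h1 h2 => *; lra.
    * by rewrite !nthcE /=; apply: ok9; rewrite addr0 distrC.
    * by rewrite /inj_l !nthcE.
    * apply: le_trans rl; rewrite ler_wpM2l //; lra.
- rewrite mulr_gt0 //=; apply: le_trans re; rewrite ler_wpM2l //; lra.
- by apply: (le_trans cx); lra.
- apply: eball_small; first lra.
  rewrite distrC (le_trans (ltW hq)) // ler_pM2r ?invr_gt0 //; lra.
Qed.

End LocallyInjective.

(** * Constant injectivity radii *)

Section InjectivityRadius.
Context {R : realType}.

Lemma computable_mv_const n (X : set 'rV[R]_n) (l : nat) : computable_mv X (fun=> [set l]).
Proof.
have [e he] := cmp_const l.+1; exists e; split; first by move=> x; exists l.+1.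
move=> x p _ _; exists (fun=> l); split=> // o; exists 0%N, l; split; first exact: he.
by split.
Qed.

Lemma computable_fun_sub n m (X Y : set 'rV[R]_n) (f : 'rV[R]_n -> 'rV[R]_m) :
  X `<=` Y -> computable_fun Y f -> computable_fun X f.
Proof. by move=> XY [e [te he]]; exists e; split=> // x p /XY; apply: he. Qed.

Lemma eball_sub n (x y : 'rV[R]_n) (r d : R) : 0 < r -> `|y - x| <= r / n.+1%:R / 2 ->
  d <= r / n.+1%:R / 2 -> eball y d `<=` eball x r.
Proof.
move=> r0 yx dr z /eball_norm zy; apply: eball_small => //.
have := ler_distD y z x; move: (r / n.+1%:R) yx dr => q.
by move: (`|y - x|) (`|z - y|) (`|z - x|) zy => a b c; lra.
Qed.

(** The closure of [X] is compact, and a ball of injectivity contains smaller balls about all points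
    near its centre. *)
Lemma uniform_injectivity_radius n (X : set 'rV[R]_n) (f : 'rV[R]_n -> 'rV[R]_n) :
  bounded_in X -> (forall x, closure X x -> exists r : R, 0 < r /\
    inj_on (eball x r `&` closure X) f) ->
  exists l, forall x, X x -> inj_on (eball x ((2 ^+ l)^-1) `&` X) f.
Proof.
move=> [K hK] linj.
have cX : compact (closure X).
  apply: bounded_closed_compact; last exact: closed_closure.
  have XK : closure X `<=` [set x | `|x - 0| <= `|K|].
    have clK : closed [set x : 'rV[R]_n | `|x - 0| <= `|K|].
      by apply: compact_closed; [exact: norm_hausdorff|exact: compact_cube].
    rewrite [X in _ `<=` X](closure_id _).1 //.
    apply: closure_subset => x Xx /=; rewrite subr0; apply: rV_norm_le => // i.
    by rewrite (le_trans (hK x Xx i)) // ler_norm.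
  exists `|K|; split; first exact: num_real.
  by move=> M KM x /XK /=; rewrite subr0 => hx; rewrite (le_trans hx) // ltW.
pose P (d : R) (x : 'rV[R]_n) := inj_on (eball x d `&` closure X) f.
have [|d d0 hd] := compact_uniform (P := P) cX.
  move=> x /linj[r [r0 inj]].
  have r1 : 0 < r / n.+1%:R / 2 by rewrite !divr_gt0.
  exists (r / n.+1%:R / 2) => // y e yx /andP[_ er].
  have sub := eball_sub r0 (ltW yx) er.
  by move=> a b [/sub ? ?] [/sub ? ?]; apply: inj.
have [l hl] := expr2V_small d0; exists l => x Xx.
have sub : eball x ((2 ^+ l)^-1) `<=` eball x d.
  move=> y [l0 hy]; split=> //; apply: lt_trans hy _.
  by rewrite ltrXn2r ?nnegrE // ltW.
move=> a b [/sub ? /subset_closure ?] [/sub ? /subset_closure ?].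
by apply: (hd x) => //; apply: subset_closure.
Qed.

End InjectivityRadius.

(** * Effective openness in each of the cases *)

Theorem theorem3 (R : realType) :
  (* (a), first sentence: real-valued case *)
  (forall (n : nat) (X : set 'rV[R]_n) (f : 'rV[R]_n -> 'rV[R]_1),
      re_open X -> computable_fun X f -> open_fun X f -> eff_open X f) /\
  (* (a), general case: images of open balls inside X are convex *)
  (forall (n m : nat) (X : set 'rV[R]_n) (f : 'rV[R]_n -> 'rV[R]_m),
      re_open X -> computable_fun X f -> open_fun X f ->
      (forall (c : 'rV[R]_n) (r : R), 0 < r -> eball c r `<=` X ->
         convex_in (f @` eball c r)) ->
      eff_open X f) /\
  (* (b) surjective computable affine maps R^n -> R^m *)
  (forall (n m : nat) (f : 'rV[R]_n -> 'rV[R]_m),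
      (exists (A : 'M[R]_(n, m)) (b : 'rV[R]_m), forall x, f x = x *m A + b) ->
      (forall y, exists x, f x = y) ->
      computable_fun setT f -> eff_open setT f) /\
  (* (c) C^1 with computable derivative of full rank m *)
  (forall (n m : nat) (X : set 'rV[R]_n) (f : 'rV[R]_n -> 'rV[R]_m),
      re_open X -> computable_fun X f ->
      (forall x, X x -> differentiable f x) ->
      (forall x, X x -> {for x, continuous (fun y => lin1_mx ('d f y))}) ->
      computable_fun X (fun x => lin1_mx ('d f x)) ->
      (forall x, X x -> \rank (lin1_mx ('d f x)) = m) ->
      eff_open X f) /\
  (* (d) computable local injectivity radius *)
  (forall (n : nat) (X : set 'rV[R]_n) (f : 'rV[R]_n -> 'rV[R]_n)
          (h : 'rV[R]_n -> set nat),
      re_open X -> computable_fun X f -> computable_mv X h ->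
      (forall x l, X x -> h x l -> inj_on (eball x ((2 ^+ l)^-1) `&` X) f) ->
      eff_open X f) /\
  (* (e) bounded X, f computable and locally injective on closure X *)
  (forall (n : nat) (X : set 'rV[R]_n) (f : 'rV[R]_n -> 'rV[R]_n),
      re_open X -> bounded_in X -> computable_fun (closure X) f ->
      (forall x, closure X x ->
         exists r : R, 0 < r /\ inj_on (eball x r `&` closure X) f) ->
      eff_open X f) /\
  (* (e), second sentence: f computable and globally injective on X *)
  (forall (n : nat) (X : set 'rV[R]_n) (f : 'rV[R]_n -> 'rV[R]_n),
      re_open X -> computable_fun X f -> inj_on X f -> eff_open X f).
Proof.
have cvx n m (X : set 'rV[R]_n) (f : 'rV[R]_n -> 'rV[R]_m) :
    computable_fun X f -> open_fun X f ->
    (forall (c : 'rV[R]_n) (r : R), 0 < r -> eball c r `<=` X ->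
       convex_in (f @` eball c r)) -> eff_open X f.
  move=> /computable_fun_answers[E cE hE]; exact: eff_open_convex cE hE.
have inj n (X : set 'rV[R]_n) (f : 'rV[R]_n -> 'rV[R]_n) (h : 'rV[R]_n -> set nat) :
    re_open X -> computable_fun X f -> computable_mv X h ->
    (forall x l, X x -> h x l -> inj_on (eball x ((2 ^+ l)^-1) `&` X) f) -> eff_open X f.
  move=> /re_open_open oX /computable_fun_answers[E cE hE] /computable_mv_answers[Eh cEh hEh].
  exact: (eff_open_locally_injective cE hE cEh hEh oX).
split; [|split; [|split; [|split; [|split; [|split]]]]].
- move=> n X f /re_open_open oX cf of_; apply: cvx => // c r _ BX.
  have [E _ hE] := computable_fun_answers cf.
  by apply: (convex_image_real _ BX) => x Xx; apply: (computes_continuous hE).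
- by move=> n m X f _; apply: cvx.
- move=> n m f [A [b fE]] sf cf; apply: cvx => //; first exact: affine_open fE sf.
  by move=> c r _ _; apply: affine_convex fE.
- move=> n m X f /re_open_open oX /computable_fun_answers[E cE hE] df _ _ rk.
  apply: (eff_open_submersion cE hE oX) => x Xx; exists (lin1_mx ('d f x)); split.
    (* With row vectors, a derivative of rank [m] is row full, which yields [B] with
       [B *m A = 1]. *)
    by apply/row_fullP; rewrite /row_full rk.
  by move=> eta; apply/diff_eps/df.
- exact: inj.
- move=> n X f rX bX cf linj.
  have [l hl] := uniform_injectivity_radius bX linj.
  (* The uniform radius serves as a constant, hence computable, [h]. *)
  apply: (inj n X f (fun=> [set l]) rX); first exact: computable_fun_sub (@subset_closure _ X) cf.
    exact: computable_mv_const.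
  by move=> x _ Xx ->; apply: hl.
- move=> n X f rX cf injf.
  apply: (inj n X f (fun=> [set 0%N]) rX cf); first exact: computable_mv_const.
  by move=> x _ Xx _ a b [_ Xa] [_ Xb]; apply: injf.
Qed.
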